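(* Let $n\ge2$. Then, as sets of products in the group $(1+\mathfrak p_n)^*=\mathrm{GL}_\infty(\mathbb S_{n-1})$, $$\mathrm{GL}_\infty(\mathbb S_{n-1})=(1+\mathfrak p_n)^*=\widetilde{\mathcal E}_{n,1}\widetilde\Theta_{n,2}\widetilde{\mathcal E}_{n,2}\cdots\widetilde\Theta_{n,n-1}\widetilde{\mathcal E}_{n,n-1}.$$ Moreover, for $2\le s\le n-1$, $(1+\mathfrak p_n)^*_s=\widetilde\Theta_{n,s}\widetilde{\mathcal E}_{n,s}\cdots\widetilde\Theta_{n,n-1}\widetilde{\mathcal E}_{n,n-1}$, and $(1+\mathfrak p_n)^*_n=(1+F_n)^*$.
   Context: $K$ is a field, $\mathbb N=\{0,1,\dots\}$. $\mathbb S_n$ is the $K$-algebra generated by $x_1,\dots,x_n,y_1,\dots,y_n$ with relations $y_ix_i=1$ and $[x_i,y_j]=[x_i,x_j]=[y_i,y_j]=0$ ($i\ne j$). $E_{st}(i):=x_i^sy_i^t-x_i^{s+1}y_i^{t+1}$, $e_i:=E_{00}(i)$, $e_I:=\prod_{i\in I}e_i$; for $\alpha,\beta\in\mathbb N^I$, $E_{\alpha\beta}(I):=\prod_{i\in I}E_{\alpha_i\beta_i}(i)$. $\theta_{ij}(J):=(1+(y_i-1)e_{J\setminus\{i\}})(1+(x_j-1)e_{J\setminus\{j\}})$ for $|J|\ge2$, $i\ne j\in J$. $\mathfrak p_i$ is the ideal of $\mathbb S_n$ generated by $e_i$, $\mathfrak p_I:=\prod_{i\in I}\mathfrak p_i$,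 $\mathfrak a_{n,s}:=\sum_{|I|=s}\mathfrak p_I$, $F_n:=\mathfrak p_{\{1,\dots,n\}}$; $(1+\mathfrak b)^*$ is the group of units of $\mathbb S_n$ in $1+\mathfrak b$; $(1+\mathfrak p_n)^*_s:=(1+\mathfrak p_n)^*\cap(1+\mathfrak a_{n,s})^*$. $\mathrm{GL}_\infty(\mathbb S_{n-1})$ ($\mathbb S_{n-1}$ = subalgebra generated by $x_k,y_k$, $k<n$) is identified with $(1+\mathfrak p_n)^*$ via $(a_{kl})\mapsto 1+\sum(a_{kl}-\delta_{kl})E_{kl}(n)$. For $I\subseteq\{1,\dots,n\}$: $\mu_I(\lambda):=\lambda e_I+1-e_I$, $U_I(K):=\{\mu_I(\lambda):\lambda\in K^*\}$; $CI$ is the complement of $I$, $\mathbb S_{CI}$ the subalgebra generated by $x_k,y_k$, $k\in CI$; $E_\infty(\mathbb S_{CI})$ the subgroup of $\mathbb S_n^*$ generated by $1+aE_{\alpha\beta}(I)$, $a\in\mathbb S_{CI}$, $\alpha\ne\beta\in\mathbb N^I$. For $1\le s\le n-1$, $\widetilde{\mathcal E}_{n,s}$ is the set of products $g_1\cdots g_r$ where $I_1,\dots,I_r$ are all subsets with $|I|=s$ and $n\in I$, listed in a fixed order, and $g_k\in U_{I_k}(K)E_\infty(\mathbb S_{CI_k})$. For $2\le s\le n-1$, $\widetilde\Theta_{n,s}$ is the set of products, in a fixed order, $\prod_J\prod_{j}\theta_{m(J),j}(J)^{n(j,J)}$ with $n(j,J)\in\mathbb Z$, where $J$ ranges over subsets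 with $|J|=s+1$, $n\in J$, $m(J):=\max(J\setminus\{n\})$, and $j\in J\setminus\{n,m(J)\}$. A product $A_1A_2\cdots A_r$ of subsets denotes $\{a_1\cdots a_r: a_k\in A_k\}$. *)

(* Defs.v *)
(* Model of the Jacobian algebra S_n over a field K as the
   monoid algebra of the n-th power of the bicyclic monoid <x,y | yx = 1>:
   the K-basis x^alpha y^beta (alpha, beta in N^n), with the multiplication
   induced by the defining relations.  Variables are indexed 0..n-1, so the
   paper's variable i corresponds to index i-1; the paper's "n" is n.-1. *)
From Stdlib Require Import ClassicalEpsilon.
From HB Require Import structures.
From mathcomp Require Import all_boot all_order all_algebra.
Set Implicit Arguments.
Unset Strict Implicit.
Unset Printing Implicit Defensive.
Import GRing.Theory.
Local Open Scope ring_scope.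

Section Jacobian.
Variables (K : fieldType) (n : nat).

(* monomials x^alpha y^beta *)
Definition mono := ({ffun 'I_n -> nat} * {ffun 'I_n -> nat})%type.

(* product in the bicyclic monoid (coordinatewise):
   x^a y^b x^c y^d = x^(a + (c-b)) y^((b-c) + d), truncated subtraction *)
Definition mmul (u v : mono) : mono :=
  ([ffun i => (u.1 i + (v.1 i - u.2 i))%N],
   [ffun i => ((u.2 i - v.1 i) + v.2 i)%N]).

Definition mone : mono := ([ffun => 0%N], [ffun => 0%N]).

(* elements: coefficient functions; those with finite support form S_n *)
Definition elem := mono -> K.

Definition Sn (f : elem) : Prop := exists s : seq mono, forall m, f m != 0 -> m \in s.

Definition supp (f : elem) : seq mono :=
  match excluded_middle_informative (Sn f) with
  | left H => proj1_sig (constructive_indefinite_description _ H)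
  | right _ => [::]
  end.

Definition zero : elem := fun _ => 0.
Definition one : elem := fun m => if m == mone then 1 else 0.
Definition add (f g : elem) : elem := fun m => f m + g m.
Definition opp (f : elem) : elem := fun m => - f m.
Definition scale (c : K) (f : elem) : elem := fun m => c * f m.
Definition mul (f g : elem) : elem := fun m =>
  \sum_(a <- undup (supp f)) \sum_(b <- undup (supp g))
     (if mmul a b == m then f a * g b else 0).
Definition mon (a : mono) : elem := fun m => if m == a then 1 else 0.

Definition pow (f : elem) (k : nat) : elem := iter k (mul f) one.

Definition isunit (u : elem) : Prop :=
  Sn u /\ exists v, Sn v /\ mul u v = one /\ mul v u = one.

(* inverse of a unit (junk value otherwise) *)
Definition inv (f : elem) : elem :=
  match excluded_middle_informative
          (exists g, Sn g /\ mul f g = one /\ mul g f = one) with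
  | left H => proj1_sig (constructive_indefinite_description _ H)
  | right _ => f
  end.

Definition zpow (f : elem) (z : int) : elem :=
  match z with Posz k => pow f k | Negz k => pow (inv f) k.+1 end.

(* generators x_k, y_k (0-based index k) *)
Definition xg (k : nat) : elem :=
  mon ([ffun i : 'I_n => nat_of_bool (val i == k)], [ffun => 0%N]).
Definition yg (k : nat) : elem :=
  mon ([ffun => 0%N], [ffun i : 'I_n => nat_of_bool (val i == k)]).

Definition Est (s t k : nat) : elem :=
  add (mul (pow (xg k) s) (pow (yg k) t))
      (opp (mul (pow (xg k) s.+1) (pow (yg k) t.+1))).
Definition eg (k : nat) : elem := Est 0 0 k.
Definition eI (I : {set 'I_n}) : elem := \big[mul/one]_(i in I) eg (val i).
Definition EI (alpha beta : 'I_n -> nat) (I : {set 'I_n}) : elem :=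
  \big[mul/one]_(i in I) Est (alpha i) (beta i) (val i).

Definition theta (i j : nat) (J : {set 'I_n}) : elem :=
  mul (add one (mul (add (yg i) (opp one)) (eI (J :\: [set t | val t == i]))))
      (add one (mul (add (xg j) (opp one)) (eI (J :\: [set t | val t == j])))).

Inductive idealg (g : elem) : elem -> Prop :=
| ig0 : idealg g zero
| igS f a b : idealg g f -> Sn a -> Sn b -> idealg g (add f (mul (mul a g) b)).

Inductive idprod (A B : elem -> Prop) : elem -> Prop :=
| ip0 : idprod A B zero
| ipS f a b : idprod A B f -> A a -> B b -> idprod A B (add f (mul a b)).

Definition p_ (k : nat) : elem -> Prop := idealg (eg k).
Definition pI (I : {set 'I_n}) : elem -> Prop :=
  foldr (fun i acc => idprod (p_ (val i)) acc) Sn (enum I).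

Inductive asum (s : nat) : elem -> Prop :=
| as0 : asum s zero
| asS f (I : {set 'I_n}) a : asum s f -> #|I| = s -> pI I a -> asum s (add f a).

Definition Fn : elem -> Prop := pI setT.

Definition oneplus (B : elem -> Prop) (u : elem) : Prop :=
  isunit u /\ B (add u (opp one)).

(* (1 + p_n)^*  (the paper's p_n is p_ n.-1 in 0-based indexing) *)
Definition unitsP : elem -> Prop := oneplus (p_ n.-1).
Definition unitsPs (s : nat) (u : elem) : Prop :=
  unitsP u /\ oneplus (asum s) u.

Definition mu (I : {set 'I_n}) (l : K) : elem :=
  add (add (scale l (eI I)) one) (opp (eI I)).
Definition UI (I : {set 'I_n}) (u : elem) : Prop :=
  exists l : K, l != 0 /\ u = mu I l.

Inductive subalg (G : elem -> Prop) : elem -> Prop :=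
| sa_gen g : G g -> subalg G g
| sa_one : subalg G one
| sa_scale c f : subalg G f -> subalg G (scale c f)
| sa_add f g : subalg G f -> subalg G g -> subalg G (add f g)
| sa_mul f g : subalg G f -> subalg G g -> subalg G (mul f g).

Definition SC (I : {set 'I_n}) : elem -> Prop :=
  subalg (fun g => exists t : 'I_n, t \notin I /\ (g = xg (val t) \/ g = yg (val t))).

Inductive gengroup (G : elem -> Prop) : elem -> Prop :=
| gg1 : gengroup G one
| ggg g h : G g -> gengroup G h -> gengroup G (mul g h)
| ggi g gi h : G g -> Sn gi -> mul g gi = one -> mul gi g = one ->
               gengroup G h -> gengroup G (mul gi h).

Definition Einf (I : {set 'I_n}) : elem -> Prop :=
  gengroup (fun u => exists (a : elem) (alpha beta : 'I_n -> nat),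
     SC I a /\ (exists i, i \in I /\ alpha i <> beta i) /\
     u = add one (mul a (EI alpha beta I))).

Definition prodset (A B : elem -> Prop) (u : elem) : Prop :=
  exists a b, A a /\ B b /\ u = mul a b.

Definition singl1 (u : elem) : Prop := u = one.

Definition lastin (I : {set 'I_n}) : bool := [exists t in I, val t == n.-1].

Definition mJ (J : {set 'I_n}) : nat := (\max_(t in J | val t != n.-1) val t)%N.

(* tilde E_{n,s}, the subsets being listed by the sequence L *)
Definition Etil (L : seq {set 'I_n}) : elem -> Prop :=
  foldr (fun I acc => prodset (prodset (UI I) (Einf I)) acc) singl1 L.

(* tilde Theta_{n,s}: the J's listed by LJ, and for each J the j's by Lj J *)
Definition Thtil (LJ : seq {set 'I_n}) (Lj : {set 'I_n} -> seq 'I_n) : elem -> Prop :=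
  foldr (fun J acc =>
     prodset (foldr (fun j acc' =>
                prodset (fun u => exists z : int, u = zpow (theta (mJ J) (val j) J) z) acc')
              singl1 (Lj J)) acc) singl1 LJ.

Fixpoint tailF (ordE ordJ : nat -> seq {set 'I_n}) (Lj : {set 'I_n} -> seq 'I_n)
    (k s : nat) : elem -> Prop :=
  match k with
  | 0 => singl1
  | k'.+1 => prodset (Thtil (ordJ s) Lj)
               (prodset (Etil (ordE s)) (tailF ordE ordJ Lj k' s.+1))
  end.

End Jacobian.

(* Main.v *)
(* Let F be the field K(t_1,...,t_n).  For a subset I, S_n acts on functions
   N^I -> F: x_i, y_i (i in I) act by shifts and x_j, y_j (j not in I) by
   t_j, t_j^-1.  The ideals p_n, a_{n,s}, F_n are the common kernels of families
   of these representations, so (1+p_n)^*_s consists of the units acting as the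
   identity whenever |I| < s or n is not in I.  On the first layer |I| = s such a
   unit acts as an invertible finite matrix over the Laurent ring in the t_j
   (j not in I), with determinant a scalar times a monomial in the t_j.
   The theta's remove all but one exponent for each J with |J| = s+1, and the
   last one vanishes because it is the Fredholm index of an invertible operator.
   A determinant one matrix over a Laurent polynomial ring is stably elementary
   (Suslin), so U_I E_infty(S_CI) removes what is left and the unit descends to
   the next layer.  The last layer 1+F_n is absorbed by E_infty(S_CI) for
   |I| = n-1: by commutators, and by Whitehead's lemma for U_{1..n}.

   Stable elementarity is proved by induction on the number of variables.  Over
   K(t) instead of K the induction hypothesis leaves a polynomial denominator
   f(t); replacing t by a companion matrix C with f(C) invertible turns this into
   a factorisation without denominators, and comparison with a block triangular
   companion matrix having t as a diagonal block gives the claim. *)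
From Stdlib Require Import ClassicalEpsilon.
From HB Require Import structures.
From mathcomp Require Import all_boot all_order all_algebra all_fingroup.
From mathcomp Require Import boolp.
From mathcomp Require Import ring zify.
Require Import Defs.
Set Implicit Arguments.
Unset Strict Implicit.
Unset Printing Implicit Defensive.

(** * Elementary matrices over subrings of a field *)

(** All coefficient rings are subsets of one large field, given by predicates: passing from $K$ to
    $K(t)$ changes a predicate but no type. Transcendence of the $t_j$ turns equality of operators
    into equality in $\mathbb S_n$. That common kernels lie in the ideals follows from a partition
    of unity: expanding the product over $i$ of $(1-x_i^Dy_i^D)+x_i^Dy_i^D$ writes 1 as a sum over
    subsets $I$. An element with exponents at most $D$ that acts as 0 in the representation of $I$
    annihilates the term of $I$, and the terms that survive contain factors $1-x_i^Dy_i^D$, which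
    lie in $\mathfrak p_i$. The companion matrices belong to $(X-t)(X^d+1)-\xi$. In the basis
    $1,\dots,X^{d-1},X^d+1$ the case $\xi=0$ is block triangular, with $t$ in the corner and an
    integral block beside it. For $f(C)$ to be invertible, $\xi=X^cx$ is chosen so that the
    polynomial becomes $fk+X^c$, which is possible because $f(0)$ is invertible. For large $c$ and
    $d$ both matrices act as the same shift away from the ends, so the two specialisations differ in
    a middle window only. *)

Section Elementary.
Import GRing.Theory.
Local Open Scope ring_scope.

(** Index sets carry no order, so enlarging them, merging them or taking products needs no
    arithmetic on indices. The set may be empty, hence a ring structure that admits the trivial
    ring. *)
Definition sqm (F : Type) (I : finType) := I -> I -> F.

Section SqmRing.
Variables (F : fieldType) (I : finType).
Implicit Types A B C : sqm F I.
Definition sqm_add A B : sqm F I := fun i j => A i j + B i j.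
Definition sqm_opp A : sqm F I := fun i j => - A i j.
Definition sqm_zero : sqm F I := fun _ _ => 0.
Definition sqm_one : sqm F I := fun i j => (i == j)%:R.
Definition sqm_mul A B : sqm F I := fun i k => \sum_j A i j * B j k.

Lemma sqmP A B : (forall i j, A i j = B i j) -> A = B.
Proof. by move=> h; apply: funext => i; apply: funext => j. Qed.

Fact sqm_addA : associative sqm_add.
Proof. by move=> A B C; apply: sqmP => i j; rewrite /sqm_add addrA. Qed.
Fact sqm_addC : commutative sqm_add.
Proof. by move=> A B; apply: sqmP => i j; rewrite /sqm_add addrC. Qed.
Fact sqm_add0 : left_id sqm_zero sqm_add.
Proof. by move=> A; apply: sqmP => i j; rewrite /sqm_add add0r. Qed.
Fact sqm_addN : left_inverse sqm_zero sqm_opp sqm_add.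
Proof. by move=> A; apply: sqmP => i j; rewrite /sqm_add addNr. Qed.

HB.instance Definition _ := Choice.copy (sqm F I) (I -> I -> F).
HB.instance Definition _ := GRing.isZmodule.Build (sqm F I)
  sqm_addA sqm_addC sqm_add0 sqm_addN.

Fact sqm_mulA : associative sqm_mul.
Proof.
move=> A B C; apply: sqmP => i j; rewrite /sqm_mul.
under eq_bigr do rewrite big_distrr /=.
rewrite exchange_big /=; apply: eq_bigr => k _; rewrite big_distrl /=.
by apply: eq_bigr => l _; rewrite mulrA.
Qed.
Fact sqm_mul1 : left_id sqm_one sqm_mul.
Proof.
move=> A; apply: sqmP => i j; rewrite /sqm_mul (bigD1 i) //= /sqm_one eqxx mul1r.
by rewrite big1 ?addr0 // => k /negPf; rewrite eq_sym => ->; rewrite mul0r.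
Qed.
Fact sqm_mulr1 : right_id sqm_one sqm_mul.
Proof.
move=> A; apply: sqmP => i j; rewrite /sqm_mul (bigD1 j) //= /sqm_one eqxx mulr1.
by rewrite big1 ?addr0 // => k /negPf ->; rewrite mulr0.
Qed.
Fact sqm_mulDl : left_distributive sqm_mul sqm_add.
Proof.
move=> A B C; apply: sqmP => i j; rewrite /sqm_mul /sqm_add -big_split /=.
by apply: eq_bigr => k _; rewrite mulrDl.
Qed.
Fact sqm_mulDr : right_distributive sqm_mul sqm_add.
Proof.
move=> A B C; apply: sqmP => i j; rewrite /sqm_mul /sqm_add -big_split /=.
by apply: eq_bigr => k _; rewrite mulrDr.
Qed.
HB.instance Definition _ := GRing.Zmodule_isPzRing.Build (sqm F I)
  sqm_mulA sqm_mul1 sqm_mulr1 sqm_mulDl sqm_mulDr.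

Lemma sqm_addE A B i j : (A + B) i j = A i j + B i j. Proof. by []. Qed.
Lemma sqm_oppE A i j : (- A) i j = - A i j. Proof. by []. Qed.
Lemma sqm_zeroE i j : (0 : sqm F I) i j = 0. Proof. by []. Qed.
Lemma sqm_oneE i j : (1 : sqm F I) i j = (i == j)%:R. Proof. by []. Qed.
Definition sqmE := (sqm_addE, sqm_oppE, sqm_zeroE, sqm_oneE).
Lemma sqm_mulE A B i j : (A * B) i j = \sum_k A i k * B k j.
Proof. by []. Qed.
Lemma sqm_sumE (T : Type) (r : seq T) (P : pred T) (f : T -> sqm F I) i j :
  (\sum_(x <- r | P x) f x) i j = \sum_(x <- r | P x) f x i j.
Proof.
by elim/big_ind2: _ => // A a B b <- <-.
Qed.
End SqmRing.

Section Emb.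
Variable F : fieldType.

Definition de (I : finType) (i j : I) (a : F) : sqm F I :=
  fun k l => ((k == i) && (l == j))%:R * a.

Definition emb (I J : finType) (f : I -> J) (X : sqm F I) : sqm F J :=
  fun k l => \sum_i \sum_j ((f i == k) && (f j == l))%:R * X i j.

(** The block sum with an identity matrix, the form in which every stabilisation appears. Writing it
    through [emb] reduces its multiplicativity to that of extension by zero. *)
Definition ext (I J : finType) (f : I -> J) (A : sqm F I) : sqm F J := 1 + emb f (A - 1).

Lemma embf (I J : finType) (f : I -> J) (X : sqm F I) i j : injective f -> emb f X (f i) (f j) = X i j.
Proof.
move=> inj; rewrite /emb (bigD1 i) //= (bigD1 j) //= !eqxx mul1r.
rewrite !big1 ?addr0 //.
- move=> k /negPf ki; rewrite big1 // => l _.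
  by rewrite (inj_eq inj) ki mul0r.
- by move=> l /negPf ki; rewrite (inj_eq inj) ki andbF mul0r.
Qed.
Lemma emb_out (I J : finType) (f : I -> J) (X : sqm F I) k l :
  (forall i, f i <> k) \/ (forall i, f i <> l) -> emb f X k l = 0.
Proof.
move=> h; rewrite /emb big1 // => i _; rewrite big1 // => j _.
by case: h => h; [have /eqP/negPf -> := h i|have /eqP/negPf -> := h j; rewrite andbF]; rewrite mul0r.
Qed.

Lemma in_img (I J : finType) (f : I -> J) k : (exists i, k = f i) \/ (forall i, f i <> k).
Proof.
case: (pickP (fun i => f i == k)) => [i /eqP <-|h]; first by left; exists i.
by right => i /eqP; rewrite h.
Qed.

Lemma embP (I J : finType) (f : I -> J) (X : sqm F I) (Y : sqm F J) : injective f ->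
  (forall i j, X i j = Y (f i) (f j)) ->
  (forall k l, (forall i, f i <> k) \/ (forall i, f i <> l) -> Y k l = 0) ->
  emb f X = Y.
Proof.
move=> inj h1 h2; apply: sqmP => k l.
have [[i ->]|hk] := in_img f k; last by rewrite emb_out ?h2 //; left.
have [[j ->]|hl] := in_img f l; last by rewrite emb_out ?h2 //; right.
by rewrite embf.
Qed.

Lemma embD (I J : finType) (f : I -> J) (X Y : sqm F I) : emb f (X + Y) = emb f X + emb f Y.
Proof.
apply: sqmP => k l; rewrite sqmE /emb -big_split /=; apply: eq_bigr => i _.
by rewrite -big_split /=; apply: eq_bigr => j _; rewrite mulrDr.
Qed.
Lemma embN (I J : finType) (f : I -> J) (X : sqm F I) : emb f (- X) = - emb f X.
Proof.
apply: sqmP => k l; rewrite sqmE /emb -sumrN; apply: eq_bigr => i _.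
by rewrite -sumrN; apply: eq_bigr => j _; rewrite mulrN.
Qed.
Lemma embB (I J : finType) (f : I -> J) (X Y : sqm F I) : emb f (X - Y) = emb f X - emb f Y.
Proof. by rewrite embD embN. Qed.
Lemma emb0 (I J : finType) (f : I -> J) : emb f 0 = 0.
Proof. by rewrite -(subrr 0) embB subrr. Qed.

Lemma embM (I J : finType) (f : I -> J) (X Y : sqm F I) : injective f ->
  emb f (X * Y) = emb f X * emb f Y.
Proof.
move=> inj; apply: embP => // [i j|k l h].
  rewrite !sqm_mulE [RHS](bigID (fun k => [exists x, f x == k])) /=.
  rewrite [X in _ = _ + X]big1 ?addr0; last first.
    move=> k /existsPn hk; rewrite emb_out ?mul0r //.
    by right => x; apply/eqP/hk.
  (* The image of [f] is reindexed by [I] through the partial inverse that [pick] supplies. *)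
  rewrite (reindex_omap f (fun k => [pick x | f x == k])) /=.
    apply: eq_big => [x|x _]; last by rewrite !embf.
    case: pickP => [y /eqP/inj ->|/(_ x)]; rewrite ?eqxx ?andbT //.
    by apply/esym/existsP; exists x.
  move=> k /existsP[x /eqP <-]; case: pickP => [y /eqP /inj -> //|/(_ x)].
  by rewrite eqxx.
rewrite sqm_mulE big1 // => m _; case: h => h.
  by rewrite (@emb_out _ _ f X k m) ?mul0r //; left.
by rewrite (@emb_out _ _ f Y m l) ?mulr0 //; right.
Qed.

Lemma emb_comp (I J L : finType) (f : I -> J) (g : J -> L) (X : sqm F I) :
  injective f -> injective g -> emb g (emb f X) = emb (g \o f) X.
Proof.
move=> fi gi; apply/esym/embP => [|i j|k l h]; first exact: inj_comp.
  by rewrite /= !embf.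
have [[k' ek]|hk] := in_img g k; last by apply: emb_out; left.
have [[l' el]|hl] := in_img g l; last by apply: emb_out; right.
rewrite ek el embf // emb_out //.
by case: h => h; [left|right] => i e; apply: (h i); rewrite /= e.
Qed.

Lemma emb_de (I J : finType) (f : I -> J) i j a : injective f -> emb f (de i j a) = de (f i) (f j) a.
Proof.
move=> inj; apply: embP => // [k l|k l h]; rewrite /de ?(inj_eq inj) //.
case: eqP => [e|_] //=; last by rewrite mul0r.
case: eqP => [e'|_] /=; last by rewrite mul0r.
by case: h => h; [case: (h i)|case: (h j)].
Qed.

Lemma deM (I : finType) (i j k l : I) a b :
  de i j a * de k l b = (if j == k then de i l (a * b) else 0).
Proof.
apply: sqmP => x y; rewrite sqm_mulE (bigD1 j) //= big1 ?addr0; last first.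
  by move=> z /negPf h; rewrite /de h andbF !mul0r.
rewrite /de eqxx andbT; case: (j =P k) => _ /=; last by rewrite mul0r mulr0.
by case: (x == i); case: (y == l); rewrite /= ?(mul0r, mulr0, mul1r).
Qed.
Lemma deD (I : finType) (i j : I) a b : de i j (a + b) = de i j a + de i j b.
Proof. by apply: sqmP => x y; rewrite sqmE /de mulrDr. Qed.
Lemma de0 (I : finType) (i j : I) : de i j 0 = 0.
Proof. by apply: sqmP => x y; rewrite /de mulr0. Qed.

Lemma ext1 (I J : finType) (f : I -> J) : ext f 1 = 1.
Proof. by rewrite /ext subrr emb0 addr0. Qed.
Lemma extM (I J : finType) (f : I -> J) A B : injective f -> ext f (A * B) = ext f A * ext f B.
Proof.
move=> inj; rewrite /ext mulrDl mul1r mulrDr mulr1 -embM // -addrA; congr (_ + _).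
rewrite -!embD; congr emb; rewrite mulrBr mulr1 [A - 1 + _]addrC subrK mulrBl mul1r.
by rewrite [B - 1 + _]addrC addrA subrK.
Qed.
Lemma ext_comp (I J L : finType) (f : I -> J) (g : J -> L) (X : sqm F I) :
  injective f -> injective g -> ext g (ext f X) = ext (g \o f) X.
Proof. by move=> fi gi; rewrite /ext (addrC 1 (emb f _)) addrK emb_comp. Qed.
Lemma extf (I J : finType) (f : I -> J) (X : sqm F I) i j : injective f -> ext f X (f i) (f j) = X i j.
Proof. by move=> inj; rewrite /ext sqmE embf // !sqmE inj_eq // addrC subrK. Qed.
Lemma ext_out (I J : finType) (f : I -> J) (X : sqm F I) k l :
  (forall i, f i <> k) \/ (forall i, f i <> l) -> ext f X k l = (k == l)%:R.
Proof. by move=> h; rewrite /ext sqmE emb_out // addr0. Qed.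
Lemma extP (I J : finType) (f : I -> J) (X : sqm F I) (Y : sqm F J) : injective f ->
  (forall i j, X i j = Y (f i) (f j)) ->
  (forall k l, (forall i, f i <> k) \/ (forall i, f i <> l) -> Y k l = (k == l)%:R) ->
  ext f X = Y.
Proof.
move=> inj h1 h2; apply: sqmP => k l.
have [[i ->]|hk] := in_img f k; last by rewrite ext_out ?h2 //; left.
have [[j ->]|hl] := in_img f l; last by rewrite ext_out ?h2 //; right.
by rewrite extf.
Qed.
Lemma ext_de (I J : finType) (f : I -> J) i j a : injective f ->
  ext f (1 + de i j a) = 1 + de (f i) (f j) a.
Proof. by move=> inj; rewrite /ext (addrC 1 (de _ _ _)) addrK emb_de. Qed.

End Emb.

(** * Elementary and stably elementary matrices over a subring *)

Section EL.
Variable F : fieldType.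

Record sring (P : F -> Prop) : Prop := SRing {
  sring1 : P 1; sringB : forall x y, P x -> P y -> P (x - y);
  sringM : forall x y, P x -> P y -> P (x * y) }.

Section Closure.
Variables (P : F -> Prop) (hP : sring P).
Lemma sring0 : P 0. Proof. by rewrite -(subrr 1); apply: sringB => //; apply: sring1. Qed.
Lemma sringN x : P x -> P (- x).
Proof. by move=> h; rewrite -sub0r; apply: sringB => //; apply: sring0. Qed.
Lemma sringD x y : P x -> P y -> P (x + y).
Proof. by move=> hx hy; rewrite -[y]opprK; apply: sringB => //; apply: sringN. Qed.
Lemma sring_sum T (r : seq T) (Q : pred T) (f : T -> F) :
  (forall i, Q i -> P (f i)) -> P (\sum_(i <- r | Q i) f i).
Proof. by move=> h; apply: big_ind => //; [apply: sring0|apply: sringD]. Qed.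
Lemma sring_prod T (r : seq T) (Q : pred T) (f : T -> F) :
  (forall i, Q i -> P (f i)) -> P (\prod_(i <- r | Q i) f i).
Proof. by move=> h; apply: big_ind => //; [apply: sring1|apply: sringM]. Qed.
Lemma sringX x n : P x -> P (x ^+ n).
Proof. by move=> h; elim: n => [|n IH]; rewrite ?exprS; [apply: sring1|apply: sringM]. Qed.
Lemma sring_nat n : P n%:R.
Proof. by elim: n => [|n IH]; rewrite ?mulrS; [apply: sring0|apply: sringD => //; apply: sring1]. Qed.

Definition over (I : finType) (A : sqm F I) := forall i j, P (A i j).

Lemma over1 (I : finType) : over (1 : sqm F I).
Proof. by move=> i j; apply: sring_nat. Qed.
Lemma overD (I : finType) (A B : sqm F I) : over A -> over B -> over (A + B).
Proof. by move=> hA hB i j; apply: sringD. Qed.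
Lemma overN (I : finType) (A : sqm F I) : over A -> over (- A).
Proof. by move=> hA i j; apply: sringN. Qed.
Lemma overM (I : finType) (A B : sqm F I) : over A -> over B -> over (A * B).
Proof. by move=> hA hB i j; apply: sring_sum => k _; apply: sringM. Qed.
Lemma over_de (I : finType) (i j : I) a : P a -> over (de i j a).
Proof. by move=> ha k l; apply: sringM => //; apply: sring_nat. Qed.
End Closure.

(** Inverse letters are not listed, since the inverse of [1 + de i j a] is [1 + de i j (- a)]. *)
Inductive EL (P : F -> Prop) (I : finType) : sqm F I -> Prop :=
| EL1 : EL P 1
| ELc i j a A : i != j -> P a -> EL P A -> EL P ((1 + de i j a) * A).

Definition SE (P : F -> Prop) (I : finType) (A : sqm F I) : Prop :=
  exists (J : finType) (f : I -> J), injective f /\ EL P (ext f A).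

Section ELth.
Variables (P : F -> Prop) (hP : sring P).

Lemma EL_mul I (A B : sqm F I) : EL P A -> EL P B -> EL P (A * B).
Proof.
move=> hA hB; elim: hA => [|i j a {}A ij ha hA IH]; first by rewrite mul1r.
by rewrite -mulrA; apply: ELc.
Qed.
Lemma EL_gen (I : finType) (i j : I) a : i != j -> P a -> EL P (1 + de i j a).
Proof. by move=> ij ha; rewrite -[X in EL _ X]mulr1; apply: ELc => //; apply: EL1. Qed.
Lemma de_invr (I : finType) (i j : I) (a : F) : i != j ->
  (1 + de i j a) * (1 + de i j (- a)) = 1.
Proof.
move=> ij; rewrite mulrDl mul1r mulrDr mulr1 deM eq_sym (negPf ij) addr0 -addrA -deD.
by rewrite addNr de0 addr0.
Qed.
Lemma de_invl (I : finType) (i j : I) (a : F) : i != j ->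
  (1 + de i j (- a)) * (1 + de i j a) = 1.
Proof. by move=> ij; rewrite -{2}[a]opprK de_invr. Qed.
Lemma EL_inv I (A : sqm F I) : EL P A -> exists B, [/\ EL P B, A * B = 1 & B * A = 1].
Proof.
elim=> [|i j a {}A ij ha hA [B [hB AB BA]]]; first by exists 1; rewrite mulr1; split => //; apply: EL1.
exists (B * (1 + de i j (- a))); split.
- by apply: EL_mul => //; apply: EL_gen => //; apply: sringN.
- by rewrite mulrA -[X in X * _]mulrA AB mulr1 de_invr.
- by rewrite mulrA -[X in X * _]mulrA de_invl // mulr1 BA.
Qed.
Lemma EL_over I (A : sqm F I) : EL P A -> over P A.
Proof.
elim=> [|i j a {}A ij ha hA IH]; first exact: over1.
by apply: overM => //; apply: overD => //; [apply: over1|apply: over_de].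
Qed.
Lemma EL_ext (I J : finType) (f : I -> J) (A : sqm F I) : injective f -> EL P A -> EL P (ext f A).
Proof.
move=> inj; elim=> [|i j a {}A ij ha hA IH]; first by rewrite ext1; apply: EL1.
by rewrite extM // ext_de //; apply: ELc => //; rewrite (inj_eq inj).
Qed.

(** The matrix units of [Z] have row inside [p] and column outside, so any two of them multiply to 0
    and [1 + Z] is the product of the corresponding elementary matrices. *)
Lemma EL_unip (I : finType) (p : pred I) (Z : sqm F I) : over P Z ->
  (forall i j, ~~ (p i && ~~ p j) -> Z i j = 0) -> EL P (1 + Z).
Proof.
move=> hZ hz.
have EZ : Z = \sum_(x : I * I | p x.1 && ~~ p x.2) de x.1 x.2 (Z x.1 x.2).
  apply: sqmP => i j; rewrite sqm_sumE.
  case: (boolP (p i && ~~ p j)) => h.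
    rewrite (bigD1 (i, j)) //= /de !eqxx mul1r big1 ?addr0 // => -[k l] /= /andP[_].
    by rewrite xpair_eqE eq_sym [l == _]eq_sym => /negPf ->; rewrite mul0r.
  rewrite hz // big1 // => -[k l] /= hkl; rewrite /de; case: eqP => [e|]; last by rewrite mul0r.
  by case: eqP => [e'|]; rewrite ?mul0r //; rewrite e e' hkl in h.
rewrite EZ.
pose Q (X : sqm F I) := EL P (1 + X) /\ forall i j, ~~ (p i && ~~ p j) -> X i j = 0.
suff: Q (\sum_(x : I * I | p x.1 && ~~ p x.2) de x.1 x.2 (Z x.1 x.2)) by case.
elim: (index_enum _) => [|[k l] r IH] /=.
  by rewrite big_nil /Q addr0; split=> //; apply: EL1.
rewrite big_cons /=; case: ifP => // hkl; set X := \sum_(_ <- _ | _) _ in IH *.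
case: IH => h1 h2; split; last first.
  move=> i j hij; rewrite sqmE h2 // addr0 /de; case: eqP => [e|]; last by rewrite mul0r.
  by case: eqP => [e'|]; rewrite ?mul0r //; rewrite e e' hkl in hij.
have -> : 1 + (de k l (Z k l) + X) = (1 + de k l (Z k l)) * (1 + X).
  rewrite mulrDl mul1r mulrDr mulr1.
  have -> : de k l (Z k l) * X = 0.
    apply: sqmP => i j; rewrite sqm_mulE big1 // => m _; rewrite /de.
    case: eqP => _; rewrite ?mul0r //; case: eqP => [->|]; rewrite ?mul0r //=.
    by rewrite h2 ?mulr0 //; case/andP: hkl => _ /negPf ->.
  by rewrite addr0 addrAC addrA.
by apply: ELc => //; case/andP: hkl => h3 h4; apply: contraNneq h4 => <-.
Qed.

(** Two stabilisations have to be compared in a common larger index set. The sum [J + J'] serves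
    once the points of [J'] coming from [I] are redirected into the copy of [J]. *)
Lemma amalgam (I J J' : finType) (f : I -> J) (g : I -> J') : injective f -> injective g ->
  exists (T : finType) (h : J -> T) (h' : J' -> T),
   [/\ injective h, injective h' & h \o f =1 h' \o g].
Proof.
move=> fi gi; exists (J + J')%type, inl,
  (fun j' => if [pick i | g i == j'] is Some i then inl (f i) else inr j').
split=> [x y []//|x y|i /=]; last first.
  by case: pickP => [j /eqP/gi -> //|/(_ i)]; rewrite eqxx.
case: pickP => [i /eqP <-|_]; case: pickP => [j /eqP <-|_] // [].
  by move/fi ->.
by [].
Qed.

Lemma eq_ext (I J : finType) (f g : I -> J) (A : sqm F I) : f =1 g -> ext f A = ext g A.
Proof. by move=> /funext ->. Qed.

Lemma SE_EL (I : finType) (A : sqm F I) : EL P A -> SE P A.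
Proof. by exists I, id; split => //; apply: EL_ext. Qed.

Lemma SE_ext (I J : finType) (g : I -> J) (A : sqm F I) : injective g -> SE P A -> SE P (ext g A).
Proof.
move=> gi [K [f [fi h]]]; have [T [h1 [h2 [i1 i2 e]]]] := amalgam fi gi.
exists T, h2; split=> //; rewrite ext_comp // -(eq_ext _ e) -ext_comp //.
exact: EL_ext.
Qed.
Lemma SE_unext (I J : finType) (g : I -> J) (A : sqm F I) : injective g -> SE P (ext g A) -> SE P A.
Proof.
move=> gi [K [f [fi h]]]; exists K, (f \o g); split; first exact: inj_comp.
by rewrite -ext_comp.
Qed.
Lemma SE_mul (I : finType) (A B : sqm F I) : SE P A -> SE P B -> SE P (A * B).
Proof.
move=> [J [f [fi h]]] [K [g [gi h']]]; have [T [h1 [h2 [i1 i2 e]]]] := amalgam fi gi.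
exists T, (h1 \o f); split; first exact: inj_comp.
rewrite extM; last exact: inj_comp.
by apply: EL_mul; [|rewrite (eq_ext _ e)]; rewrite -ext_comp //; apply: EL_ext.
Qed.
Lemma SE_cancel (I : finType) (A B : sqm F I) : SE P A -> SE P (A * B) -> SE P B.
Proof.
move=> hA hAB; have [J [f [fi h]]] := hA; have [C [hC AC CA]] := EL_inv h.
apply: (SE_unext fi); have -> : ext f B = C * ext f (A * B) by rewrite extM // mulrA CA mul1r.
by apply: SE_mul; [apply: SE_EL|apply: SE_ext].
Qed.
End ELth.

Lemma EL_mono (P Q : F -> Prop) (I : finType) (A : sqm F I) : (forall x, P x -> Q x) -> EL P A -> EL Q A.
Proof.
move=> PQ; elim=> [|i j a {}A ij ha hA IH]; first exact: EL1.
by apply: ELc => //; apply: PQ.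
Qed.
Lemma SE_mono (P Q : F -> Prop) (I : finType) (A : sqm F I) : (forall x, P x -> Q x) -> SE P A -> SE Q A.
Proof. by move=> PQ [J [f [fi h]]]; exists J, f; split=> //; apply: EL_mono h. Qed.
End EL.
End Elementary.

(** * Determinants *)

Section Determinant.
Import GRing.Theory.
Local Open Scope ring_scope.
Variable F : fieldType.

Definition toM (I : finType) (A : sqm F I) : 'M[F]_#|I| :=
  \matrix_(i, j) A (enum_val i) (enum_val j).
Definition detF (I : finType) (A : sqm F I) : F := \det (toM A).

Lemma toM_inj (I : finType) (A B : sqm F I) : toM A = toM B -> A = B.
Proof.
move=> h; apply: sqmP => i j.
by have := congr1 (fun M : 'M_#|I| => M (enum_rank i) (enum_rank j)) h; rewrite !mxE !enum_rankK.
Qed.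
Lemma toMM (I : finType) (A B : sqm F I) : toM (A * B) = toM A *m toM B.
Proof.
apply/matrixP => i j; rewrite !mxE sqm_mulE (reindex (fun k : 'I_#|I| => enum_val k)) /=; last exact/onW_bij/enum_val_bij.
by apply: eq_bigr => k _; rewrite !mxE.
Qed.
Lemma toM1 (I : finType) : toM (1 : sqm F I) = 1%:M.
Proof. by apply/matrixP => i j; rewrite !mxE sqmE (inj_eq enum_val_inj). Qed.
Lemma detF_mul (I : finType) (A B : sqm F I) : detF (A * B) = detF A * detF B.
Proof. by rewrite /detF toMM det_mulmx. Qed.
Lemma detF1 (I : finType) : detF (1 : sqm F I) = 1.
Proof. by rewrite /detF toM1 det1. Qed.

(** Two enumerations differ by one permutation acting on rows and on columns; its sign occurs twice
    and cancels. *)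
Lemma detF_enum (I : finType) (A : sqm F I) m (g : 'I_m -> I) : bijective g ->
  detF A = \det (\matrix_(i < m, j < m) A (g i) (g j)).
Proof.
move=> gb; have em : m = #|I| by rewrite -(bij_eq_card gb) card_ord.
subst m; have inj : injective (fun i => enum_rank (g i)).
  by move=> i j /enum_rank_inj; apply: (bij_inj gb).
pose s := perm inj.
have -> : \matrix_(i, j) A (g i) (g j) = row_perm s (col_perm s (toM A)).
  by apply/matrixP => i j; rewrite !mxE !permE !enum_rankK.
rewrite row_permE col_permE !det_mulmx !det_perm odd_permV /detF.
by case: (odd_perm s); rewrite ?expr0 ?expr1 ?mul1r ?mulr1 // mulrN1 mulN1r opprK.
Qed.

Lemma detF_ext (I J : finType) (f : I -> J) (A : sqm F I) : injective f -> detF (ext f A) = detF A.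
Proof.
move=> inj; pose D := [set j | j \notin codom f].
(* Listing the image of [f] first and its complement second makes the matrix block diagonal. *)
pose g (x : 'I_(#|I| + #|D|)) : J :=
  match split x with inl i => f (enum_val i) | inr k => enum_val k end.
have hD (k : 'I_#|D|) i : enum_val k <> f i.
  by move=> e; have := enum_valP k; rewrite inE e codom_f.
have gi : injective g.
  move=> x y; rewrite /g; case: splitP => i ei; case: splitP => j ej.
  - by move/inj/enum_val_inj => e; apply: val_inj; rewrite /= ei ej e.
  - by move/esym/hD.
  - by move/hD.
  - by move/enum_val_inj => e; apply: val_inj; rewrite /= ei ej e.
have cI : #|J| = (#|I| + #|D|)%N.
  by rewrite -(cardC (mem (codom f))) (card_codom inj); congr (_ + _)%N; apply: eq_card => x; rewrite !inE.
have gb : bijective g by apply: (inj_card_bij gi); rewrite card_ord cI.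
rewrite (detF_enum _ gb).
have -> : \matrix_(i, j) ext f A (g i) (g j) = block_mx (toM A) 0 0 1%:M.
  apply/matrixP => x y; rewrite !mxE /g.
  case: splitP => i _; rewrite !mxE; case: splitP => j _; rewrite ?mxE.
  - by rewrite extf.
  - rewrite ext_out; last by right => k /esym/hD.
    by case: eqP => // /esym/hD.
  - rewrite ext_out; last by left => k /esym/hD.
    by case: eqP => // /hD.
  - rewrite ext_out; last by left => k /esym/hD.
    by rewrite (inj_eq enum_val_inj).
by rewrite det_ublock det1 mulr1.
Qed.

(** Row [i] is a unit vector plus [a] times a unit vector. Linearity in this row leaves the identity
    and a matrix [C] with two equal rows unless [i = j]. *)
Lemma detF_de (I : finType) (i j : I) a : detF (1 + de i j a) = 1 + (i == j)%:R * a.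
Proof.
pose r := enum_rank i; pose c := enum_rank j.
pose B : 'M[F]_#|I| := 1%:M.
pose C : 'M[F]_#|I| := \matrix_(k, l) (if k == r then (c == l)%:R else (k == l)%:R).
rewrite /detF (@determinant_multilinear _ _ _ B C r 1 a).
- rewrite mul1r det1 mulrC; congr (_ + _ * _).
  have [e|ne] := eqVneq i j.
    suff -> : C = 1%:M by rewrite det1.
    by apply/matrixP => k l; rewrite !mxE; case: eqP => // ->; rewrite /r /c e.
  apply: (@determinant_alternate _ _ _ r c).
    by apply: contra ne => /eqP/enum_rank_inj/eqP.
  by move=> l; rewrite !mxE eqxx; case: (c == r).
- apply/rowP => l; rewrite !mxE !sqmE /de (inj_eq enum_val_inj) enum_rankK !eqxx mul1r.
  have -> : (enum_val l == j) = (c == l) by rewrite /c -(inj_eq enum_rank_inj) enum_valK eq_sym.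
  by rewrite mulrC.
- apply/matrixP => k l; rewrite !mxE !sqmE /de.
  have -> : (enum_val (lift r k) == i) = false.
    by rewrite -(inj_eq enum_rank_inj) enum_valK eq_sym; apply: negPf (neq_lift r k).
  by rewrite mul0r addr0 (inj_eq enum_val_inj).
- apply/matrixP => k l; rewrite !mxE !sqmE /de.
  have -> : (enum_val (lift r k) == i) = false.
    by rewrite -(inj_eq enum_rank_inj) enum_valK eq_sym; apply: negPf (neq_lift r k).
  by rewrite mul0r addr0 (inj_eq enum_val_inj) eq_sym (negPf (neq_lift r k)).
Qed.

Lemma detF_EL (P : F -> Prop) (I : finType) (A : sqm F I) : EL P A -> detF A = 1.
Proof.
elim=> [|i j a {}A ij _ _ IH]; first exact: detF1.
by rewrite detF_mul IH detF_de (negPf ij) mul0r addr0 mulr1.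
Qed.
Lemma detF_SE (P : F -> Prop) (I : finType) (A : sqm F I) : SE P A -> detF A = 1.
Proof. by move=> [J [f [fi /detF_EL]]]; rewrite detF_ext. Qed.

Section Over.
Variables (P : F -> Prop) (hP : sring P).
Lemma P_det n (M : 'M[F]_n) : (forall i j, P (M i j)) -> P (\det M).
Proof.
move=> h; apply: sring_sum => // s _; apply: sringM => //; last by apply: sring_prod.
by apply: sringX => //; apply: sringN => //; apply: sring1.
Qed.
Lemma P_detF (I : finType) (A : sqm F I) : over P A -> P (detF A).
Proof. by move=> h; apply: P_det => i j; rewrite mxE. Qed.

Lemma det1_inv (I : finType) (A : sqm F I) : over P A -> detF A = 1 ->
  exists B, [/\ over P B, A * B = 1 & B * A = 1].
Proof.
move=> hA dA; pose B : sqm F I := fun i j => (\adj (toM A)) (enum_rank i) (enum_rank j).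
have eB : toM B = \adj (toM A) by apply/matrixP => i j; rewrite mxE /B !enum_valK.
exists B; split.
- move=> i j; rewrite /B mxE /cofactor; apply: sringM => //.
    by apply: sringX => //; apply: sringN => //; apply: sring1.
  by apply: P_det => k l; rewrite !mxE.
- by apply: toM_inj; rewrite toMM eB mul_mx_adj -/(detF A) dA toM1.
- by apply: toM_inj; rewrite toMM eB mul_adj_mx -/(detF A) dA toM1.
Qed.
End Over.

(** * Gaussian elimination over a subfield *)

Section Gauss.
Variables (P : F -> Prop) (hP : sring P) (hV : forall x, P x -> P x^-1).
Variable I : finType.
Implicit Types (A B : sqm F I) (T : {set I}).

(** The block [T] is what remains to be eliminated; its size is the induction variable of
    [gauss]. *)
Definition inside T A := forall i j, ~~ ((i \in T) && (j \in T)) -> A i j = (i == j)%:R.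

Lemma insideM T A B : inside T A -> inside T B -> inside T (A * B).
Proof.
move=> hA hB i j; rewrite negb_and => /orP h; rewrite sqm_mulE.
case: h => h.
  rewrite (bigD1 i) //= hA ?(negPf h) // eqxx mul1r big1 ?addr0; last first.
    by move=> k ki; rewrite hA ?(negPf h) // eq_sym (negPf ki) mul0r.
  by rewrite hB // (negPf h).
rewrite (bigD1 j) //= hB ?(negPf h) ?andbF // eqxx mulr1 big1 ?addr0; last first.
  by move=> k ki; rewrite hB ?(negPf h) ?andbF // (negPf ki) mulr0.
by rewrite hA // (negPf h) andbF.
Qed.
Lemma inside_de T i j a : i \in T -> j \in T -> inside T (1 + de i j a).
Proof.
move=> hi hj k l; rewrite !sqmE /de; case: (k =P i) => [->|_]; last by rewrite mul0r addr0.
by case: (l =P j) => [->|_]; rewrite ?hi ?hj //= mul0r addr0.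
Qed.
Lemma deMl i j a A k l : ((1 + de i j a) * A) k l = A k l + (k == i)%:R * (a * A j l).
Proof.
rewrite mulrDl mul1r sqmE sqm_mulE (bigD1 j) //= big1 ?addr0.
  by rewrite /de eqxx andbT mulrA.
by move=> m mj; rewrite /de (negPf mj) andbF !mul0r.
Qed.
Lemma deMr i j a A k l : (A * (1 + de i j a)) k l = A k l + (l == j)%:R * (A k i * a).
Proof.
rewrite mulrDr mulr1 sqmE sqm_mulE (bigD1 i) //= big1 ?addr0.
  by rewrite /de eqxx /= mulrCA.
by move=> m mj; rewrite /de (negPf mj) mul0r mulr0.
Qed.

(** Multiples of row [i] are subtracted from the rows in [s], so row [i] itself never changes, and
    neither do entries of column [i] outside [s]. *)
Lemma clear_col T (s : seq I) A i : over P A -> i \in T -> A i i = 1 -> i \notin s -> {subset s <= T} -> inside T A ->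
  exists X, [/\ EL P X, inside T (X * A), (forall j, (X * A) i j = A i j) & forall k, (k \in s) || (A k i == 0) -> k != i -> (X * A) k i = 0].
Proof.
move=> hA iT Aii; elim: s => [|k s IH] his hs insA.
  exists 1; rewrite mul1r; split=> // [|k]; first exact: EL1.
  by rewrite in_nil => /eqP.
move: his; rewrite inE negb_or => /andP[ik his].
have [|//|X [hX XA1 XA2 XA3]] := IH his; first by move=> x xs; apply: hs; rewrite inE xs orbT.
have kT : k \in T by apply: hs; rewrite inE eqxx.
have XAii : (X * A) i i = 1 by rewrite XA2.
exists ((1 + de k i (- (X * A) k i)) * X); split.
- apply: ELc => //; first by rewrite eq_sym.
  by apply: sringN => //; apply: overM => //; apply: EL_over.
- by rewrite -mulrA; apply: insideM => //; apply: inside_de.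
- by move=> j; rewrite -mulrA deMl (negPf ik) mul0r addr0.
- move=> l hl li; rewrite -mulrA deMl XAii mulr1.
  have [->|lk] := eqVneq l k; first by rewrite mul1r subrr.
  by rewrite mul0r addr0 XA3 //; move: hl; rewrite inE (negPf lk).
Qed.

(** Column [i] is already a unit vector, so adding multiples of it to other columns alters row [i]
    only. *)
Lemma clear_row T (s : seq I) A i : over P A -> i \in T -> (forall k, A k i = (k == i)%:R) -> i \notin s -> {subset s <= T} -> inside T A ->
  exists Y, [/\ EL P Y, inside T (A * Y), (forall k, (A * Y) k i = (k == i)%:R) & forall l, (l \in s) || (A i l == 0) -> l != i -> (A * Y) i l = 0].
Proof.
move=> hA iT Aii; elim: s => [|k s IH] his hs insA.
  exists 1; rewrite mulr1; split=> // [|k]; first exact: EL1.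
  by rewrite in_nil => /eqP.
move: his; rewrite inE negb_or => /andP[ik his].
have [|//|X [hX XA1 XA2 XA3]] := IH his; first by move=> x xs; apply: hs; rewrite inE xs orbT.
have kT : k \in T by apply: hs; rewrite inE eqxx.
exists (X * (1 + de i k (- (A * X) i k))); split.
- apply: EL_mul => //; apply: EL_gen => //.
  by apply: sringN => //; apply: overM => //; apply: EL_over.
- by rewrite mulrA; apply: insideM => //; apply: inside_de.
- by move=> j; rewrite mulrA deMr (negPf ik) mul0r addr0.
- move=> l hl li; rewrite mulrA deMr XA2 eqxx mul1r.
  have [->|lk] := eqVneq l k; first by rewrite mul1r subrr.
  by rewrite mul0r addr0 XA3 //; move: hl; rewrite inE (negPf lk).
Qed.

(** A nonzero entry elsewhere in column [i] can be scaled and added to make the pivot 1. If there is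
    none, invertibility makes [A i i] nonzero, and adding row [i] to row [k] creates one; this is
    why a second index is supplied. *)
Lemma pivot T A A' i k : over P A -> A' * A = 1 -> i \in T -> k \in T -> k != i -> inside T A ->
  exists X, [/\ EL P X, inside T (X * A) & (X * A) i i = 1].
Proof.
move=> hA AA iT kT ki insA.
have go (B : sqm F I) l : over P B -> inside T B -> l != i -> B l i != 0 ->
    exists X, [/\ EL P X, inside T (X * B) & (X * B) i i = 1].
  move=> hB insB li Bl.
  have lT : l \in T.
    by apply: contraNT Bl => lT; rewrite insB ?(negPf lT) // (negPf li).
  exists (1 + de i l ((1 - B i i) / B l i)); split.
  - apply: EL_gen; first by rewrite eq_sym.
    by apply: sringM => //; [apply: sringB => //; apply: sring1|apply: hV].
  - by apply: insideM => //; apply: inside_de.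
  - by rewrite deMl eqxx mul1r divfK // addrC subrK.
case: (pickP (fun l => (l != i) && (A l i != 0))) => [l /andP[li Al]|h]; first exact: go Al.
have Ai : A i i != 0.
  apply/eqP => e; have := congr1 (fun M : sqm F I => M i i) AA.
  rewrite sqm_mulE sqmE eqxx big1; last first.
    move=> l _; have [->|li] := eqVneq l i; first by rewrite e mulr0.
    by have := h l; rewrite li /= => /negbFE/eqP ->; rewrite mulr0.
  by move/esym/eqP; rewrite oner_eq0.
have [||//||X [X1 X2 X3]] := go ((1 + de k i 1) * A) k.
- by apply: overM => //; apply: overD => //; [apply: over1|apply: over_de => //; apply: sring1].
- by apply: insideM => //; apply: inside_de.
- have := h k; rewrite ki /= => /negbFE/eqP Ak.
  by rewrite deMl eqxx Ak add0r !mul1r.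
exists (X * (1 + de k i 1)); split; rewrite -?mulrA //.
by apply: EL_mul => //; apply: EL_gen => //; apply: sring1.
Qed.

Lemma gauss A : over P A -> detF A = 1 -> EL P A.
Proof.
move=> hA dA; have : inside setT A by move=> i j; rewrite !inE.
move: (setT : {set I}) => T; move eqn : #|T| => m; elim: m T eqn A hA dA => [|m IH] T eqn A hA dA insA.
  suff -> : A = 1 by apply: EL1.
  by apply: sqmP => i j; rewrite insA // (cards0_eq eqn) inE.
have /card_gt0P[i iT] : (0 < #|T|)%N by rewrite eqn.
case: (pickP (fun k => (k \in T) && (k != i))) => [k /andP[kT ki]|h]; last first.
  (* On a block of size one there is no second index, and the determinant forces the entry to be
     1. *)
  have hT j : j \in T -> j = i by move=> jT; have := h j; rewrite jT /= => /negbFE/eqP.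
  have eA : A = 1 + de i i (A i i - 1).
    apply: sqmP => k l; rewrite !sqmE /de; case: (boolP ((k \in T) && (l \in T))).
      by case/andP => /hT -> /hT ->; rewrite eqxx mul1r addrC subrK.
    move=> n; rewrite insA //; case: (k =P i) => [e|_]; last by rewrite mul0r addr0.
    by case: (l =P i) => [e'|_]; [rewrite e e' iT in n|rewrite mul0r addr0].
  move: dA; rewrite {1}eA detF_de eqxx mul1r addrC subrK => Aii.
  by rewrite eA Aii subrr de0 addr0; apply: EL1.
have [A' [_ _ AA]] := det1_inv hP hA dA.
have [X [hX X1 X2]] := pivot hA AA iT kT ki insA.
have hXA : over P (X * A) by apply: overM => //; apply: EL_over.
have [//|||//|Y [hY Y1 Y2 Y3]] := clear_col (s := [seq x <- enum T | x != i]) hXA iT.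
- by rewrite mem_filter eqxx.
- by move=> x; rewrite mem_filter mem_enum => /andP[].
set B := Y * (X * A) in Y1 Y2 Y3 *.
have hB : over P B by apply: overM => //; apply: EL_over.
have colB k' : B k' i = (k' == i)%:R.
  have [->|ki'] := eqVneq k' i; first by rewrite Y2.
  case: (boolP (k' \in T)) => [kT'|kT']; first by rewrite Y3 // mem_filter ki' mem_enum kT'.
  by rewrite Y1 ?(negPf kT') // (negPf ki').
have [||//|Z [hZ Z1 Z2 Z3]] := clear_row (s := [seq x <- enum T | x != i]) hB iT colB.
- by rewrite mem_filter eqxx.
- by move=> x; rewrite mem_filter mem_enum => /andP[].
have : EL P (B * Z).
  apply: (IH (T :\ i)).
  - by move: eqn; rewrite (cardsD1 i) iT => -[].
  - by apply: overM => //; apply: EL_over.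
  - by rewrite !detF_mul (detF_EL hX) (detF_EL hY) (detF_EL hZ) dA !mulr1.
  - move=> a b; rewrite !inE => hab.
    case: (boolP ((a \in T) && (b \in T))) => [/andP[aT bT]|]; last exact: Z1.
    have [ea|ai] := eqVneq b i; first by rewrite ea Z2.
    have [eb|bi] := eqVneq a i; last by rewrite aT bT ai bi in hab.
    by rewrite eb [i == b]eq_sym (negPf ai) Z3 // mem_filter ai mem_enum bT.
have [X' [hX' XX XX']] := EL_inv hP hX.
have [Y' [hY' YY YY']] := EL_inv hP hY.
have [Z' [hZ' ZZ ZZ']] := EL_inv hP hZ.
move=> h; have -> : A = X' * (Y' * ((B * Z) * Z')).
  rewrite -mulrA ZZ mulr1 /B [Y' * _]mulrA YY' mul1r mulrA XX' mul1r //.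
by apply: EL_mul => //; apply: EL_mul => //; apply: EL_mul.
Qed.
End Gauss.
End Determinant.

(** * Iterated Laurent extensions *)

Section Laurent.
Import GRing.Theory.
Local Open Scope ring_scope.
Variable F : fieldType.
Implicit Types (S K Q P : F -> Prop) (t x y : F) (p q : {poly F}).

Definition po S p := forall i, S p`_i.

Section Po.
Variables (S : F -> Prop) (hS : sring S).
Lemma poC x : S x -> po S x%:P.
Proof. by move=> h i; rewrite coefC; case: ifP => // _; apply: sring0. Qed.
Lemma po1 : po S 1. Proof. by apply: poC; apply: sring1. Qed.
Lemma poX : po S 'X. Proof. by move=> i; rewrite coefX; apply: sring_nat. Qed.
Lemma poD p q : po S p -> po S q -> po S (p + q).
Proof. by move=> hp hq i; rewrite coefD; apply: sringD. Qed.
Lemma poN p : po S p -> po S (- p).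
Proof. by move=> hp i; rewrite coefN; apply: sringN. Qed.
Lemma poB p q : po S p -> po S q -> po S (p - q).
Proof. by move=> hp hq; apply: poD => //; apply: poN. Qed.
Lemma poM p q : po S p -> po S q -> po S (p * q).
Proof. by move=> hp hq i; rewrite coefM; apply: sring_sum => // j _; apply: sringM. Qed.
Lemma poE p n : po S p -> po S (p ^+ n).
Proof. by move=> hp; elim: n => [|n IH]; rewrite ?exprS; [apply: po1|apply: poM]. Qed.
Lemma poXn n : po S 'X^n. Proof. by apply: poE; apply: poX. Qed.
Lemma poZ x p : S x -> po S p -> po S (x *: p).
Proof. by move=> hx hp i; rewrite coefZ; apply: sringM. Qed.
Lemma po_horner p x : po S p -> S x -> S p.[x].
Proof.
by move=> hp hx; rewrite horner_coef; apply: sring_sum => // i _; apply: sringM => //; apply: sringX.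
Qed.
End Po.

Lemma po_mono S Q p : (forall x, S x -> Q x) -> po S p -> po Q p.
Proof. by move=> h hp i; apply: h. Qed.

Definition adj S t x := exists p k, po S p /\ x * t ^+ k = p.[t].
Definition trans S t := forall p, po S p -> p.[t] = 0 -> p = 0.
(** The head of the list is adjoined last. Accordingly [chain] expresses algebraic independence one
    variable at a time, each over the Laurent ring of the variables after it. *)
Definition laur K (ts : seq F) := foldr (fun t S => adj S t) K ts.
Fixpoint chain K (ts : seq F) : Prop :=
  if ts is t :: ts' then chain K ts' /\ trans (laur K ts') t else True.

Lemma adj_sring S t : sring S -> sring (adj S t).
Proof.
move=> hS; split.
- by exists 1, 0%N; split; [apply: po1|rewrite hornerC mulr1].
- move=> x y [p [k [hp ep]]] [q [l [hq eq]]]; exists (p * 'X^l - q * 'X^k), (k + l)%N; split.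
    by apply: poB => //; apply: poM => //; apply: poXn.
  by rewrite !hornerE ?hornerXn exprD mulrBl mulrA ep [t ^+ k * _]mulrC mulrA eq.
- move=> x y [p [k [hp ep]]] [q [l [hq eq]]]; exists (p * q), (k + l)%N; split; first exact: poM.
  by rewrite hornerM -ep -eq exprD mulrACA.
Qed.
Lemma adj_sub S t x : sring S -> S x -> adj S t x.
Proof. by move=> hS h; exists x%:P, 0%N; split; [apply: poC|rewrite hornerC mulr1]. Qed.
Lemma adj_t S t : sring S -> adj S t t.
Proof. by move=> hS; exists 'X, 0%N; split; [apply: poX|rewrite hornerX mulr1]. Qed.
Lemma adj_tV S t : sring S -> t != 0 -> adj S t t^-1.
Proof. by move=> hS h; exists 1, 1%N; split; [apply: po1|rewrite hornerC expr1 mulVf]. Qed.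
Lemma adj_mono S Q t x : (forall x, S x -> Q x) -> adj S t x -> adj Q t x.
Proof. by move=> h [p [k [hp e]]]; exists p, k; split=> //; apply: po_mono hp. Qed.
Lemma adj_min S Q t x : sring Q -> (forall x, S x -> Q x) -> t != 0 -> Q t -> Q t^-1 -> adj S t x -> Q x.
Proof.
move=> hQ SQ t0 Qt Qv [p [k [hp e]]].
have -> : x = p.[t] * t^-1 ^+ k by rewrite -e exprVn mulfK // expf_neq0.
by apply: sringM => //; [apply: po_horner => //; apply: po_mono hp|apply: sringX].
Qed.

Lemma laur_sring K ts : sring K -> sring (laur K ts).
Proof. by move=> hK; elim: ts => //= t ts IH; apply: adj_sring. Qed.
Lemma laur_mono K Q ts x : (forall x, K x -> Q x) -> laur K ts x -> laur Q ts x.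
Proof. by move=> h; elim: ts x => [|t ts IH] x /=; [apply: h|apply: adj_mono]. Qed.
Lemma laur_base K ts x : sring K -> K x -> laur K ts x.
Proof. by move=> hK; elim: ts => //= t ts IH /IH; apply: adj_sub; apply: laur_sring. Qed.
Lemma laur_gen K ts t : sring K -> t \in ts -> t != 0 -> laur K ts t /\ laur K ts t^-1.
Proof.
move=> hK; elim: ts => //= s ts IH; rewrite inE; have hL := laur_sring ts hK.
case/orP => [/eqP ->|/IH h /h [h1 h2]] => [s0|]; first by split; [apply: adj_t|apply: adj_tV].
by split; apply: adj_sub.
Qed.
Lemma laur_min K Q ts x : sring Q -> (forall x, K x -> Q x) ->
  (forall t, t \in ts -> [/\ t != 0, Q t & Q t^-1]) -> laur K ts x -> Q x.
Proof.
move=> hQ KQ; elim: ts x => [|t ts IH] x /= hts; first exact: KQ.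
have [t0 Qt Qv] := hts t (mem_head _ _).
by apply: adj_min => // y; apply: IH => s hs; apply: hts; rewrite inE hs orbT.
Qed.
Lemma trans_neq0 S t : sring S -> trans S t -> t != 0.
Proof.
move=> hS h; apply/eqP => e; have := h 'X (poX hS); rewrite hornerX => /(_ e)/eqP.
by rewrite polyX_eq0.
Qed.
Lemma trans_mono S Q t : (forall x, S x -> Q x) -> trans Q t -> trans S t.
Proof. by move=> h hQ p hp; apply: hQ; apply: po_mono hp. Qed.
Lemma chain_neq0 K ts t : sring K -> chain K ts -> t \in ts -> t != 0.
Proof.
move=> hK; elim: ts => //= s ts IH [hc ht]; rewrite inE => /orP[/eqP ->|/IH]; last exact.
by apply: (trans_neq0 _ ht); apply: laur_sring.
Qed.
Lemma chain_mono K Q ts : (forall x, K x -> Q x) -> chain Q ts -> chain K ts.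
Proof.
move=> h; elim: ts => //= t ts IH [hc ht]; split; first exact: IH.
by apply: trans_mono ht => x; apply: laur_mono.
Qed.

Lemma laur_rcons K ts t : laur K (rcons ts t) = laur (adj K t) ts.
Proof. by rewrite /laur -cats1 foldr_cat. Qed.
Lemma chain_rcons K ts t : chain K (rcons ts t) -> chain (adj K t) ts /\ trans K t.
Proof.
elim: ts => [|s ts IH] /=; first by case.
by rewrite laur_rcons => -[/IH[h1 h2] h3].
Qed.

(** * Rational functions in one variable and their denominators *)

Definition sfield K := sring K /\ forall x, K x -> K x^-1.

Definition fr K t x := exists p q, [/\ po K p, po K q, q.[t] != 0 & x = p.[t] / q.[t]].

Lemma fr_sfield K t : sring K -> sfield (fr K t).
Proof.
move=> hK; split.
  split.
  - by exists 1, 1; split; [apply: po1|apply: po1|rewrite hornerC oner_eq0|rewrite hornerC divr1].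
  - move=> x y [p [q [hp hq q0 ->]]] [p' [q' [hp' hq' q0' ->]]].
    exists (p * q' - p' * q), (q * q'); split.
    + by apply: poB => //; apply: poM.
    + exact: poM.
    + by rewrite hornerM mulf_neq0.
    + by rewrite !hornerE -mulNr addf_div // mulNr.
  - move=> x y [p [q [hp hq q0 ->]]] [p' [q' [hp' hq' q0' ->]]].
    exists (p * p'), (q * q'); split; [exact: poM|exact: poM|by rewrite hornerM mulf_neq0|].
    by rewrite !hornerM mulf_div.
move=> x [p [q [hp hq q0 ->]]]; have [p0|p0] := eqVneq p.[t] 0.
  exists 0, 1; split; [by apply: (poC hK); apply: sring0|by apply: po1|by rewrite hornerC oner_eq0|].
  by rewrite p0 mul0r invr0 hornerC mul0r.
by exists q, p; split=> //; rewrite invf_div.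
Qed.
Lemma fr_adj K t x : sring K -> t != 0 -> adj K t x -> fr K t x.
Proof.
move=> hK t0; apply: adj_min => //; first by case: (fr_sfield t hK).
- move=> y Ky; exists y%:P, 1; split; [exact: poC|exact: po1|by rewrite hornerC oner_eq0|by rewrite !hornerC divr1].
- by exists 'X, 1; split; [exact: poX|exact: po1|by rewrite hornerC oner_eq0|by rewrite hornerX hornerC divr1].
- by exists 1, 'X; split; [exact: po1|exact: poX|by rewrite hornerX|by rewrite hornerX hornerC mul1r].
Qed.

Lemma common_den K t S n (c : nat -> F) : sring K -> sring S -> (forall q, po K q -> S q.[t]) ->
  (forall i, exists q, [/\ po K q, q.[t] != 0 & S (q.[t] * c i)]) ->
  exists q, [/\ po K q, q.[t] != 0 & forall i, (i < n)%N -> S (q.[t] * c i)].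
Proof.
move=> hK hS KS h; elim: n => [|n [q [hq q0 IH]]].
  by exists 1; split=> //; [apply: po1|rewrite hornerC oner_eq0].
have [q' [hq' q0' hn]] := h n; exists (q * q'); split; first exact: poM.
  by rewrite hornerM mulf_neq0.
move=> i; rewrite ltnS leq_eqVlt hornerM => /orP[/eqP ->|/IH h'].
  by rewrite -mulrA; apply: sringM => //; apply: KS.
by rewrite [q.[t] * _]mulrC -mulrA; apply: sringM => //; apply: KS.
Qed.

Lemma po_laur_adj K ts t q : sring K -> po K q -> laur (adj K t) ts q.[t].
Proof.
move=> hK hq; apply: laur_base; first exact: adj_sring.
by exists q, 0%N; rewrite mulr1.
Qed.

Lemma laur_den K t ts x : sring K -> laur (fr K t) ts x ->
  exists q, [/\ po K q, q.[t] != 0 & laur (adj K t) ts (q.[t] * x)].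
Proof.
move=> hK; elim: ts x => [|s ts IH] x /=.
  move=> [p [q [hp hq q0 ->]]]; exists q; split=> //.
  by exists p, 0%N; split=> //; rewrite mulr1 mulrC divfK.
move=> [p [k [hp e]]]; have hL := laur_sring ts (adj_sring t hK).
have [q [hq q0 h]] := common_den (size p) hK hL (fun q => @po_laur_adj K ts t q hK) (fun i => IH _ (hp i)).
exists q; split=> //; exists (q.[t] *: p), k; split; last by rewrite hornerZ -e mulrA.
move=> i; rewrite coefZ; have [/h //|hi] := ltnP i (size p).
by rewrite nth_default // mulr0; apply: sring0.
Qed.

(** Multiplication by a common denominator turns a relation with coefficients over $K(t)$ into one
    over $K[t,t^{-1}]$. *)
Lemma chain_fr K t ts : sring K -> chain (adj K t) ts -> chain (fr K t) ts.
Proof.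
move=> hK; elim: ts => //= s ts IH [hc ht]; split; first exact: IH.
move=> p hp p0; have hL := laur_sring ts (adj_sring t hK).
have [q [hq q0 h]] := common_den (size p) hK hL (fun q => @po_laur_adj K ts t q hK)
  (fun i => @laur_den K t ts _ hK (hp i)).
suff /eqP : q.[t] *: p = 0 by rewrite scaler_eq0 (negPf q0) => /eqP.
apply: ht; last by rewrite hornerZ p0 mulr0.
  move=> i; rewrite coefZ; have [/h //|hi] := ltnP i (size p).
  by rewrite nth_default // mulr0; apply: sring0.
Qed.

(** With its converse below, this changes the order of adjunction: the induction of [SK1] splits off
    the innermost variable, whereas [core] specialises the outermost one. *)
Lemma laur_adjC K t ts x : sring K -> (forall s, s \in ts -> s != 0) ->
  laur (adj K t) ts x -> adj (laur K ts) t x.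
Proof.
move=> hK h0; have hL := laur_sring ts hK; apply: laur_min; first exact: adj_sring.
  by move=> y; apply: adj_mono => z; apply: laur_base.
move=> s hs; have [h1 h2] := laur_gen hK hs (h0 s hs).
by split; [apply: h0|apply: adj_sub|apply: adj_sub].
Qed.
Lemma adj_laurC K t ts x : sring K -> t != 0 -> adj (laur K ts) t x -> laur (adj K t) ts x.
Proof.
move=> hK t0; have hA := adj_sring t hK; apply: adj_min => //; first exact: laur_sring.
- by move=> y; apply: laur_mono => z; apply: adj_sub.
- by apply: laur_base => //; apply: adj_t.
- by apply: laur_base => //; apply: adj_tV.
Qed.

(** An exchange argument: a relation for [t] is multiplied by a power of the first variable [s] and
    regrouped by powers of [s]. Transcendence of [s] annihilates every group, and every group is a
    relation for [t] over the shorter list. *)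
Lemma trans_laur K t ts : sring K -> trans K t -> chain (adj K t) ts -> trans (laur K ts) t.
Proof.
move=> hK tK; elim: ts => //= s ts IH [hc ht].
have hL := laur_sring ts hK; have t0 := trans_neq0 hK tK.
have s0 : s != 0 by apply: (trans_neq0 _ ht); apply: laur_sring; apply: adj_sring.
move=> p hp p0.
have [k hk] : exists k, forall i, exists r, po (laur K ts) r /\ p`_i * s ^+ k = r.[s].
  have [k hk] : exists k, forall i, (i < size p)%N -> exists r, po (laur K ts) r /\ p`_i * s ^+ k = r.[s].
    elim: (size p) => [|n [k IHn]]; first by exists 0%N.
    have [r [l [hr er]]] := hp n; exists (k + l)%N => i; rewrite ltnS leq_eqVlt.
    case/orP => [/eqP ->|/IHn [r' [hr' er']]].
      exists (r * 'X^k); split; first by apply: poM => //; apply: poXn.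
      by rewrite !hornerE ?hornerXn -er exprD [s ^+ k * _]mulrC mulrA.
    exists (r' * 'X^l); split; first by apply: poM => //; apply: poXn.
    by rewrite !hornerE ?hornerXn -er' exprD mulrA.
  exists k => i; have [/hk //|hi] := ltnP i (size p).
  exists 0; split; first by apply: (poC hL); apply: sring0.
  by rewrite nth_default // mul0r horner0.
have [r hr] := choice hk.
pose m := \max_(i < size p) size (r i).
(* The regrouped relation: a polynomial to be evaluated at [s], whose coefficients are polynomials
   in [t]. *)
pose g := \poly_(j < m) (\sum_(i < size p) (r i)`_j * t ^+ i).
have rE (i : 'I_(size p)) : (r i).[s] = \sum_(j < m) (r i)`_j * s ^+ j.
  rewrite (@horner_coef_wide _ m) //.
  exact: (@leq_bigmax _ (fun i : 'I_(size p) => size (r i))).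
have g0 : g = 0.
  apply: ht => [j|].
    rewrite coef_poly; case: ifP => _; last by apply: sring0; apply: laur_sring; apply: adj_sring.
    apply: adj_laurC => //; apply: sring_sum => [|i _]; first exact: adj_sring.
    apply: sringM; first exact: adj_sring.
      by apply: adj_sub => //; case: (hr i) => h _; apply: h.
    by apply: sringX; [apply: adj_sring|apply: adj_t].
  rewrite horner_poly; under eq_bigr do rewrite big_distrl /=.
  rewrite exchange_big /=.
  transitivity (s ^+ k * p.[t]); last by rewrite p0 mulr0.
  rewrite horner_coef big_distrr /=; apply: eq_bigr => i _.
  have [_ e] := hr i; rewrite mulrA [s ^+ k * _]mulrC e rE big_distrl /=.
  by apply: eq_bigr => j _; rewrite mulrAC.
have rz (i : 'I_(size p)) j : (r i)`_j = 0.
  have [hj|hj] := ltnP j m; last first.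
    rewrite nth_default //; apply: leq_trans hj.
    exact: (@leq_bigmax _ (fun i : 'I_(size p) => size (r i))).
  pose h := \poly_(l < size p) (r l)`_j.
  have h0 : h = 0.
    apply: IH => // [l|].
      rewrite coef_poly; case: ifP => _; last exact: sring0.
      by case: (hr l) => hl _; apply: hl.
    rewrite horner_poly; have := congr1 (fun q : {poly F} => q`_j) g0.
    by rewrite coef_poly hj coef0.
  by have := congr1 (fun q : {poly F} => q`_i) h0; rewrite coef_poly ltn_ord coef0.
apply/polyP => i; rewrite coef0; have [hi|hi] := ltnP i (size p); last by rewrite nth_default.
have [_ e] := hr i; apply/eqP; rewrite -(mulIr_eq0 _ (mulIf (expf_neq0 k s0))) e.
by rewrite (rE (Ordinal hi)) big1 // => j _; rewrite (rz (Ordinal hi)) mul0r.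
Qed.

(** * Units of an iterated Laurent ring *)

Section Units.
(** Once powers of [t] are cleared, the two mutually inverse elements become polynomials with
    product $X^{k+l}$. Each is therefore a constant times a power of $X$, and the constants are
    mutually inverse in the smaller ring. *)
Lemma chain_units K ts x y : sring K -> chain K ts -> laur K ts x -> laur K ts y -> x * y = 1 ->
  exists c d (z : seq int), [/\ K c, K d, c * d = 1, size z = size ts &
    x = c * \prod_(i < size ts) ts`_i ^ z`_i].
Proof.
move=> hK; elim: ts x y => [|t ts IH] x y /=.
  by move=> _ hx hy e; exists x, y, [::]; rewrite big_ord0 mulr1.
move=> [hc ht] [p [k [hp ep]]] [q [l [hq eq]]] xy.
have hL := laur_sring ts hK; have t0 := trans_neq0 hL ht.
have pq : p * q = 'X^(k + l).
  apply/eqP; rewrite -subr_eq0; apply/eqP/ht.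
    by apply: poB => //; [apply: poM|apply: poXn].
  by rewrite !hornerE ?hornerXn -ep -eq mulrACA xy mul1r exprD subrr.
have mono (u v : {poly F}) m : u * v = 'X^m -> exists a b, u = a *: 'X^b.
  move=> uv; have : u %| ('X - 0%:P) ^+ m by rewrite subr0 -uv dvdp_mulr.
  case/dvdp_exp_XsubCP => b [_]; rewrite subr0 => /eqpP[[a1 a2] /= /andP[a10 a20] e].
  exists (a2 / a1), b; apply: (scalerI a10); rewrite e scalerA mulrC divfK //.
have [a [b eu]] := mono _ _ _ pq; have [a' [b' ev]] := mono q p (k + l)%N (etrans (mulrC _ _) pq).
have La : laur K ts a by have := hp b; rewrite eu coefZ coefXn eqxx mulr1.
have La' : laur K ts a' by have := hq b'; rewrite ev coefZ coefXn eqxx mulr1.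
have aa : a * a' = 1.
  have := pq; rewrite eu ev -scalerAl -scalerAr scalerA -exprD.
  move/(congr1 (fun p : {poly F} => p.[1])); rewrite !hornerE ?hornerXn !expr1n mulr1 //.
have [c [d [z [Kc Kd cd sz ea]]]] := IH a a' hc La La' aa.
exists c, d, ((b%:Z - k%:Z) :: z); split=> //=; first by rewrite sz.
rewrite big_ord_recl /= mulrCA -ea.
have -> : t ^ (b%:Z - k%:Z) = t ^+ b / t ^+ k by rewrite expfzDr // exprnN.
have := ep; rewrite eu !hornerE ?hornerXn => e.
by rewrite mulrAC [t ^+ b * a]mulrC -e mulfK // expf_neq0.
Qed.
End Units.

(* Substitution of a matrix for the transcendental element [t]; only the
   values on elements of the form [p(t) / g(t)^k] matter. *)
Lemma evalP S t (g : {poly F}) d (C G : 'M[F]_d.+1) : sring S -> trans S t -> po S g ->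
  horner_mx C g * G = 1 -> G * horner_mx C g = 1 ->
  exists psi : F -> 'M[F]_d.+1, forall x k p, po S p -> x * g.[t] ^+ k = p.[t] ->
     psi x = horner_mx C p * G ^+ k.
Proof.
move=> hS ht hg gG Gg.
have gGn n : horner_mx C g ^+ n * G ^+ n = 1.
  elim: n => [|n IH]; first by rewrite !expr0 mulr1.
  by rewrite exprSr exprS mulrA -[X in X * _]mulrA gG mulr1 IH.
suff h x : exists M : 'M[F]_d.+1, forall k p, po S p -> x * g.[t] ^+ k = p.[t] -> M = horner_mx C p * G ^+ k.
  by have [psi hpsi] := choice h; exists psi.
case: (pselect (exists k p, po S p /\ x * g.[t] ^+ k = p.[t])) => [[k [p [hp ep]]]|h]; last first.
  by exists 0 => k p hp ep; case: h; exists k, p.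
exists (horner_mx C p * G ^+ k) => l r hr er.
have e : p * g ^+ l = r * g ^+ k.
  apply/eqP; rewrite -subr_eq0; apply/eqP/ht.
    by apply: poB => //; apply: poM => //; apply: poE.
  by rewrite !hornerE ?horner_exp -ep -er mulrAC subrr.
have := congr1 (horner_mx C) e; rewrite !rmorphM !rmorphXn /= => eC.
rewrite -[horner_mx C p]mulr1 -(gGn l) mulrA eC -!mulrA -exprD addnC exprD [X in _ * X]mulrA.
by rewrite gGn mul1r.
Qed.

(** This is $S[t]$ with $g(t)$ inverted, the part of the field on which the map of [evalP] is
    determined. *)
Definition denoms S t (g : {poly F}) x := exists k p, po S p /\ x * g.[t] ^+ k = p.[t].

(** The laws are required on [Q] only: a map obtained from [evalP] is total on [F], and its values
    off the subring are arbitrary. *)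
Record is_hom d Q (psi : F -> 'M[F]_d.+1) : Prop := IsHom {
  hom1 : psi 1 = 1;
  homD : forall x y, Q x -> Q y -> psi (x + y) = psi x + psi y;
  homM : forall x y, Q x -> Q y -> psi (x * y) = psi x * psi y }.

Lemma denoms_sring S t g : sring S -> po S g -> sring (denoms S t g).
Proof.
move=> hS hg; split.
- by exists 0%N, 1; split; [apply: po1|rewrite hornerC mulr1].
- move=> x y [k [p [hp ep]]] [l [q [hq eq]]]; exists (k + l)%N, (p * g ^+ l - q * g ^+ k); split.
    by apply: poB => //; apply: poM => //; apply: poE.
  by rewrite !hornerE ?horner_exp exprD mulrBl mulrA ep [g.[t] ^+ k * _]mulrC mulrA eq.
- move=> x y [k [p [hp ep]]] [l [q [hq eq]]]; exists (k + l)%N, (p * q); split; first exact: poM.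
  by rewrite hornerM -ep -eq exprD mulrACA.
Qed.

Lemma eval_hom S t (g : {poly F}) d (C G : 'M[F]_d.+1) psi : sring S -> po S g ->
  horner_mx C g * G = 1 -> G * horner_mx C g = 1 ->
  (forall x k p, po S p -> x * g.[t] ^+ k = p.[t] -> psi x = horner_mx C p * G ^+ k) ->
  is_hom (denoms S t g) psi.
Proof.
move=> hS hg gG Gg hpsi.
have com p : G * horner_mx C p = horner_mx C p * G.
  rewrite -[X in X = _]mulr1 -gG mulrA -[X in X * _]mulrA -rmorphM [p * g]mulrC rmorphM.
  by rewrite mulrA Gg mul1r.
have comn k p : G ^+ k * horner_mx C p = horner_mx C p * G ^+ k.
  by elim: k => [|k IH]; rewrite ?expr0 ?mulr1 ?mul1r // exprS -mulrA IH mulrA com -mulrA.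
have gGn n : horner_mx C g ^+ n * G ^+ n = 1.
  elim: n => [|n IH]; first by rewrite !expr0 mulr1.
  by rewrite exprSr exprS mulrA -[X in X * _]mulrA gG mulr1 IH.
split.
- rewrite (hpsi 1 0%N 1) ?expr0 ?mulr1 ?rmorph1 ?hornerC //; exact: po1.
- move=> x y [k [p [hp ep]]] [l [q [hq eq]]].
  rewrite (hpsi x k p) // (hpsi y l q) // (hpsi (x + y) (k + l)%N (p * g ^+ l + q * g ^+ k)).
  + rewrite rmorphD !rmorphM !rmorphXn /= mulrDl; congr (_ + _).
      by rewrite addnC exprD -!mulrA [X in _ * X]mulrA gGn mul1r.
    by rewrite exprD -!mulrA [X in _ * X]mulrA gGn mul1r.
  + by apply: poD => //; apply: poM => //; apply: poE.
  + by rewrite !hornerE ?horner_exp exprD mulrDl mulrA ep [g.[t] ^+ k * _]mulrC mulrA eq.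
- move=> x y [k [p [hp ep]]] [l [q [hq eq]]].
  rewrite (hpsi x k p) // (hpsi y l q) // (hpsi (x * y) (k + l)%N (p * q)).
  + by rewrite rmorphM /= exprD -!mulrA; congr (_ * _); rewrite !mulrA comn.
  + exact: poM.
  + by rewrite hornerM -ep -eq exprD mulrACA.
Qed.

Definition tens d (I : finType) (psi : F -> 'M[F]_d.+1) (A : sqm F I) : sqm F (I * 'I_d.+1)%type :=
  fun u v => psi (A u.1 v.1) u.2 v.2.

Section Tens.
Variables (d : nat) (Q : F -> Prop) (psi : F -> 'M[F]_d.+1) (hQ : sring Q) (hpsi : is_hom Q psi).
Lemma hom0 : psi 0 = 0.
Proof.
have h := homD hpsi (sring0 hQ) (sring0 hQ); rewrite addr0 in h.
by apply/esym/eqP; rewrite -(inj_eq (addrI (psi 0))) addr0 -h.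
Qed.
Lemma hom_sum T (r : seq T) (f : T -> F) : (forall i, Q (f i)) ->
  psi (\sum_(i <- r) f i) = \sum_(i <- r) psi (f i).
Proof.
move=> h; elim: r => [|i r IH]; first by rewrite !big_nil hom0.
by rewrite !big_cons (homD hpsi) ?IH //; apply: sring_sum.
Qed.
Lemma tens1 (I : finType) : tens psi (1 : sqm F I) = 1.
Proof.
apply: sqmP => -[i a] [j b]; rewrite /tens !sqmE /= xpair_eqE; case: eqP => _ /=.
  by rewrite mulr1n (hom1 hpsi) mxE.
by rewrite mulr0n hom0 mxE.
Qed.
Lemma tensM (I : finType) (A B : sqm F I) : over Q A -> over Q B -> tens psi (A * B) = tens psi A * tens psi B.
Proof.
move=> hA hB; apply: sqmP => -[i a] [j b]; rewrite /tens /= sqm_mulE hom_sum; last first.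
  by move=> k; apply: sringM.
rewrite summxE; under eq_bigr do rewrite (homM hpsi) // mxE.
by rewrite pair_big /= sqm_mulE; apply: eq_bigr => -[k c].
Qed.
Lemma tensD (I : finType) (A B : sqm F I) : over Q A -> over Q B -> tens psi (A + B) = tens psi A + tens psi B.
Proof.
by move=> hA hB; apply: sqmP => -[i a] [j b]; rewrite /tens !sqmE /= (homD hpsi) // mxE.
Qed.
Lemma tens_ext (I J : finType) (f : I -> J) (A : sqm F I) : injective f ->
  tens psi (ext f A) = ext (fun x : I * 'I_d.+1 => (f x.1, x.2)) (tens psi A).
Proof.
move=> inj; apply/esym/extP => [[i a] [i' a'] /= [/inj -> ->] //|[i a] [j b]|[k a] [l b] h].
  by rewrite /tens /= extf.
have h' : (forall i, f i <> k) \/ (forall i, f i <> l).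
  by case: h => h; [left|right] => i e; [apply: (h (i, a))|apply: (h (i, b))]; rewrite /= e.
rewrite /tens /= ext_out // xpair_eqE; case: eqP => _ /=.
  by rewrite mulr1n (hom1 hpsi) mxE.
by rewrite mulr0n hom0 mxE.
Qed.
(** An elementary matrix with entry [c] becomes the identity plus the single off-diagonal block
    [psi c], which [EL_unip] factors. *)
Lemma EL_tens (P : F -> Prop) (I : finType) (A : sqm F I) : sring P ->
  (forall x a b, Q x -> P (psi x a b)) -> EL Q A -> EL P (tens psi A).
Proof.
move=> hP QP; elim=> [|i j c {}A ij hc hA IH]; first by rewrite tens1; apply: EL1.
have o1 : over Q (1 : sqm F I) by apply: over1.
have o2 : over Q (de i j c) by apply: over_de.
rewrite tensM ?tensD //; [|exact: overD|exact: EL_over].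
apply: EL_mul => //; rewrite tens1; apply: (EL_unip (p := fun u : I * 'I_d.+1 => u.1 == i)).
  by move=> x y; apply: QP; apply: o2.
move=> [k a] [l b] /= h; rewrite /tens /de /=; case: eqP => [e|_]; last by rewrite mul0r hom0 mxE.
case: eqP => [e'|_]; last by rewrite mul0r hom0 mxE.
by move: h; rewrite e e' eqxx eq_sym ij.
Qed.
End Tens.
End Laurent.

(** * Companion matrices *)

Section Companion.
Import GRing.Theory.
Local Open Scope ring_scope.
Variable F : fieldType.

Section PolyDiv.
Variables (P : F -> Prop) (hP : sring P).

Let po0 : po P 0.
Proof. by move=> i; rewrite coef0; apply: sring0. Qed.

(** Division by a monic polynomial never leaves the coefficient ring, which here is a Laurent ring
    and not a field. *)
Lemma po_divmod (f Q : {poly F}) : f \is monic -> po P f -> po P Q ->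
  exists k r, [/\ po P k, po P r, Q = f * k + r & (size r < size f)%N].
Proof.
move=> mf hf; move en : (size Q) => n; elim/ltn_ind: n Q en => n IH Q en hQ.
have [h|h] := ltnP n (size f).
  by exists 0, Q; rewrite mulr0 add0r en; split=> //; apply: po0.
have sf : (0 < size f)%N by rewrite size_poly_gt0 monic_neq0.
pose m := (n - size f)%N; pose a := Q`_n.-1.
pose Q' := Q - f * (a *: 'X^m).
have ha : po P (a *: 'X^m) by apply: poZ => //; [apply: hQ|apply: poXn].
have sQ' : (size Q' < n)%N.
  rewrite -[n]prednK ?(leq_trans sf) // ltnS; apply/leq_sizeP => i hi.
  rewrite coefB -scalerAr coefZ coefMXn.
  have -> : (i < m)%N = false by apply/negbTE; rewrite -leqNgt; lia.
  have [e|ne] := eqVneq i n.-1.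
    rewrite e (_ : (n.-1 - m = (size f).-1)%N); last by rewrite /m; lia.
    by rewrite -[X in _ * X]/(lead_coef f) (monicP mf) mulr1 subrr.
  have h1 : (size f <= i - m)%N by rewrite /m; lia.
  have h2 : (size Q <= i)%N by rewrite en; lia.
  by rewrite !nth_default ?mulr0 ?subr0.
have [k [r [hk hr e sr]]] := IH _ sQ' Q' erefl (poB hP hQ (poM hP hf ha)).
exists (k + a *: 'X^m), r; split=> //; first exact: poD.
by rewrite mulrDr addrAC -e subrK.
Qed.

(** As the constant term of [f] is invertible, $X^c$ is invertible modulo [f]. The shape
    $Q-X^cx=fk+X^c$ makes [f] invertible modulo the left side as soon as $X$ is. *)
Lemma po_bezout (f Q : {poly F}) c : f \is monic -> po P f -> P (f`_0)^-1 -> f`_0 != 0 -> po P Q ->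
  exists k x, [/\ po P k, po P x, (size x <= size f)%N & Q = 'X^c * x + (f * k + 'X^c)].
Proof.
move=> mf hf hv f0 hQ; pose f0' := (f`_0)^-1 *: f.
have [g eg] : exists g, 1 - f0' = 'X * g.
  have : root (1 - f0') 0 by rewrite rootE !hornerE horner_coef0 mulVf // subrr.
  by case/factor_theorem => g ->; exists g; rewrite subr0 mulrC.
have hf0 : po P f0' by apply: poZ.
have hg : po P g.
  move=> i; have := congr1 (fun p : {poly F} => p`_i.+1) eg; rewrite coefXM /= => <-.
  by apply: poB => //; apply: po1.
(* From $1-f_0'=Xg$ the finite geometric series yields $1=bf_0'+X^cg^c$. *)
pose b := \sum_(i < c) (1 - f0') ^+ i.
have eb : 1 = b * f0' + 'X^c * g ^+ c.
  rewrite -exprMn -eg /b; elim: c {hQ b} => [|c IH]; first by rewrite big_ord0 mul0r add0r expr0.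
  rewrite big_ord_recr /= mulrDl exprS {1}IH -addrA; congr (_ + _).
  by rewrite mulrBl mul1r mulrC addrC subrK.
have hb : po P b.
  by apply: big_ind => [|x y|i _]; [apply: po0|apply: poD|apply: poE => //; apply: poB => //; apply: po1].
have [k [r [hk hr e sr]]] := po_divmod mf hf (poM hP hQ (poE hP c hg)).
(* The remainder is lowered by 1 to make room for the separate term $X^c$. *)
exists ((f`_0)^-1 *: (Q * b) + 'X^c * k), (r - 1); split.
- by apply: poD => //; [apply: poZ => //; apply: poM|apply: poM => //; apply: poXn].
- by apply: poB => //; apply: po1.
- apply: leq_trans (size_polyD _ _) _; rewrite size_polyN size_poly1 geq_max (ltnW sr) /=.
  by rewrite size_poly_gt0 monic_neq0.
- rewrite -{1}[Q]mulr1 {1}eb mulrDr /f0' -scalerAr.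
  have -> : Q * ('X^c * g ^+ c) = 'X^c * (f * k + r) by rewrite -e mulrCA.
  rewrite -scalerAr -!mul_polyC; ring.
Qed.
End PolyDiv.

(** * Companion matrices of $(X-w)(X^d+1)-\xi$ *)

Section Comp.
Variables (d : nat) (w : F).
Hypothesis d2 : (1 < d)%N.
Implicit Types (xi p : {poly F}) (X Y : 'M[F]_d.+1).

(** Multiplication by $X$ modulo [cpoly xi] on the basis $1,X,\dots,X^{d-1},X^d+1$, for [xi] of
    degree below [d]. The last basis vector is an eigenvector for [xi = 0], with eigenvalue [w]. *)
Definition cmx xi : 'M[F]_d.+1 := \matrix_(a, b)
  ((a == b.+1 :> nat)%:R - ((b == d.-1 :> nat) && (a == 0 :> nat))%:R
   + (b == d :> nat)%:R * (if a == d :> nat then w else xi`_a)).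

Definition cpoly xi : {poly F} := ('X - w%:P) * ('X^d + 1) - xi.

Let e (i : nat) : 'cV[F]_d.+1 := delta_mx (inord i) 0.

Lemma cmx_e xi i : (i < d.-1)%N -> cmx xi *m e i = e i.+1.
Proof.
move=> hi; rewrite /e -colE; apply/colP => a; rewrite !mxE !andbT -!val_eqE /=.
rewrite inordK; last by lia.
rewrite inordK; last by lia.
have -> : (i == d.-1) = false by lia.
have -> : (i == d) = false by lia.
by rewrite mul0r addr0 subr0.
Qed.
Lemma cmx_e1 xi : cmx xi *m e d.-1 = e d - e 0.
Proof.
rewrite /e -colE; apply/colP => a; rewrite !mxE !andbT -!val_eqE /=.
rewrite inordK; last by lia.
rewrite inordK; last by lia.
rewrite inordK; last by lia.
have -> : (d.-1 == d) = false by lia.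
have -> : d.-1.+1 = d by lia.
by rewrite eqxx mul0r addr0.
Qed.
Lemma cmx_e2 xi : (size xi <= d)%N -> cmx xi *m e d = w *: e d + \sum_(i < d) xi`_i *: e i.
Proof.
move=> sx; rewrite /e -colE; apply/colP => a; rewrite !mxE summxE !andbT -!val_eqE /=.
rewrite inordK; last by lia.
have ha := ltn_ord a.
have -> : (a == d.+1 :> nat) = false by lia.
have -> : (d == d.-1) = false by lia.
rewrite eqxx mul1r subr0 add0r; case: (eqVneq (a : nat) d) => had.
  rewrite mulr1 big1 ?addr0 // => i _; rewrite !mxE andbT -val_eqE /=.
  have hi := ltn_ord i; rewrite inordK; last by lia.
  have -> : (a == i :> nat) = false by lia.
  by rewrite mulr0.
have ha' : (a < d)%N by lia.
rewrite mulr0 add0r (bigD1 (Ordinal ha')) //= !mxE andbT -val_eqE /=.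
rewrite inordK; last by lia.
rewrite eqxx mulr1 big1 ?addr0 // => i hi; rewrite !mxE andbT -val_eqE /=.
have hi' := ltn_ord i; rewrite inordK; last by lia.
have -> : (a == i :> nat) = false.
  by apply: contraNF hi => /eqP h; apply/eqP/val_inj; rewrite /= h.
by rewrite mulr0.
Qed.

Lemma horner_mxE (C : 'M[F]_d.+1) p : horner_mx C p = \sum_(i < size p) p`_i *: C ^+ i.
Proof.
rewrite -{1}[p]coefK poly_def rmorph_sum /=; apply: eq_bigr => i _.
by rewrite horner_mxZ rmorphXn /= horner_mx_X.
Qed.

Lemma cmx_pow xi i : (i < d)%N -> (cmx xi ^+ i) *m e 0 = e i.
Proof.
elim: i => [|i IH] hi; first by rewrite expr0 mul1mx.
by rewrite exprS -[_ * _]/(_ *m _) -mulmxA IH ?cmx_e //; lia.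
Qed.

(** The vector [e 0] is cyclic, so it suffices that the polynomial annihilates it; there the claim
    is the formula for the image of [e d]. *)
Lemma cpoly0 xi : (size xi <= d)%N -> horner_mx (cmx xi) (cpoly xi) = 0.
Proof.
move=> sx; set C := cmx xi.
have hX p : horner_mx C ('X * p) = C * horner_mx C p by rewrite rmorphM /= horner_mx_X.
have ed : horner_mx C ('X^d + 1) *m e 0 = e d.
  rewrite rmorphD rmorph1 rmorphXn /= horner_mx_X mulmxDl mul1mx.
  have -> : C ^+ d = C * C ^+ d.-1 by rewrite -exprS prednK //; lia.
  rewrite -[_ * _]/(_ *m _) -mulmxA cmx_pow; last by lia.
  by rewrite cmx_e1 subrK.
have q0 : horner_mx C (cpoly xi) *m e 0 = 0.
  rewrite /cpoly rmorphB rmorphM /= mulmxBl -[_ * _]/(_ *m _) -mulmxA ed.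
  rewrite rmorphB /= horner_mx_X horner_mx_C mulmxBl cmx_e2 // mul_scalar_mx.
  rewrite [w *: _ + _]addrC addrK horner_mxE mulmx_suml.
  rewrite [X in _ - X](eq_bigr (fun i : 'I_(size xi) => xi`_i *: e i)); last first.
    move=> i _; rewrite -scalemxAl cmx_pow //; apply: leq_trans sx => //.
  rewrite [X in _ - X](big_ord_widen d (fun i => xi`_i *: e i)) // [X in _ - X]big_mkcond /=.
  apply/eqP; rewrite subr_eq0; apply/eqP/eq_bigr => i _; case: ifP => // /negbT.
  by rewrite -leqNgt => h; rewrite nth_default // scale0r.
have qp p : horner_mx C (cpoly xi) *m (horner_mx C p *m e 0) = 0.
  rewrite mulmxA -[_ *m horner_mx C p]/(_ * _) -rmorphM mulrC rmorphM -[_ * _]/(_ *m _).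
  by rewrite -mulmxA q0 mulmx0.
apply/matrixP => a b; rewrite [RHS]mxE.
have -> : horner_mx C (cpoly xi) a b = (horner_mx C (cpoly xi) *m e b) a 0.
  by rewrite /e inord_val -colE mxE.
have [hb|hb] := ltnP b d.
  have -> : e b = horner_mx C 'X^b *m e 0 by rewrite rmorphXn /= horner_mx_X cmx_pow.
  by rewrite qp mxE.
have -> : (b : nat) = d by have := ltn_ord b; lia.
by rewrite -ed qp mxE.
Qed.

Hypothesis w0 : w != 0.
(** If [xi] has constant term 0, that of [cpoly xi] is $-w$, and dividing [w%:P + cpoly xi] by $wX$
    gives this inverse of $X$ modulo [cpoly xi]. *)
Definition ci_poly xi : {poly F} := w^-1 *: ('X^d + 1 - w%:P * 'X^(d.-1) - drop_poly 1 xi).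
Definition cinv xi : 'M[F]_d.+1 := horner_mx (cmx xi) (ci_poly xi).

Lemma cinvE xi : (size xi <= d)%N -> xi`_0 = 0 -> cmx xi * cinv xi = 1 /\ cinv xi * cmx xi = 1.
Proof.
move=> sx x0; have ex : xi = 'X * drop_poly 1 xi.
  rewrite -{1}(poly_take_drop 1 xi) expr1 mulrC; apply/eqP; rewrite -subr_eq0 addrK.
  apply/eqP/polyP => i; rewrite coef_take_poly coef0; case: i => [|i] //=.
have e1 : 'X * ci_poly xi = 1 + w^-1 *: cpoly xi.
  have -> : 1 + w^-1 *: cpoly xi = w^-1 *: (w%:P + cpoly xi) by rewrite [RHS]scalerDr scale_polyC mulVf.
  rewrite /ci_poly /cpoly {2}ex -scalerAr; congr (_ *: _).
  have -> : 'X^d = 'X * 'X^(d.-1) :> {poly F} by rewrite -exprS prednK //; lia.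
  ring.
have h : horner_mx (cmx xi) ('X * ci_poly xi) = 1.
  by rewrite e1 rmorphD rmorph1 /= horner_mxZ cpoly0 // scaler0 addr0.
split; first by rewrite /cinv -[RHS]h rmorphM /= horner_mx_X.
by rewrite /cinv -[RHS]h mulrC rmorphM /= horner_mx_X.
Qed.

(** The polynomial expression for the inverse involves [w] and hides that, outside the last row, the
    entries for [xi = 0] are 0, 1 or $-1$; [tri_cinv] depends on this. *)
Definition cinv0 : 'M[F]_d.+1 := \matrix_(a, b)
  (((b == a.+1 :> nat) && (b < d)%N)%:R - ((b == 0 :> nat) && (a == d.-1 :> nat))%:R
   + (((b == 0 :> nat) || (b == d :> nat)) && (a == d :> nat))%:R * w^-1).

Lemma cinv0E : cinv 0 = cinv0.
Proof.
have [h1 h2] : cmx 0 * cinv 0 = 1 /\ cinv 0 * cmx 0 = 1 by apply: cinvE; rewrite ?size_poly0 ?coef0.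
suff h : cmx 0 * cinv0 = 1 by rewrite -[LHS]mulr1 -h mulrA h2 mul1r.
apply/matrixP => a b; rewrite !mxE.
pose Y (c : nat) : F := ((((b : nat) == c.+1) && (b < d)%N)%:R - (((b : nat) == 0%N) && (c == d.-1))%:R
   + ((((b : nat) == 0%N) || ((b : nat) == d)) && (c == d))%:R * w^-1).
have -> : \sum_c (cmx 0) a c * cinv0 c b =
   (if (a : nat) is a'.+1 then Y a' else 0) - (a == 0 :> nat)%:R * Y d.-1 + (a == d :> nat)%:R * (w * Y d).
  rewrite (eq_bigr (fun c : 'I_d.+1 => (a == c.+1 :> nat)%:R * Y c + (- ((c == d.-1 :> nat)%:R * ((a == 0 :> nat)%:R * Y c))
       + (c == d :> nat)%:R * ((a == d :> nat)%:R * (w * Y c))))); last first.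
    move=> c _; rewrite !mxE coef0 -/(Y c) /Y; set y := (_ + _ * w^-1).
    by case: (_ == c.+1 :> nat); case: (_ == d.-1 :> nat); case: (a == 0 :> nat); case: (c == d :> nat); case: (a == d :> nat); rewrite /=; ring.
  have pick (k : nat) (f : nat -> F) : (k < d.+1)%N -> \sum_(c < d.+1) ((c : nat) == k)%:R * f c = f k.
    move=> hk; rewrite (bigD1 (Ordinal hk)) //= eqxx mul1r big1 ?addr0 // => c hc.
    by rewrite (_ : (c == k :> nat) = false) ?mul0r //; apply: contraNF hc => /eqP h; apply/eqP/val_inj.
  rewrite !big_split /= sumrN (pick d.-1 (fun c => (a == 0 :> nat)%:R * Y c)); last by lia.
  rewrite (pick d (fun c => (a == d :> nat)%:R * (w * Y c))) // addrA; congr (_ - _ + _).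
  case ea : (a : nat) => [|a'].
    by rewrite big1 // => c _; rewrite mul0r.
  rewrite -(pick a' Y); last by have := ltn_ord a; lia.
  by apply: eq_bigr => c _; rewrite eqSS eq_sym.
have ha := ltn_ord a; have hb := ltn_ord b; rewrite /Y -val_eqE /=.
case ea : (a : nat) => [|a'].
  have -> : (0%N == d) = false by lia.
  have -> : (d.-1 == d) = false by lia.
  have -> : ((b : nat) == d.-1.+1) && (b < d)%N = false by lia.
  by rewrite !eqxx [0%N == b]eq_sym; case: (b == 0%N :> nat); case: (b == d :> nat); rewrite /=; ring.
have [had|had] := eqVneq a'.+1 d.
  have -> : (a' == d.-1) = true by lia.
  have -> : (a' == d) = false by lia.
  have -> : (d == d.-1) = false by lia.
  have -> : ((b : nat) == a'.+1) && (b < d)%N = false by lia.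
  have -> : ((b : nat) == d.+1) && (b < d)%N = false by lia.
  have -> : (a'.+1 == b) = ((b : nat) == d) by rewrite had eq_sym.
  have -> : (d == d) = true by exact: eqxx.
  case: (eqVneq (b : nat) 0%N) => hb0.
    have -> : ((b : nat) == d) = false by lia.
    by rewrite /=; field.
  by case: (b == d :> nat); rewrite /=; field.
have -> : (a' == d.-1) = false by lia.
have -> : (a' == d) = false by lia.
have -> : (a'.+1 == b) = ((b : nat) == a'.+1) && (b < d)%N by lia.
by rewrite !andbF (_ : (a'.+1 == 0%N) = false) //=; ring.
Qed.

(** A window of rows that tracks how far powers of the companion matrices move vectors. Away from
    both ends these matrices are index shifts that do not see [xi]. *)
Definition rows lo hi X := forall (a b : 'I_d.+1), ~~ (lo <= a <= hi)%N -> X a b = 0.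

Lemma rowsW lo hi lo' hi' X : (lo' <= lo)%N -> (hi <= hi')%N -> rows lo hi X -> rows lo' hi' X.
Proof. by move=> h1 h2 hX a b h; apply: hX; apply: contra h => /andP[h3 h4]; apply/andP; split; lia. Qed.
Lemma rowsMr lo hi X Y : rows lo hi X -> rows lo hi (X * Y).
Proof. by move=> hX a b h; rewrite mxE big1 // => c _; rewrite hX // mul0r. Qed.
Lemma rowsD lo hi X Y : rows lo hi X -> rows lo hi Y -> rows lo hi (X + Y).
Proof. by move=> hX hY a b h; rewrite mxE hX // hY // addr0. Qed.
Lemma rowsN lo hi X : rows lo hi X -> rows lo hi (- X).
Proof. by move=> hX a b h; rewrite mxE hX // oppr0. Qed.
Lemma rows_sum lo hi T (r : seq T) (f : T -> 'M[F]_d.+1) (Q : pred T) : (forall i, Q i -> rows lo hi (f i)) ->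
  rows lo hi (\sum_(i <- r | Q i) f i).
Proof.
by move=> h; apply: big_ind => //; [move=> a b _; rewrite mxE|apply: rowsD].
Qed.
Lemma rowsZ lo hi X c : rows lo hi X -> rows lo hi (c *: X).
Proof. by move=> hX a b h; rewrite mxE hX // mulr0. Qed.

Lemma cmx_rows xi lo hi X : (hi.+1 < d)%N -> rows lo hi X -> rows lo hi.+1 (cmx xi * X).
Proof.
move=> hd hX a b h; rewrite mxE big1 // => c _.
case: (boolP (lo <= c <= hi)%N) => hc; last by rewrite hX // mulr0.
rewrite mxE (_ : (a == c.+1 :> nat) = false); last first.
  by apply: contraNF h => /eqP ->; lia.
rewrite (_ : (c == d.-1 :> nat) = false); last by lia.
by rewrite (_ : (c == d :> nat) = false) ?subr0 ?add0r ?mul0r //; lia.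
Qed.
Lemma cmx_agree xi xi' lo hi X : (hi < d)%N -> rows lo hi X -> cmx xi * X = cmx xi' * X.
Proof.
move=> hd hX; apply/matrixP => a b; rewrite !mxE; apply: eq_bigr => c _.
case: (boolP (lo <= c <= hi)%N) => hc; last by rewrite hX // !mulr0.
by rewrite !mxE (_ : (c == d :> nat) = false) ?mul0r //; lia.
Qed.

Section Inv.
Variable xi : {poly F}.
Hypotheses (sx : (size xi <= d)%N) (x0 : xi`_0 = 0).
Let C := cmx xi. Let Ci := cinv xi.
Let C' := cmx 0. Let Ci' := cinv 0.
Let CCi : Ci * C = 1. Proof. by case: (cinvE sx x0). Qed.
Let CiC : C * Ci = 1. Proof. by case: (cinvE sx x0). Qed.
Let CCi' : Ci' * C' = 1. Proof. by case: (@cinvE 0); rewrite ?size_poly0 ?coef0. Qed.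

Lemma cinv_rows lo hi X : (hi < d)%N -> (0 < lo)%N -> rows lo hi X ->
  rows lo.-1 hi (Ci * X) /\ Ci * X = Ci' * X.
Proof.
move=> hd hl hX; pose Y : 'M[F]_d.+1 := \matrix_(a, b) (if (a.+1 <= hi)%N then X (inord a.+1) b else 0).
have hY : rows lo.-1 hi.-1 Y.
  move=> a b h; rewrite mxE; case: ifP => // ha; rewrite hX // inordK; lia.
have CY xi' : cmx xi' * Y = X.
  apply/matrixP => a b; rewrite mxE; case ea : (a : nat) => [|a'].
    rewrite hX ?ea; last by lia.
    rewrite big1 // => c _; case: (boolP (lo.-1 <= c <= hi.-1)%N) => hc; last by rewrite hY // mulr0.
    case: (ltnP c hi) => hc2; last by rewrite !mxE ltnNge hc2 /= mulr0.
    rewrite !mxE ea (_ : (c == d.-1 :> nat) = false); last by lia.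
    by rewrite (_ : (c == d :> nat) = false) ?subr0 ?add0r ?mul0r //; lia.
  have ha' : (a' < d.+1)%N by have := ltn_ord a; lia.
  rewrite (bigD1 (Ordinal ha')) //= big1 ?addr0; last first.
    move=> c hc; case: (ltnP c hi) => hc2; last by rewrite !mxE ltnNge hc2 /= mulr0.
    have hca : (c == a' :> nat) = false by apply: contraNF hc => /eqP h; apply/eqP/val_inj.
    rewrite !mxE ea eqSS eq_sym hca (_ : (c == d.-1 :> nat) = false); last by lia.
    by rewrite (_ : (c == d :> nat) = false) ?subr0 ?add0r ?mul0r //; lia.
  have ha := ltn_ord a.
  rewrite !mxE /= ea eqxx; case: ltnP => h.
    rewrite (_ : (a' == d.-1) = false); last by lia.
    rewrite (_ : (a' == d) = false); last by lia.
    rewrite subr0 mul0r addr0 mul1r; congr (X _ b); by apply: val_inj => /=; rewrite inordK; lia.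
  rewrite mulr0 hX // ea; lia.
have h1 : Ci * X = Y by rewrite -(CY xi) mulrA CCi mul1r.
have h2 : Ci' * X = Y by rewrite -(CY 0) mulrA CCi' mul1r.
by rewrite h1 h2; split=> //; apply: rowsW hY => //; lia.
Qed.

Lemma cinv_pow_rows lo hi X k : (hi < d)%N -> (k < lo)%N -> rows lo hi X ->
  rows (lo - k) hi (Ci ^+ k * X) /\ Ci ^+ k * X = Ci' ^+ k * X.
Proof.
move=> hd hk hX; elim: k hk => [|k IH] hk; first by rewrite !expr0 !mul1r subn0.
have [|h1 h2] := IH; first by lia.
have [|h3 h4] := cinv_rows hd _ h1; first by lia.
by rewrite !exprS -!mulrA -h2 -h4; split=> //; apply: rowsW h3 => //; lia.
Qed.
Lemma cmx_pow_rows lo hi X k : (hi + k < d)%N -> rows lo hi X ->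
  rows lo (hi + k) (C ^+ k * X) /\ C ^+ k * X = C' ^+ k * X.
Proof.
move=> hd hX; elim: k hd => [|k IH] hd; first by rewrite !expr0 !mul1r addn0.
have [|h1 h2] := IH; first by lia.
rewrite !exprS -!mulrA -h2 addnS; split; first by apply: cmx_rows => //; lia.
by apply: cmx_agree h1; lia.
Qed.
Lemma horner_rows lo hi X p m : (hi + m < d)%N -> (size p <= m)%N -> rows lo hi X ->
  rows lo (hi + m) (horner_mx C p * X) /\ horner_mx C p * X = horner_mx C' p * X.
Proof.
move=> hd sp hX; rewrite !horner_mxE !mulr_suml; split; last first.
  apply: eq_bigr => i _; rewrite -!scalerAl; congr (_ *: _).
  have hi' := ltn_ord i; have [|_ h //] := @cmx_pow_rows lo hi X i _ hX; lia.
apply: rows_sum => i _; rewrite -scalerAl; apply: rowsZ.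
have hi' := ltn_ord i; have [|h _] := @cmx_pow_rows lo hi X i _ hX; first by lia.
by apply: rowsW h; lia.
Qed.

(** The matrix is the value of the Laurent polynomial $p(t)/t^l$: the negative power extends the
    window downwards by [l], the polynomial upwards by at most [m]. *)
Lemma eval_rows p m l lo hi X : (hi + m < d)%N -> (size p <= m)%N -> (l < lo)%N -> rows lo hi X ->
  rows (lo - l) (hi + m) (horner_mx C p * Ci ^+ l * X) /\
  horner_mx C p * Ci ^+ l * X = horner_mx C' p * Ci' ^+ l * X.
Proof.
move=> hd sp hl hX; have [|h1 h2] := @cinv_pow_rows lo hi X l _ hl hX; first by lia.
have [h3 h4] := horner_rows hd sp h1.
by rewrite -!mulrA -h2 -h4; split.
Qed.

Variables lo0 hi0 : nat.
Hypothesis xirows : forall a, ~~ (lo0 <= a <= hi0)%N -> xi`_a = 0.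
Hypotheses (hlo : (0 < lo0)%N) (hhi : (hi0 < d)%N).

(** The two companion matrices differ only in the last column, by the coefficients of [xi]. The
    following lemmas telescope this through powers and values of Laurent polynomials. *)
Lemma diff_rows : rows lo0 hi0 (C' - C).
Proof.
move=> a b h; rewrite !mxE coef0 xirows //.
by apply/eqP; rewrite subr_eq0.
Qed.
Lemma diff_pow k : (hi0 + k < d)%N -> rows lo0 (hi0 + k) (C' ^+ k - C ^+ k).
Proof.
elim: k => [|k IH] hk; first by rewrite !expr0 subrr => a b _; rewrite mxE.
have -> : C' ^+ k.+1 - C ^+ k.+1 = C' * (C' ^+ k - C ^+ k) + (C' - C) * C ^+ k.
  by rewrite mulrBr mulrBl -!exprS addrA subrK.
apply: rowsD; last by apply: rowsMr; apply: rowsW diff_rows; lia.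
by rewrite addnS; apply: cmx_rows; [lia|apply: IH; lia].
Qed.
Lemma diff_ipow k : (k < lo0)%N -> rows (lo0 - k) hi0 (Ci' ^+ k - Ci ^+ k).
Proof.
elim: k => [|k IH] hk; first by rewrite !expr0 subrr => a b _; rewrite mxE.
have -> : Ci' ^+ k.+1 - Ci ^+ k.+1 = Ci' * (Ci' ^+ k - Ci ^+ k) + (Ci' - Ci) * Ci ^+ k.
  by rewrite mulrBr mulrBl -!exprS addrA subrK.
apply: rowsD.
  have [||h he] := cinv_rows hhi _ (IH _); [lia|lia|].
  by rewrite -he; apply: rowsW h => //; lia.
apply: rowsMr.
have -> : Ci' - Ci = - (Ci' * ((C' - C) * Ci)).
  by rewrite mulrBl mulrBr mulrA CCi' mul1r CiC mulr1 opprB.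
have [h he] := cinv_rows hhi hlo (rowsMr Ci diff_rows).
by apply: rowsN; rewrite -he; apply: rowsW h => //; lia.
Qed.
Lemma diff_horner p m : (hi0 + m < d)%N -> (size p <= m)%N -> rows lo0 (hi0 + m) (horner_mx C' p - horner_mx C p).
Proof.
move=> hd sp; rewrite !horner_mxE -sumrB; apply: rows_sum => i _.
rewrite -scalerBr; apply: rowsZ; have hi' := ltn_ord i.
by apply: rowsW (diff_pow _); lia.
Qed.
Lemma diff_eval p m l : (hi0 + m < d)%N -> (size p <= m)%N -> (l < lo0)%N ->
  rows (lo0 - l) (hi0 + m) (horner_mx C' p * Ci' ^+ l - horner_mx C p * Ci ^+ l).
Proof.
move=> hd sp hl.
have -> : horner_mx C' p * Ci' ^+ l - horner_mx C p * Ci ^+ l =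
  horner_mx C' p * (Ci' ^+ l - Ci ^+ l) + (horner_mx C' p - horner_mx C p) * Ci ^+ l.
  by rewrite mulrBr mulrBl addrA subrK.
apply: rowsD; last by apply: rowsMr; apply: rowsW (diff_horner hd sp); lia.
by have [h he] := horner_rows hd sp (diff_ipow hl); rewrite -he.
Qed.
End Inv.
End Comp.
End Companion.

(** * Determinant one matrices over Laurent rings are stably elementary *)

Section SK1.
Import GRing.Theory.
Local Open Scope ring_scope.
Variable F : fieldType.

Section MatOver.
Variables (P : F -> Prop) (hP : sring P) (d : nat).
Definition mo (M : 'M[F]_d.+1) := forall a b, P (M a b).
Lemma mo1 : mo 1. Proof. by move=> a b; rewrite mxE; apply: sring_nat. Qed.
Lemma moD M N : mo M -> mo N -> mo (M + N).
Proof. by move=> hM hN a b; rewrite mxE; apply: sringD. Qed.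
Lemma moN M : mo M -> mo (- M).
Proof. by move=> hM a b; rewrite mxE; apply: sringN. Qed.
Lemma moM M N : mo M -> mo N -> mo (M * N).
Proof. by move=> hM hN a b; rewrite mxE; apply: sring_sum => // c _; apply: sringM. Qed.
Lemma moX M k : mo M -> mo (M ^+ k).
Proof. by move=> hM; elim: k => [|k IH]; rewrite ?exprS; [apply: mo1|apply: moM]. Qed.
Lemma moZ c M : P c -> mo M -> mo (c *: M).
Proof. by move=> hc hM a b; rewrite mxE; apply: sringM. Qed.
Lemma mo_horner C p : mo C -> po P p -> mo (horner_mx C p).
Proof.
move=> hC hp; rewrite horner_mxE; apply: big_ind => [|M N|i _].
- by move=> a b; rewrite mxE; apply: sring0.
- exact: moD.
- by apply: moZ => //; apply: moX.
Qed.
End MatOver.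

(* Matrices preserving the last coordinate line, with eigenvalue [s] on it,
   and with the complementary diagonal block defined over [S]. *)
Section Tri.
Variables (S : F -> Prop) (hS : sring S) (d : nat).
Definition tri (s : F) (U : 'M[F]_d.+1) : Prop :=
  [/\ forall a, a != ord_max -> U a ord_max = 0, U ord_max ord_max = s &
      forall a b, a != ord_max -> b != ord_max -> S (U a b)].
Lemma tri1 : tri 1 1.
Proof.
split=> [a h||a b _ _]; rewrite mxE ?(negPf h) ?eqxx //; exact: sring_nat.
Qed.
Lemma triM s s' U V : tri s U -> tri s' V -> tri (s * s') (U * V).
Proof.
move=> [u1 u2 u3] [v1 v2 v3]; split=> [a h||a b ha hb]; rewrite mxE.
- rewrite big1 // => c _; have [->|hc] := eqVneq c ord_max; first by rewrite u1 // mul0r.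
  by rewrite v1 // mulr0.
- rewrite (bigD1 ord_max) //= u2 v2 big1 ?addr0 // => c hc.
  by rewrite v1 // mulr0.
- apply: sring_sum => // c _; have [->|hc] := eqVneq c ord_max; last by apply: (sringM hS); [apply: u3|apply: v3].
  by rewrite u1 // mul0r; apply: sring0.
Qed.
Lemma triX s U k : tri s U -> tri (s ^+ k) (U ^+ k).
Proof. by move=> h; elim: k => [|k IH]; rewrite ?exprS; [apply: tri1|apply: triM]. Qed.
Lemma tri_horner s U p : tri s U -> po S p -> tri p.[s] (horner_mx U p).
Proof.
move=> hU hp; rewrite horner_mxE horner_coef.
have: tri 0 0 by split=> *; rewrite mxE //; apply: sring0.
elim/big_ind2: _ => // [s1 U1 s2 U2 h1 h2 h0|i _ _].
  have [u1 u2 u3] := h1 h0; have [v1 v2 v3] := h2 h0; split=> [a h||a b ha hb]; rewrite mxE.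
  - by rewrite u1 // v1 // addr0.
  - by rewrite u2 v2.
  - by apply: (sringD hS); [apply: u3|apply: v3].
have [u1 u2 u3] := triX i hU; split=> [a h||a b ha hb]; rewrite mxE.
- by rewrite u1 // mulr0.
- by rewrite u2.
- by apply: sringM => //; apply: u3.
Qed.
End Tri.

Lemma tri_cmx (S : F -> Prop) d w : sring S -> (1 < d)%N -> tri S w (cmx d w 0).
Proof.
move=> hS d2; split=> [a h||a b ha hb]; rewrite mxE ?coef0 /=.
- have ha : (a : nat) != d by apply: contra h => /eqP h; apply/eqP/val_inj.
  have -> : (a == d.+1 :> nat) = false by have := ltn_ord a; lia.
  have -> : (d == d.-1) = false by lia.
  by rewrite (negPf ha) mulr0 subr0 addr0.
- have -> : (d == d.+1) = false by lia.
  have -> : (d == d.-1) = false by lia.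
  by rewrite eqxx mul1r subr0 add0r.
- have hb' : (b : nat) != d by apply: contra hb => /eqP h; apply/eqP/val_inj.
  rewrite (negPf hb') mul0r addr0.
  by apply: sringB => //; apply: sring_nat.
Qed.
Lemma tri_cinv (S : F -> Prop) d w : sring S -> (1 < d)%N -> w != 0 -> tri S w^-1 (cinv d w 0).
Proof.
move=> hS d2 w0; rewrite cinv0E //; split=> [a h||a b ha hb]; rewrite mxE /=.
- have ha : (a : nat) != d by apply: contra h => /eqP h; apply/eqP/val_inj.
  rewrite ltnn andbF (negPf ha) andbF mul0r addr0.
  have -> : (d == 0%N) = false by lia.
  by rewrite subrr.
- rewrite ltnn andbF eqxx orbT mul1r.
  have -> : (d == 0%N) = false by lia.
  by rewrite subr0 add0r.
- have ha' : (a : nat) != d by apply: contra ha => /eqP h; apply/eqP/val_inj.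
  rewrite (negPf ha') andbF mul0r addr0.
  by apply: sringB => //; apply: sring_nat.
Qed.

Lemma common_exp (S : F -> Prop) t (I : finType) (A : sqm F I) : sring S -> over (adj S t) A ->
  exists l (p : I * I -> {poly F}), forall i j, po S (p (i, j)) /\ A i j * t ^+ l = (p (i, j)).[t].
Proof.
move=> hS hA.
have [l hl] : exists l, forall u : I * I, u \in enum (predT : pred (I * I)) -> exists p, po S p /\ A u.1 u.2 * t ^+ l = p.[t].
  elim: (enum _) => [|v r [l IH]]; first by exists 0%N.
  have [p [k [hp ep]]] := hA v.1 v.2; exists (l + k)%N => u; rewrite inE => /orP[/eqP ->|/IH [q [hq eq]]].
    exists (p * 'X^l); split; first by apply: poM => //; apply: poXn.
    by rewrite hornerM hornerXn -ep exprD [t ^+ l * _]mulrC mulrA.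
  exists (q * 'X^k); split; first by apply: poM => //; apply: poXn.
  by rewrite hornerM hornerXn -eq exprD mulrA.
have hl' u : exists p, po S p /\ A u.1 u.2 * t ^+ l = p.[t] by apply: hl; rewrite mem_enum.
have [p hp] := choice hl'; exists l, p => i j; exact: (hp (i, j)).
Qed.

(** * Removing a polynomial denominator *)

Section Core.
Variables (K S : F -> Prop) (t : F).
Hypotheses (hK : sring K) (hS : sring S) (KS : forall x, K x -> S x) (tS : trans S t).
Let P := adj S t.
Let hP : sring P. Proof. exact: adj_sring. Qed.
Let SP x : S x -> P x. Proof. exact: adj_sub. Qed.
Let t0 : t != 0. Proof. exact: trans_neq0 tS. Qed.
Hypothesis IHS : forall (I : finType) (B : sqm F I), over S B -> detF B = 1 -> SE S B.
Variable f : {poly F}.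
Hypotheses (mf : f \is monic) (hf : po K f) (f0 : f`_0 != 0) (fv : K (f`_0)^-1).
Let g := 'X * f.
Variables (I : finType) (A A' : sqm F I).
Hypotheses (hA : over P A) (hA' : over P A') (AA : A * A' = 1) (AA' : A' * A = 1) (dA : detF A = 1).
Hypothesis hSE : SE (denoms S t g) A.

(* Specialising [t] to the block triangular matrix [cmx 0]: since [A] is
   elementary after inverting [f], it can be specialised to [cmx xi], and the
   two specialisations differ by a unipotent matrix supported on the middle
   coordinates. *)
Lemma core_tri : exists (d : nat) (psi : F -> 'M[F]_d.+1),
  [/\ (0 < d)%N, is_hom P psi, (forall x, P x -> tri S x (psi x)),
      (forall x, P x -> mo P (psi x)) & SE P (tens psi A)].
Proof.
have hf' : po P f by apply: po_mono hf => x /KS/SP.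
have [l1 [p1 hp1]] := common_exp hS hA; have [l2 [p2 hp2]] := common_exp hS hA'.
pose l := (l1 + l2)%N.
pose q1 u := p1 u * 'X^l2; pose q2 u := p2 u * 'X^l1.
have hq1 i j : po S (q1 (i, j)) /\ A i j * t ^+ l = (q1 (i, j)).[t].
  have [h1 h2] := hp1 i j; split; first by apply: poM => //; apply: poXn.
  by rewrite hornerM hornerXn -h2 exprD mulrA.
have hq2 i j : po S (q2 (i, j)) /\ A' i j * t ^+ l = (q2 (i, j)).[t].
  have [h1 h2] := hp2 i j; split; first by apply: poM => //; apply: poXn.
  by rewrite hornerM hornerXn -h2 exprD [t ^+ l1 * _]mulrC mulrA.
pose m := (\max_u size (q1 u) + \max_u size (q2 u))%N.
have s1 u : (size (q1 u) <= m)%N by apply: leq_trans (leq_addr _ _); apply: (@leq_bigmax _ (fun u => size (q1 u))).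
have s2 u : (size (q2 u) <= m)%N by apply: leq_trans (leq_addl _ _); apply: (@leq_bigmax _ (fun u => size (q2 u))).
clearbody m q1 q2; clear p1 hp1 p2 hp2.
(* Windows must survive three evaluations, each moving rows by at most [l] downwards and [m]
   upwards: two produce the window of the correction [Z], and one more acts on a column inside that
   window. *)
pose c := (3 * l + 1)%N; pose hi0 := (c + size f)%N; pose d := (hi0 + 3 * m + 2)%N.
have d2 : (1 < d)%N by rewrite /d; lia.
have hQ : po P (('X - t%:P) * ('X^d + 1)).
  apply: poM => //; [apply: poB => //; [exact: poX|by apply: poC => //; apply: adj_t]|].
  by apply: poD => //; [apply: poXn|apply: po1].
(* With this choice of [xi], [cpoly0] reads $f(C)k(C)+C^c=0$, which exhibits the inverse [fi] of
   $f(C)$. *)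
have [k [x [hk hx sx eQ]]] := po_bezout hP c mf hf' (SP (KS fv)) f0 hQ.
pose xi := 'X^c * x.
have sxi : (size xi <= d)%N.
  apply: leq_trans (size_polyMleq _ _) _; rewrite size_polyXn /=.
  apply: (@leq_trans hi0); first by rewrite /hi0 leq_add2l; exact: sx.
  by rewrite /d; lia.
have c0 : (0 < c)%N by rewrite /c; lia.
have xi0 : xi`_0 = 0 by rewrite /xi coefXnM c0.
have xirows a : ~~ (c <= a <= hi0)%N -> xi`_a = 0.
  rewrite /xi coefXnM; case: ltnP => // h1 h2; apply: nth_default.
  apply: leq_trans sx _; move: h2; rewrite /= -ltnNge /hi0.
  by move: (size f) => sf; lia.
pose C := cmx d t xi; pose Ci := cinv d t xi.
have [CCi CiC] : C * Ci = 1 /\ Ci * C = 1 by apply: cinvE.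
have hC : mo P C.
  move=> a b; rewrite mxE; apply: sringD => //; first by apply: sringB => //; apply: sring_nat.
  apply: sringM => //; first exact: sring_nat.
  case: ifP => _; first exact: adj_t.
  by rewrite /xi; apply: poM => //; apply: poXn.
have hCi : mo P Ci.
  apply: mo_horner => //; apply: poZ => //; first exact: adj_tV.
  apply: poB => //; last by move=> i; rewrite coef_drop_poly; apply: poM => //; apply: poXn.
  apply: poB => //; first by apply: poD => //; [apply: poXn|apply: po1].
  by apply: poM => //; [apply: poC => //; apply: adj_t|apply: poXn].
pose fi := - (horner_mx C k * Ci ^+ c).
have CCin n : C ^+ n * Ci ^+ n = 1.
  elim: n => [|n IH]; first by rewrite !expr0 mulr1.
  by rewrite exprSr exprS mulrA -[X in X * _]mulrA CCi mulr1 IH.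
have ffi : horner_mx C f * fi = 1.
  have := @cpoly0 _ d t d2 xi sxi; rewrite /cpoly eQ addrAC subrr add0r -/C rmorphD rmorphM rmorphXn /= horner_mx_X.
  move/eqP; rewrite addr_eq0 => /eqP h.
  by rewrite /fi mulrN mulrA h mulNr opprK CCin.
have comC (p : {poly F}) : Ci * horner_mx C p = horner_mx C p * Ci.
  by rewrite /Ci /cinv -/C -!rmorphM mulrC.
have comCn n (p : {poly F}) : Ci ^+ n * horner_mx C p = horner_mx C p * Ci ^+ n.
  by elim: n => [|n IH]; rewrite ?expr0 ?mulr1 ?mul1r // exprS -mulrA IH mulrA comC -mulrA.
have fif : fi * horner_mx C f = 1.
  rewrite -[RHS]ffi /fi mulNr mulrN -mulrA comCn !mulrA; congr (- (_ * _)).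
  by rewrite -!rmorphM mulrC.
pose G := Ci * fi.
have gG : horner_mx C g * G = 1.
  by rewrite /g mulrC rmorphM /= horner_mx_X /G mulrA -[X in X * _]mulrA CCi mulr1.
have Gg : G * horner_mx C g = 1.
  by rewrite /g mulrC rmorphM /= horner_mx_X /G mulrA -[X in X * _]mulrA fif mulr1.
have hgS : po S g by apply: poM => //; [exact: poX|apply: po_mono hf].
have [phi hphi] := evalP hS tS hgS gG Gg.
have homphi := eval_hom hS hgS gG Gg hphi.
have hD := denoms_sring t hS hgS.
have hfi : mo P fi by apply: moN => //; apply: moM => //; [apply: mo_horner|apply: moX].
have phiP x' a b : denoms S t g x' -> P (phi x' a b).
  move=> [n [p [hp ep]]]; rewrite (hphi _ _ _ hp ep); apply: moM => //.
    by apply: mo_horner => //; apply: po_mono hp.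
  by apply: moX => //; apply: moM.
have phit : phi t = C.
  by rewrite (hphi t 0%N 'X) ?expr0 ?mulr1 ?hornerX ?horner_mx_X //; apply: poX.
have Dt : denoms S t g t by exists 0%N, 'X; split; [apply: poX|rewrite expr0 mulr1 hornerX].
have Dv : denoms S t g t^-1.
  exists 1%N, f; split; first by apply: po_mono hf.
  by rewrite expr1 /g hornerM hornerX mulrA mulVf // mul1r.
have phiv : phi t^-1 = Ci.
  have := homM homphi Dv Dt; rewrite mulVf // (hom1 homphi) phit => h.
  by rewrite -[LHS]mulr1 -CCi mulrA -h mul1r.
have phivn n : phi (t^-1 ^+ n) = Ci ^+ n /\ denoms S t g (t^-1 ^+ n).
  elim: n => [|n [e1 e2]]; first by rewrite !expr0 (hom1 homphi); split=> //; apply: sring1.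
  rewrite !exprS; split; last by apply: sringM.
  by rewrite (homM homphi Dv e2) e1 phiv.
have phiE x' (p : {poly F}) : po S p -> x' * t ^+ l = p.[t] -> phi x' = horner_mx C p * Ci ^+ l.
  move=> hp ep; have -> : x' = p.[t] * t^-1 ^+ l by rewrite -ep exprVn mulfK // expf_neq0.
  have [e1 e2] := phivn l.
  have Dp : denoms S t g p.[t] by exists 0%N, p; rewrite expr0 mulr1.
  rewrite (homM homphi Dp e2) e1.
  by rewrite (hphi p.[t] 0%N p) ?expr0 ?mulr1.
have [tD PD] : (forall x', P x' -> denoms S t g x') /\ True.
  split=> // x'; apply: adj_min => // y Sy.
  by exists 0%N, y%:P; split; [apply: poC|rewrite hornerC expr0 mulr1].
pose C' := cmx d t 0; pose Ci' := cinv d t 0.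
have [C'i Ci'C] : C' * Ci' = 1 /\ Ci' * C' = 1 by apply: cinvE; rewrite ?size_poly0 ?coef0.
have gG' : horner_mx C' 'X * Ci' = 1 by rewrite horner_mx_X.
have Gg' : Ci' * horner_mx C' 'X = 1 by rewrite horner_mx_X.
have [psi hpsi] := evalP hS tS (poX hS) gG' Gg'.
have hompsi' := eval_hom hS (poX hS) gG' Gg' hpsi.
have hompsi : is_hom P psi.
  have PX x' : P x' -> denoms S t 'X x' by move=> [p [n [h1 h2]]]; exists n, p; rewrite hornerX.
  case: hompsi' => h1 h2 h3; split=> // x' y' /PX hx' /PX hy'; [exact: h2|exact: h3].
have psiE x' n (p : {poly F}) : po S p -> x' * t ^+ n = p.[t] -> psi x' = horner_mx C' p * Ci' ^+ n.
  by move=> hp ep; apply: hpsi => //; rewrite hornerX.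
have psitri x' : P x' -> tri S x' (psi x').
  move=> [p [n [hp ep]]]; rewrite (psiE _ _ _ hp ep).
  have -> : x' = p.[t] * t^-1 ^+ n by rewrite -ep exprVn mulfK // expf_neq0.
  by apply: triM => //; [apply: tri_horner => //; apply: tri_cmx|apply: triX => //; apply: tri_cinv].
have psimo x' : P x' -> mo P (psi x').
  move=> [p [n [hp ep]]]; rewrite (psiE _ _ _ hp ep); apply: moM => //.
    apply: mo_horner => //; last by apply: po_mono hp.
    move=> a b; rewrite mxE coef0; apply: sringD => //; first by apply: sringB => //; apply: sring_nat.
    apply: sringM => //; first exact: sring_nat.
    by case: ifP => _; [apply: adj_t|apply: sring0].
  apply: moX => //; rewrite /Ci' cinv0E // => a b; rewrite mxE; apply: sringD => //.
    by apply: sringB => //; apply: sring_nat.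
  by apply: sringM => //; [apply: sring_nat|apply: adj_tV].
exists d, psi; split=> //; first by lia.
have SEphi : SE P (tens phi A).
  have [J [h [hi hEL]]] := hSE.
  apply: (@SE_unext _ P _ _ (fun u : I * 'I_d.+1 => (h u.1, u.2))); first by move=> [i a] [j b] [/hi -> ->].
  rewrite -(tens_ext hD homphi) //; apply: SE_EL; apply: (EL_tens hD homphi) => //.
have oA : over (denoms S t g) A by move=> i j; apply: tD.
have oA' : over (denoms S t g) A' by move=> i j; apply: tD.
(* The factor [1 + Z] carries the specialisation at [cmx xi] to the one at [cmx 0]. Its support has
   rows inside and columns outside a window, as [EL_unip] demands. *)
pose Z := tens phi A' * tens psi A - 1.
have phiA i j : phi (A i j) = horner_mx C (q1 (i, j)) * Ci ^+ l by have [h1 h2] := hq1 i j; apply: phiE.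
have phiA' i j : phi (A' i j) = horner_mx C (q2 (i, j)) * Ci ^+ l by have [h1 h2] := hq2 i j; apply: phiE.
have psiA i j : psi (A i j) = horner_mx C' (q1 (i, j)) * Ci' ^+ l by have [h1 h2] := hq1 i j; apply: psiE.
have prodE (phi1 phi2 : F -> 'M[F]_d.+1) (B B' : sqm F I) u v : (tens phi1 B * tens phi2 B') u v =
    (\sum_j phi1 (B u.1 j) * phi2 (B' j v.1)) u.2 v.2.
  rewrite sqm_mulE summxE; under [RHS]eq_bigr do rewrite mxE.
  by rewrite pair_big /=; apply: eq_bigr => -[].
have ZE : Z = tens phi A' * (tens psi A - tens phi A).
  by rewrite mulrBr -(tensM hD homphi) // AA' (tens1 hD homphi).
have EZ : EL P (1 + Z).
  apply: (EL_unip (p := fun u : I * 'I_d.+1 => (c - 2 * l <= u.2 <= hi0 + 2 * m)%N)).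
    rewrite /Z; apply: overD => //; last by apply: overN => //; apply: over1.
    apply: overM => // u v; first by apply: phiP; apply: oA'.
    by apply: psimo; apply: hA.
  move=> u v; rewrite negb_and => /orP[hu|].
    (* Rows: the difference of the specialisations is confined to a window, and the factor from [A']
       widens it once more. *)
    rewrite ZE sqm_mulE -(pair_big xpredT xpredT (fun j b => tens phi A' u (j, b) * (tens psi A - tens phi A) (j, b) v)) /=.
    rewrite big1 // => j _.
    have -> : \sum_b tens phi A' u (j, b) * (tens psi A - tens phi A) (j, b) v =
       (phi (A' u.1 j) * (psi (A j v.1) - phi (A j v.1))) u.2 v.2.
      by rewrite mxE; apply: eq_bigr => b _; rewrite /tens !sqmE !mxE.
    rewrite phiA' psiA phiA.
    have [|||h _] := @eval_rows _ d t d2 t0 xi sxi xi0 (q2 (u.1, j)) m l (c - l)%N (hi0 + m)%N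
      (horner_mx C' (q1 (j, v.1)) * Ci' ^+ l - horner_mx C (q1 (j, v.1)) * Ci ^+ l) _ (s2 _) _ _.
    - by rewrite /d; lia.
    - by rewrite /c; lia.
    - have [h1 h2 h3] : [/\ (hi0 < d)%N, (hi0 + m < d)%N & (l < c)%N] by rewrite /d /c; split; lia.
      exact: (diff_eval d2 t0 sxi xi0 xirows c0 h1 h2 (s1 _) h3).
    by apply: h; apply: contra hu; rewrite -subnDA -addnA !addnn -!mul2n.
  rewrite negbK => hv.
  have -> : Z u v = (tens phi A' * tens psi A) u v - (tens phi A' * tens phi A) u v.
    by rewrite -(tensM hD homphi) // AA' (tens1 hD homphi).
  (* Columns: the matrix unit [D] isolates one column, whose window is the single index [v.2].
     Inside the window both specialisations agree on it, so this column of [Z] vanishes. *)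
  pose D : 'M[F]_d.+1 := delta_mx v.2 v.2.
  have hDr : rows v.2 v.2 D.
    move=> a b hab; rewrite mxE; case: eqP => // e; move: hab; rewrite e !leqnn //.
  have DE (M : 'M[F]_d.+1) a : M a v.2 = (M * D) a v.2.
    rewrite mxE (bigD1 v.2) //= mxE !eqxx mulr1 big1 ?addr0 // => b hb.
    by rewrite mxE (negPf hb) mulr0.
  rewrite !prodE DE [X in _ - X]DE !mulr_suml; apply/eqP; rewrite subr_eq0; apply/eqP.
  congr ((_ : 'M[F]_d.+1) _ _); apply: eq_bigr => j _; rewrite -!mulrA; congr (_ * _).
  rewrite psiA phiA.
  have [||_ h //] := @eval_rows _ d t d2 t0 xi sxi xi0 (q1 (j, v.1)) m l v.2 v.2 D _ (s1 _) _ hDr.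
  - by case/andP: hv => _; move: (nat_of_ord v.2) => z hz; rewrite /d; lia.
  - by case/andP: hv => + _; move: (nat_of_ord v.2) => z hz; rewrite /c in hz; lia.
have -> : tens psi A = tens phi A * (1 + Z).
  by rewrite /Z addrC subrK mulrA -(tensM hD homphi) // AA (tens1 hD homphi) mul1r.
by apply: SE_mul => //; apply: SE_EL.
Qed.

(** The eigenvalue of [psi x] on the last line is [x], so the block diagonal part of [tens psi A] is
    [A] next to a matrix over [S]. The latter is stably elementary by [IHS], up to its determinant,
    and cancels. *)
Lemma core : SE P A.
Proof.
have [d [psi [d0 hpsi psitri psimo hT]]] := core_tri.
case: (pickP (fun _ : I => true)) => [i0 _|noI]; last first.
  have -> : A = 1 by apply: sqmP => i; have := noI i.
  by apply: SE_EL; apply: EL1.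
pose isE (u : I * 'I_d.+1) := u.2 == ord_max.
pose T := tens psi A; pose T' := tens psi A'.
have TT : T * T' = 1 by rewrite -(tensM hP hpsi) // AA (tens1 hP hpsi).
have TT' : T' * T = 1 by rewrite -(tensM hP hpsi) // AA' (tens1 hP hpsi).
have lowT u v : ~~ isE u -> isE v -> T u v = 0.
  by move=> hu /eqP hv; have [h _ _] := psitri _ (hA u.1 v.1); rewrite /T /tens hv h.
have lowT' u v : ~~ isE u -> isE v -> T' u v = 0.
  by move=> hu /eqP hv; have [h _ _] := psitri _ (hA' u.1 v.1); rewrite /T' /tens hv h.
pose bd (X : sqm F (I * 'I_d.+1)%type) : sqm F (I * 'I_d.+1)%type := fun u v => if isE u == isE v then X u v else 0.
have bdM (X Y : sqm F (I * 'I_d.+1)%type) : (forall u v, ~~ isE u -> isE v -> X u v = 0) ->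
  (forall u v, ~~ isE u -> isE v -> Y u v = 0) -> X * Y = 1 -> bd X * bd Y = 1.
  move=> hX hY XY; apply: sqmP => u v; rewrite -XY !sqm_mulE.
  case huv : (isE u == isE v).
    apply: eq_bigr => x _; rewrite /bd; move: huv (hX u x) (hY x v).
    case: (isE u); case: (isE v); case: (isE x) => //= _ h1 h2.
      by rewrite h2 // !mulr0.
    by rewrite h1 // !mul0r.
  have := congr1 (fun M : sqm F (I * 'I_d.+1)%type => M u v) XY; rewrite /= sqm_mulE => ->.
  rewrite sqmE; case: eqP => [e|_]; first by rewrite e eqxx in huv.
  rewrite big1 // => x _; rewrite /bd; move: huv; case: (isE u); case: (isE v); case: (isE x) => //= _; rewrite ?mul0r ?mulr0 //.
have B1 := bdM _ _ lowT lowT' TT; have B2 := bdM _ _ lowT' lowT TT'.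
have oT : over P T by move=> u v; apply: psimo; apply: hA.
have oT' : over P T' by move=> u v; apply: psimo; apply: hA'.
have obd X : over P X -> over P (bd X) by move=> h u v; rewrite /bd; case: ifP => _ //; apply: sring0.
(* A block unipotent factor separates [T] from its block diagonal part. *)
have hT0 : SE P (bd T).
  apply: (@SE_cancel _ P hP _ (1 + (T - bd T) * bd T')).
    apply: SE_EL; apply: (EL_unip (p := isE)).
      by apply: overM => //; [apply: overD => //; apply: overN => //; apply: obd|apply: obd].
    move=> u v h; rewrite sqm_mulE big1 // => x _; rewrite !sqmE /bd.
    move: h (lowT u x); case: (isE u); case: (isE v); case: (isE x) => //= _ h;
    by rewrite ?subrr ?mul0r ?mulr0 // h // subr0 mul0r.
  by rewrite mulrDl mul1r -mulrA B2 mulr1 addrC subrK.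
pose g1 (u : I * 'I_d) : I * 'I_d.+1 := (u.1, lift ord_max u.2).
pose g2 (i : I) : I * 'I_d.+1 := (i, ord_max).
have g1i : injective g1.
  by move=> [i a] [j b] e; have /= /lift_inj -> := congr1 snd e; have /= -> := congr1 fst e.
have g2i : injective g2 by move=> i j [].
have E1 u : ~~ isE (g1 u) by rewrite /isE /= eq_sym neq_lift.
have E2 i : isE (g2 i) by rewrite /isE /= eqxx.
have imE u : (exists x, u = g1 x) \/ (exists i, u = g2 i).
  case: u => i a; case: (unliftP ord_max a) => [b ->|->]; last by right; exists i.
  by left; exists (i, b).
pose res (X : sqm F (I * 'I_d.+1)%type) : sqm F (I * 'I_d)%type := fun x y => X (g1 x) (g1 y).
have g12 x i : g1 x <> g2 i by move=> e; have := E1 x; rewrite e E2.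
have bdE (B : sqm F I) : over P B -> bd (tens psi B) = ext g1 (res (tens psi B)) * ext g2 B.
  move=> oB; apply: sqmP => u v; rewrite sqm_mulE.
  have [[x ->]|[i ->]] := imE u.
    rewrite (bigID isE) /= [X in X + _]big1 ?add0r; last first.
      move=> w hw; have [[y ey]|[j ->]] := imE w; first by have := E1 y; rewrite -ey hw.
      rewrite ext_out; last by right => y; apply: g12.
      by case: eqP => [/g12 //|]; rewrite mul0r.
    have [[y ->]|[j ->]] := imE v.
      rewrite (bigD1 (g1 y)) ?E1 //= extf // ext_out ?eqxx ?mulr1; last by right => j /esym/g12.
      rewrite big1 ?addr0 /bd ?(negPf (E1 _)) // => w /andP[_ hw].
      by rewrite (@ext_out _ _ _ _ _ w) ?(negPf hw) ?mulr0 //; right => j /esym/g12.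
    rewrite /bd (negPf (E1 _)) E2 /= big1 // => w hw; rewrite (@ext_out _ _ _ g2 B w) ?mulr0.
      by case: eqP => [e|]; [rewrite e E2 in hw|rewrite mulr0].
    by left => j' e; rewrite -e E2 in hw.
  rewrite (bigD1 (g2 i)) //= [X in _ + X]big1 ?addr0; last first.
    move=> w hw; rewrite ext_out; last by left => y; apply: g12.
    by rewrite eq_sym (negPf hw) mul0r.
  rewrite ext_out ?eqxx ?mul1r; last by left => y; apply: g12.
  rewrite /bd E2; have [[y ->]|[j ->]] := imE v.
    rewrite (negPf (E1 _)) ext_out; last by right => j /esym/g12.
    by rewrite /=; case: (g2 i =P g1 y) => [e|//]; case: (g12 y i).
  by rewrite E2 extf //; have [_ h _] := psitri _ (oB i j); rewrite /tens /=.
have dbd (B : sqm F I) : over P B -> detF (bd (tens psi B)) = detF (res (tens psi B)) * detF B.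
  by move=> oB; rewrite bdE // detF_mul !detF_ext.
have resS (B : sqm F I) : over P B -> over S (res (tens psi B)).
  move=> oB x y; have [_ _ h] := psitri _ (oB x.1 y.1); rewrite /res /tens /=; apply: h; exact: E1.
pose A0 := res T; pose c := detF A0; pose c' := detF (res T').
have dA' : detF A' = 1 by have := detF_mul A A'; rewrite AA detF1 dA mul1r.
have cc : c * c' = 1.
  have := detF_mul (bd T) (bd T'); rewrite B1 detF1 !dbd // dA dA' !mulr1 => ->.
  by [].
have Sc : S c by apply: P_detF => //; apply: resS.
have Sc' : S c' by apply: P_detF => //; apply: resS.
pose k0 : I * 'I_d := (i0, Ordinal d0).
(* [IHS] asks for determinant one, so one diagonal entry is rescaled by the inverse of the
   determinant. The compensating factor turns out to be trivial when determinants are taken at the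
   end. *)
pose B := A0 * (1 + de k0 k0 (c' - 1)).
have hB : SE S B.
  apply: IHS.
    apply: overM => //; first exact: resS.
    apply: overD => //; first exact: over1.
    by apply: over_de => //; apply: sringB => //; apply: sring1.
  by rewrite detF_mul detF_de eqxx mul1r addrC subrK -/c cc.
have eA0 : A0 = B * (1 + de k0 k0 (c - 1)).
  rewrite /B -mulrA [X in _ = _ * X](_ : _ = 1) ?mulr1 //.
  rewrite mulrDl mul1r mulrDr mulr1 deM eqxx -!addrA -!deD.
  rewrite (_ : c - 1 + _ = 0) ?de0 ?addr0 //.
  by transitivity (c * c' - 1); [ring|rewrite cc subrr].
have := hT0; rewrite bdE // -/T -/A0 eA0 extM // -mulrA => /(SE_cancel hP (SE_ext g1i (SE_mono SP hB))).
rewrite ext_de // => h; have := detF_SE h.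
rewrite detF_mul detF_de eqxx mul1r detF_ext // dA mulr1 addrC subrK => c1.
by move: h; rewrite c1 subrr de0 addr0 mul1r; apply: SE_unext.
Qed.
End Core.

Lemma poly_split (K : F -> Prop) q : sring K -> po K q -> q != 0 ->
  exists a f, [/\ po K f, q = 'X^a * f & f`_0 != 0].
Proof.
move=> hK; move en : (size q) => n; elim: n q en => [|n IH] q en hq q0.
  by move: q0; rewrite -size_poly_eq0 en.
have [e|h] := eqVneq q`_0 0; last by exists 0%N, q; rewrite expr0 mul1r.
have ex : q = 'X * drop_poly 1 q.
  rewrite -{1}(poly_take_drop 1 q) expr1 mulrC; apply/eqP; rewrite -subr_eq0 addrK.
  by apply/eqP/polyP => i; rewrite coef_take_poly coef0; case: i.
have d0 : drop_poly 1 q != 0 by apply: contra q0 => /eqP h; rewrite ex h mulr0.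
have [|||a [f [hf ef f0]]] := IH (drop_poly 1 q) => //.
- by rewrite size_drop_poly en subn1.
- by move=> i; rewrite coef_drop_poly.
by exists a.+1, f; split=> //; rewrite exprS -mulrA -ef.
Qed.

(** A word in elementary matrices has finitely many coefficients and hence one common denominator;
    the extra factor $X$ takes care of negative powers of [t]. *)
Lemma EL_den (K S' : F -> Prop) (S : F -> Prop) t (I : finType) (A : sqm F I) : sring K -> sring S ->
  (forall x, K x -> S x) -> trans K t ->
  (forall x, S' x -> exists q, [/\ po K q, q.[t] != 0 & adj S t (q.[t] * x)]) ->
  EL S' A -> exists q, [/\ po K q, q.[t] != 0 & EL (denoms S t ('X * q)) A].
Proof.
move=> hK hS KS tK h.
have mulq x q q' : po K q -> po K q' -> denoms S t ('X * q) x -> denoms S t ('X * (q * q')) x.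
  move=> hq hq' [k [p [hp ep]]]; exists k, (p * q' ^+ k); split.
    by apply: poM => //; apply: poE => //; apply: po_mono hq'.
  by rewrite mulrA !hornerM horner_exp -ep hornerM exprMn mulrA.
elim=> [|i j a {}A ij ha hA [q [hq q0 IH]]].
  by exists 1; split; [apply: po1|rewrite hornerC oner_eq0|apply: EL1].
have [q' [hq' q0' [p [k [hp ep]]]]] := h _ ha.
exists (q * q'); split; first exact: poM; first by rewrite hornerM mulf_neq0.
apply: ELc => //; last by apply: EL_mono IH => x; apply: mulq.
rewrite [q * q']mulrC; apply: mulq => //.
exists k.+1, (p * 'X * q' ^+ k); split.
  by apply: poM => //; [apply: poM => //; apply: poX|apply: poE => //; apply: po_mono hq'].
rewrite !hornerM !hornerX horner_exp -ep exprS exprMn; ring.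
Qed.

(** The induction removes the innermost variable [t] and uses its hypothesis twice: over $K(t)$, for
    a factorisation with denominators, and over [K], for the matrices without [t] that arise in
    [core]. *)
Theorem SK1 (ts : seq F) (K : F -> Prop) (I : finType) (A : sqm F I) : sfield K -> chain K ts ->
  over (laur K ts) A -> detF A = 1 -> SE (laur K ts) A.
Proof.
elim/last_ind: ts K I A => [|ts t IH] K I A [hK hV] hc oA dA.
  by apply: SE_EL; apply: gauss.
have [hc1 tK] := chain_rcons hc.
have t0 := trans_neq0 hK tK.
have hL := laur_sring ts hK.
have hc2 : chain K ts by apply: chain_mono hc1 => x; apply: adj_sub.
have tS := trans_laur hK tK hc1.
have ts0 s : s \in ts -> s != 0 by apply: chain_neq0 hc2.
have oA' : over (adj (laur K ts) t) A.
  by move=> i j; apply: laur_adjC => //; rewrite -laur_rcons.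
rewrite laur_rcons; apply: (@SE_mono _ (adj (laur K ts) t)); first by move=> x; apply: adj_laurC.
have [J [f [fi hEL]]] : SE (laur (fr K t) ts) A.
  apply: IH => //; [exact: fr_sfield|exact: chain_fr|].
  move=> i j; apply: (@laur_mono _ (adj K t)); first by move=> x; apply: fr_adj.
  by rewrite -laur_rcons.
have hden x : laur (fr K t) ts x -> exists q, [/\ po K q, q.[t] != 0 & adj (laur K ts) t (q.[t] * x)].
  by move=> /(laur_den hK) [q [h1 h2 h3]]; exists q; split=> //; apply: laur_adjC.
have KS x : K x -> laur K ts x by apply: laur_base.
have [q [hq q0 hEL']] := EL_den hK hL KS tK hden hEL.
have qn0 : q != 0 by apply: contra q0 => /eqP ->; rewrite horner0.
(* The power of $X$ in the denominator is a unit of the Laurent ring. The rest is made monic; its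
   constant term is invertible because [K] is a field. *)
have [a [h [hh eh h0]]] := poly_split hK hq qn0.
have hn0 : h != 0 by apply: contra h0 => /eqP ->; rewrite coef0.
pose lc := lead_coef h; pose h' := lc^-1 *: h.
have lc0 : lc != 0 by rewrite lead_coef_eq0.
have Klc : K lc by apply: hh.
have hP := adj_sring t hL.
have [B [oB AB BA]] := det1_inv hP oA' dA.
apply: (@core K (laur K ts) t hL KS tS _ h' _ _ _ _ I A B) => //.
- by move=> I' B' oB' dB'; apply: IH.
- by rewrite monicE /h' lead_coefZ mulVf.
- by apply: poZ => //; apply: hV.
- by rewrite /h' coefZ mulf_neq0 ?invr_eq0.
- by apply: (hV); rewrite /h' coefZ; apply: sringM => //; apply: hV.
exists J, f; split=> //; apply: EL_mono hEL' => x [k [p [hp ep]]].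
(* q = lc 'X^a h' *)
exists (k + a * k)%N, (lc^-1 ^+ k *: p * h' ^+ (a * k)); split.
  apply: poM => //; first by apply: poZ => //; apply: sringX => //; apply: KS; apply: hV.
  by apply: poE => //; apply: poZ => //; [apply: KS; apply: hV|apply: po_mono hh].
have eq : ('X * q).[t] = t * (t ^+ a * (lc * h'.[t])).
  by rewrite eh /h' !hornerM hornerX hornerXn hornerZ mulVKf.
have -> : (lc^-1 ^+ k *: p * h' ^+ (a * k)).[t] = lc^-1 ^+ k * p.[t] * h'.[t] ^+ (a * k).
  by rewrite hornerM hornerZ horner_exp.
have -> : ('X * h').[t] = t * h'.[t] by rewrite hornerM hornerX.
rewrite -ep eq; move: (h'.[t]) => H.
rewrite exprD !exprMn -!exprM exprVn.
have lk : lc ^+ k != 0 by rewrite expf_neq0.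
by field.
Qed.
End SK1.

(** * The ring of finitely supported elements *)

Section Algebra.
Import GRing.Theory.
Local Open Scope ring_scope.

Section Lin.
Variables (K : fieldType) (n : nat).
Notation mono := (mono n).
Notation elem := (elem K n).
Implicit Types (f g : elem).

Lemma suppP f m : Sn f -> f m != 0 -> m \in supp f.
Proof.
move=> h; rewrite /supp; case: excluded_middle_informative => // H.
by case: ClassicalEpsilon.constructive_indefinite_description => s /= hs; apply: hs.
Qed.

Lemma Sn_add f g : Sn f -> Sn g -> Sn (add f g).
Proof.
move=> hf hg; exists (supp f ++ supp g) => m; rewrite mem_cat.
have [e|h _] := eqVneq (f m) 0; last by rewrite suppP.
by rewrite /add e add0r => h; rewrite orbC suppP.
Qed.
Lemma Sn_opp f : Sn f -> Sn (opp f).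
Proof. by move=> hf; exists (supp f) => m; rewrite /opp oppr_eq0; apply: suppP. Qed.
Lemma Sn_scale c f : Sn f -> Sn (scale c f).
Proof. by move=> hf; exists (supp f) => m; rewrite /scale mulf_eq0 negb_or => /andP[_]; apply: suppP. Qed.
Lemma Sn_zero : Sn (@zero K n).
Proof. by exists [::] => m; rewrite eqxx. Qed.
Lemma Sn_mon a : Sn (@mon K n a).
Proof. by exists [:: a] => m; rewrite /mon inE; case: (m == a); rewrite ?eqxx. Qed.
Lemma one_mon : @one K n = mon K (mone n).
Proof. by apply: funext => m. Qed.
Lemma Sn_one : Sn (@one K n).
Proof. by rewrite one_mon; apply: Sn_mon. Qed.
Lemma opp_scale f : opp f = scale (-1) f.
Proof. by apply: funext => m; rewrite /opp /scale mulN1r. Qed.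
Lemma mul_supp f g m : Sn f -> Sn g -> mul f g m != 0 ->
  exists a b, [/\ f a != 0, g b != 0 & m = mmul a b].
Proof.
move=> hf hg; case: (pselect (exists a b, [/\ f a != 0, g b != 0 & m = mmul a b])) => // h.
rewrite /mul big1 ?eqxx // => a _; rewrite big1 // => b _.
case: eqP => // e; apply/eqP; apply: contraT; rewrite mulf_eq0 negb_or => /andP[h1 h2].
by case: h; exists a, b.
Qed.
Lemma Sn_mul f g : Sn f -> Sn g -> Sn (mul f g).
Proof.
move=> hf hg; exists [seq mmul a b | a <- supp f, b <- supp g] => m /(mul_supp hf hg)[a [b [ha hb ->]]].
by apply/allpairsP; exists (a, b); rewrite /= !suppP.
Qed.

Section LinF.
Variables (F : fieldType) (io : {rmorphism K -> F}).
Implicit Types phi : mono -> F.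

(** [supp] is some list containing the support, obtained by choice, so sums have to be shown
    independent of that list. *)
Lemma eq_sum_supp (T : eqType) (s s' : seq T) (f : T -> F) : uniq s -> uniq s' ->
  (forall a, f a != 0 -> a \in s) -> (forall a, f a != 0 -> a \in s') ->
  \sum_(a <- s) f a = \sum_(a <- s') f a.
Proof.
move=> us us' h h'.
have E r : \sum_(a <- r) f a = \sum_(a <- [seq a <- r | f a != 0]) f a.
  rewrite big_filter [RHS]big_mkcond /=; apply: eq_bigr => a _; case: ifP => // /negbFE/eqP //.
rewrite E [RHS]E; apply: perm_big; apply: uniq_perm; rewrite ?filter_uniq // => a.
by rewrite !mem_filter; case: eqP => //= /eqP ha; rewrite h // h'.
Qed.

(** The extension of a function on monomials, semilinear along [io]. Testing elements against all
    such functionals turns ring axioms into identities of monomials. *)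
Definition lin phi f : F := \sum_(a <- undup (supp f)) io (f a) * phi a.

Lemma lin_any phi f s : Sn f -> uniq s -> (forall a, f a != 0 -> a \in s) ->
  lin phi f = \sum_(a <- s) io (f a) * phi a.
Proof.
move=> hf us hs; apply: eq_sum_supp => //; first exact: undup_uniq.
- move=> a; rewrite mem_undup mulf_eq0 fmorph_eq0 negb_or => /andP[h _]; exact: suppP.
- by move=> a; rewrite mulf_eq0 fmorph_eq0 negb_or => /andP[h _]; apply: hs.
Qed.

Lemma eq_lin phi psi f : phi =1 psi -> lin phi f = lin psi f.
Proof. by move=> h; apply: eq_bigr => a _; rewrite h. Qed.
Lemma linZ c phi f : lin (fun a => c * phi a) f = c * lin phi f.
Proof. by rewrite /lin big_distrr /=; apply: eq_bigr => a _; rewrite mulrCA. Qed.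
Lemma lin_sum (T : Type) (r : seq T) (Q : pred T) (phi : T -> mono -> F) f :
  lin (fun a => \sum_(x <- r | Q x) phi x a) f = \sum_(x <- r | Q x) lin (phi x) f.
Proof. by rewrite /lin exchange_big /=; apply: eq_bigr => a _; rewrite big_distrr. Qed.
Lemma lin_addf phi psi f : lin (fun a => phi a + psi a) f = lin phi f + lin psi f.
Proof. by rewrite /lin -big_split /=; apply: eq_bigr => a _; rewrite mulrDr. Qed.
Lemma lin0 f : lin (fun _ => 0) f = 0.
Proof. by rewrite /lin big1 // => a _; rewrite mulr0. Qed.


Lemma linD phi f g : Sn f -> Sn g -> lin phi (add f g) = lin phi f + lin phi g.
Proof.
move=> hf hg; pose s := undup (supp f ++ supp g).
have us : uniq s by apply: undup_uniq.
rewrite (lin_any phi (Sn_add hf hg) us) ?(lin_any phi hf us) ?(lin_any phi hg us).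
- by rewrite -big_split /=; apply: eq_bigr => a _; rewrite /add rmorphD mulrDl.
- by move=> a ha; rewrite mem_undup mem_cat orbC suppP.
- by move=> a ha; rewrite mem_undup mem_cat suppP.
- move=> a ha; rewrite mem_undup mem_cat; move: ha; rewrite /add.
  have [->|h _] := eqVneq (f a) 0; last by rewrite suppP.
  by rewrite add0r => h; rewrite orbC suppP.
Qed.
Lemma lin_scale c phi f : Sn f -> lin phi (scale c f) = io c * lin phi f.
Proof.
move=> hf; rewrite (lin_any phi (Sn_scale c hf) (undup_uniq (supp f))).
  by rewrite /lin big_distrr /=; apply: eq_bigr => a _; rewrite /scale rmorphM mulrA.
by move=> a; rewrite /scale mulf_eq0 negb_or mem_undup => /andP[_]; apply: suppP.
Qed.
Lemma linN phi f : Sn f -> lin phi (opp f) = - lin phi f.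
Proof. by move=> hf; rewrite opp_scale lin_scale // rmorphN rmorph1 mulN1r. Qed.
Lemma lin_mon phi a : lin phi (mon K a) = phi a.
Proof.
rewrite (lin_any phi (Sn_mon a) (s := [:: a])) ?big_seq1 //.
  by rewrite /mon eqxx rmorph1 mul1r.
by move=> b; rewrite /mon inE; case: (b == a); rewrite ?eqxx.
Qed.
Lemma lin_zero phi : lin phi (@zero K n) = 0.
Proof. by rewrite (lin_any phi Sn_zero (s := [::])) ?big_nil // => a; rewrite eqxx. Qed.

Lemma lin_mul phi f g : Sn f -> Sn g ->
  lin phi (mul f g) = lin (fun a => lin (fun b => phi (mmul a b)) g) f.
Proof.
move=> hf hg; pose T := undup [seq mmul a b | a <- undup (supp f), b <- undup (supp g)].
have inT a b : a \in undup (supp f) -> b \in undup (supp g) -> mmul a b \in T.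
  by move=> ha hb; rewrite mem_undup; apply/allpairsP; exists (a, b).
rewrite (lin_any phi (Sn_mul hf hg) (undup_uniq _) (s := T)); last first.
  by move=> m /(mul_supp hf hg)[a [b [ha hb ->]]]; apply: inT; rewrite mem_undup suppP.
under eq_bigr => m _.
  rewrite /mul rmorph_sum big_distrl /=.
  under eq_bigr => a _ do rewrite rmorph_sum big_distrl /=.
  over.
rewrite exchange_big /= big_seq [RHS]/lin big_seq; apply: eq_bigr => a ha.
rewrite exchange_big /= /lin big_distrr /= big_seq [RHS]big_seq; apply: eq_bigr => b hb.
rewrite (bigD1_seq (mmul a b)) ?inT ?undup_uniq //= eqxx big1 ?addr0; first by rewrite rmorphM mulrA.
by move=> m /negPf h; rewrite eq_sym h rmorph0 mul0r.
Qed.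
End LinF.
End Lin.

Lemma lin_coef (K : fieldType) n (f : elem K n) m : Sn f -> lin (idfun : {rmorphism K -> K}) (fun a => (a == m)%:R) f = f m.
Proof.
move=> hf; rewrite (@lin_any _ _ _ _ _ _ (undup (m :: supp f))) ?undup_uniq //.
  rewrite (bigD1_seq m) ?undup_uniq ?mem_undup ?mem_head //= eqxx mulr1 big1 ?addr0 // => a /negPf ->.
  by rewrite mulr0.
by move=> a ha; rewrite mem_undup inE suppP ?orbT.
Qed.
Lemma elem_eq (K : fieldType) n (f g : elem K n) : Sn f -> Sn g ->
  (forall phi, lin (idfun : {rmorphism K -> K}) phi f = lin (idfun : {rmorphism K -> K}) phi g) -> f = g.
Proof. by move=> hf hg h; apply: funext => m; rewrite -(lin_coef m hf) h lin_coef. Qed.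

Lemma mmulA n : associative (@mmul n).
Proof.
by move=> u v w; congr pair; apply/ffunP => i; rewrite !ffunE /=; lia.
Qed.
Lemma mmul1 n : left_id (mone n) (@mmul n).
Proof. by move=> [u1 u2]; congr pair; apply/ffunP => i; rewrite !ffunE /=; lia. Qed.
Lemma mmulr1 n : right_id (mone n) (@mmul n).
Proof. by move=> [u1 u2]; congr pair; apply/ffunP => i; rewrite !ffunE /=; lia. Qed.

(** Bundling the finite support gives a genuine ring type with the usual algebra of rewriting;
    [sval] returns to the plain functions of the theorem. *)
Definition SR (K : fieldType) (n : nat) := {f : elem K n | Sn f}.

Section SRing.
Variables (K : fieldType) (n : nat).
Notation S := (SR K n).
HB.instance Definition _ := gen_eqMixin S.
HB.instance Definition _ := gen_choiceMixin S.

Lemma SRP (u v : S) : sval u = sval v -> u = v.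
Proof. by case: u v => [f hf] [g hg] /= e; subst g; congr exist; apply: Prop_irrelevance. Qed.
Lemma SnS (u : S) : Sn (sval u). Proof. exact: (svalP u). Qed.
Hint Resolve SnS : core.

Definition SR_add (u v : S) : S := exist _ (add (sval u) (sval v)) (Sn_add (SnS u) (SnS v)).
Definition SR_opp (u : S) : S := exist _ (opp (sval u)) (Sn_opp (SnS u)).
Definition SR_zero : S := exist _ (@zero K n) (Sn_zero K n).
Definition SR_one : S := exist _ (@one K n) (Sn_one K n).
Definition SR_mul (u v : S) : S := exist _ (mul (sval u) (sval v)) (Sn_mul (SnS u) (SnS v)).

Fact SR_addA : associative SR_add.
Proof. by move=> u v w; apply: SRP; apply: funext => m; rewrite /= /add addrA. Qed.
Fact SR_addC : commutative SR_add.
Proof. by move=> u v; apply: SRP; apply: funext => m; rewrite /= /add addrC. Qed.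
Fact SR_add0 : left_id SR_zero SR_add.
Proof. by move=> u; apply: SRP; apply: funext => m; rewrite /= /add add0r. Qed.
Fact SR_addN : left_inverse SR_zero SR_opp SR_add.
Proof. by move=> u; apply: SRP; apply: funext => m; rewrite /= /add addNr. Qed.
HB.instance Definition _ := GRing.isZmodule.Build S SR_addA SR_addC SR_add0 SR_addN.

Fact SR_mulA : associative SR_mul.
Proof.
move=> u v w; apply: SRP; apply: elem_eq => // phi /=; rewrite !lin_mul //; last exact: Sn_mul.
  by apply: eq_lin => a; rewrite lin_mul //; apply: eq_lin => b; apply: eq_lin => c; rewrite mmulA.
by apply: Sn_mul.
Qed.
Fact SR_mul1 : left_id SR_one SR_mul.
Proof.
move=> u; apply: SRP; apply: elem_eq => // phi /=; rewrite lin_mul ?one_mon ?lin_mon //; last exact: Sn_mon.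
by apply: eq_lin => a; rewrite mmul1.
Qed.
Fact SR_mulr1 : right_id SR_one SR_mul.
Proof.
move=> u; apply: SRP; apply: elem_eq => // phi /=; rewrite lin_mul ?one_mon //; last exact: Sn_mon.
by apply: eq_lin => a; rewrite lin_mon mmulr1.
Qed.
Fact SR_mulDl : left_distributive SR_mul SR_add.
Proof.
move=> u v w; apply: SRP; apply: elem_eq => // phi /=; rewrite lin_mul ?linD ?lin_mul //; try exact: Sn_mul; exact: Sn_add.
Qed.
Fact SR_mulDr : right_distributive SR_mul SR_add.
Proof.
move=> u v w; apply: SRP; apply: elem_eq => // phi /=; rewrite linD ?lin_mul //; try exact: Sn_mul; try exact: Sn_add.
by rewrite -lin_addf; apply: eq_lin => a; rewrite linD.
Qed.
HB.instance Definition _ := GRing.Zmodule_isPzRing.Build S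
  SR_mulA SR_mul1 SR_mulr1 SR_mulDl SR_mulDr.

Lemma svalM (u v : S) : sval (u * v) = mul (sval u) (sval v). Proof. by []. Qed.
Lemma svalD (u v : S) : sval (u + v) = add (sval u) (sval v). Proof. by []. Qed.
Lemma svalN (u : S) : sval (- u) = opp (sval u). Proof. by []. Qed.
Lemma sval1 : sval (1 : S) = @one K n. Proof. by []. Qed.
Lemma sval0 : sval (0 : S) = @zero K n. Proof. by []. Qed.
Lemma svalX (u : S) k : sval (u ^+ k) = pow (sval u) k.
Proof. by elim: k => // k IH; rewrite exprS svalM IH. Qed.

Definition monS (a : mono n) : S := exist _ (mon K a) (Sn_mon K a).
Definition scaleS (c : K) (u : S) : S := exist _ (scale c (sval u)) (Sn_scale c (SnS u)).

Lemma monS_mul a b : monS a * monS b = monS (mmul a b).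
Proof.
apply: SRP; apply: elem_eq => [||phi] /=; [by apply: Sn_mul; exact: Sn_mon|exact: Sn_mon|].
by rewrite lin_mul ?lin_mon //; exact: Sn_mon.
Qed.
Lemma monS1 : monS (mone n) = 1.
Proof. by apply: SRP; rewrite /= -one_mon. Qed.
Lemma scaleSE c u : scaleS c u = scaleS c 1 * u.
Proof.
apply: SRP; apply: elem_eq => [||phi] /=; [exact: Sn_scale|by apply: Sn_mul => //; apply: Sn_scale; apply: Sn_one|].
rewrite lin_mul //; last by apply: Sn_scale; apply: Sn_one.
rewrite !lin_scale //; last exact: Sn_one.
by rewrite one_mon lin_mon; congr (_ * _); apply: eq_lin => a; rewrite mmul1.
Qed.
Lemma scaleS_comm c u : scaleS c 1 * u = u * scaleS c 1.
Proof.
apply: SRP; apply: elem_eq => [||phi] /=; [by apply: Sn_mul => //; apply: Sn_scale; apply: Sn_one|by apply: Sn_mul => //; apply: Sn_scale; apply: Sn_one|].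
rewrite !lin_mul //; try by apply: Sn_scale; apply: Sn_one.
rewrite lin_scale ?one_mon ?lin_mon; last exact: Sn_mon.
rewrite -linZ; apply: eq_lin => a; rewrite mmul1 lin_scale ?lin_mon ?mmulr1 //; exact: Sn_mon.
Qed.
End SRing.
End Algebra.

(** * The representations *)

Section Repr.
Import GRing.Theory.
Local Open Scope ring_scope.
Variables (K F : fieldType) (n : nat) (io : {rmorphism K -> F}).
Notation S := (SR K n).
Notation mono := (mono n).
Implicit Types (I J : {set 'I_n}) (u v w : S) (t : 'I_n -> F).

Definition ix I := {i : 'I_n | i \in I}.
Definition mi I := {ffun ix I -> nat}.
Definition tw t I (a : mono) : F := \prod_(j | j \notin I) (t j ^+ a.1 j / t j ^+ a.2 j).
Definition lea I (a : mono) (x : mi I) := [forall i : ix I, a.1 (val i) <= x i]%N.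
Definition sh I (a : mono) (x : mi I) : mi I := [ffun i => (x i - a.1 (val i) + a.2 (val i))%N].

(** A left action: $x^ay^b$ sends [f] to $x\mapsto f(x-a+b)$ times the scalar [tw], with value 0
    unless $a\le x$ on [I]. Each value involves finitely many values of [f], so all functions are
    allowed. *)
Definition rho_ t I u (f : mi I -> F) (x : mi I) : F :=
  lin io (fun a => tw t I a * (if lea a x then f (sh a x) else 0)) (sval u).

Section T.
Variable t : 'I_n -> F.
Hypothesis t0 : forall j, t j != 0.
Variable I : {set 'I_n}.
Notation rho := (rho_ t (I := I)).
Implicit Types (f g : mi I -> F) (x : mi I).

Lemma eq_rho u f g x : f =1 g -> rho u f x = rho u g x.
Proof. by move=> /funext ->. Qed.
Lemma rhoD u v f x : rho (u + v) f x = rho u f x + rho v f x.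
Proof. by rewrite /rho_ svalD linD //; exact: SnS. Qed.
Lemma rhoN u f x : rho (- u) f x = - rho u f x.
Proof. by rewrite /rho_ svalN linN //; exact: SnS. Qed.
Lemma rhoB u v f x : rho (u - v) f x = rho u f x - rho v f x.
Proof. by rewrite rhoD rhoN. Qed.
Lemma rho0 f x : rho 0 f x = 0.
Proof. by rewrite /rho_ sval0 lin_zero. Qed.
Lemma rho_mon a f x : rho (monS K a) f x = tw t I a * (if lea a x then f (sh a x) else 0).
Proof. by rewrite /rho_ lin_mon. Qed.
Lemma rho_suml (T : Type) (r : seq T) (Q : pred T) (h : T -> S) f x :
  rho (\sum_(i <- r | Q i) h i) f x = \sum_(i <- r | Q i) rho (h i) f x.
Proof.
elim: r => [|i r IH]; first by rewrite !big_nil rho0.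
by rewrite !big_cons; case: ifP => // _; rewrite rhoD IH.
Qed.
Lemma rho1 f x : rho 1 f x = f x.
Proof.
rewrite -monS1 rho_mon /tw big1 ?mul1r; last by move=> j _; rewrite !ffunE expr0 divr1.
have -> : lea (mone n) x by apply/forallP => i; rewrite ffunE.
by congr f; apply/ffunP => i; rewrite !ffunE subn0 addn0.
Qed.
Lemma rho_scale c u f x : rho (scaleS c u) f x = io c * rho u f x.
Proof. by rewrite /rho_ /= lin_scale //; exact: SnS. Qed.
(** The truncated subtraction in a product only cancels a power of a variable against its inverse,
    which is invisible after evaluation at invertible scalars. *)
Lemma twM a b : tw t I (mmul a b) = tw t I a * tw t I b.
Proof.
rewrite /tw -big_split /=; apply: eq_bigr => j _; rewrite !ffunE /=.
have p k : t j ^+ k != 0 by rewrite expf_neq0.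
rewrite mulf_div; apply/eqP; rewrite eqr_div ?mulf_neq0 // -!exprD.
by apply/eqP; congr (_ ^+ _); lia.
Qed.
Lemma leaM a b x : lea (mmul a b) x = lea a x && lea b (sh a x).
Proof.
apply/forallP/andP => [h|[/forallP h1 /forallP h2] i].
  by split; apply/forallP => i; have := h i; rewrite !ffunE /=; lia.
by have := h1 i; have := h2 i; rewrite !ffunE /=; lia.
Qed.
Lemma shM a b x : lea a x -> lea b (sh a x) -> sh (mmul a b) x = sh b (sh a x).
Proof.
move=> /forallP h1 /forallP h2; apply/ffunP => i; have := h1 i; have := h2 i.
by rewrite !ffunE /=; lia.
Qed.
Lemma rhoM u v f x : rho (u * v) f x = rho u (rho v f) x.
Proof.
rewrite /rho_ svalM lin_mul; try exact: SnS.
apply: eq_lin => a; case: ifP => ha; last first.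
  by rewrite mulr0 -[RHS](lin0 io (sval v)); apply: eq_lin => b; rewrite leaM ha mulr0.
rewrite -linZ; apply: eq_lin => b; rewrite leaM ha twM -mulrA; congr (_ * (_ * _)).
by rewrite /=; case: ifP => // hb; rewrite shM.
Qed.
Lemma rhoZ u c f x : rho u (fun y => c * f y) x = c * rho u f x.
Proof. by rewrite -linZ; apply: eq_lin => a; case: ifP => _; rewrite ?mulr0 // mulrCA. Qed.
Lemma rho_sumr u (T : Type) (r : seq T) (Q : pred T) (h : T -> mi I -> F) x :
  rho u (fun y => \sum_(i <- r | Q i) h i y) x = \sum_(i <- r | Q i) rho u (h i) x.
Proof.
rewrite -lin_sum; apply: eq_lin => a; rewrite -big_distrr /=; case: ifP => _ //.
by rewrite big1.
Qed.
Lemma rho_zf u x : rho u (fun _ => 0) x = 0.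
Proof. by rewrite /rho_ -[RHS](lin0 io (sval u)); apply: eq_lin => a; case: ifP => _; rewrite mulr0. Qed.
End T.

Section Gens.
Definition dl (i : 'I_n) (s : nat) : {ffun 'I_n -> nat} := [ffun j => if j == i then s else 0%N].
Definition XS i : S := monS K (dl i 1, dl i 0).
Definition YS i : S := monS K (dl i 0, dl i 1).
Definition Es (s r : nat) (i : 'I_n) : S := XS i ^+ s * YS i ^+ r - XS i ^+ s.+1 * YS i ^+ r.+1.

Lemma XSn i s : XS i ^+ s = monS K (dl i s, dl i 0).
Proof.
elim: s => [|s IH].
  rewrite expr0 -monS1; congr monS; rewrite /mone; congr pair; apply/ffunP => j; rewrite !ffunE; by case: ifP.
rewrite exprS IH monS_mul; congr monS; rewrite /mmul; congr pair; apply/ffunP => j; rewrite !ffunE /=; by case: ifP => _; lia.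
Qed.
Lemma YSn i s : YS i ^+ s = monS K (dl i 0, dl i s).
Proof.
elim: s => [|s IH].
  rewrite expr0 -monS1; congr monS; rewrite /mone; congr pair; apply/ffunP => j; rewrite !ffunE; by case: ifP.
rewrite exprS IH monS_mul; congr monS; rewrite /mmul; congr pair; apply/ffunP => j; rewrite !ffunE /=; by case: ifP => _; lia.
Qed.
Lemma XYn i s r : XS i ^+ s * YS i ^+ r = monS K (dl i s, dl i r).
Proof.
rewrite XSn YSn monS_mul; congr monS; rewrite /mmul; congr pair; apply/ffunP => j; rewrite !ffunE /=; case: ifP => _; lia.
Qed.
Lemma YX i : YS i * XS i = 1.
Proof.
rewrite monS_mul -monS1; congr monS; rewrite /mmul /mone; congr pair; apply/ffunP => j; rewrite !ffunE /=; by case: ifP.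
Qed.

Lemma xg_sval (i : 'I_n) : @xg K n i = sval (XS i).
Proof.
rewrite /xg /XS /=; congr mon; congr pair; apply/ffunP => j; rewrite !ffunE ?val_eqE; by case: (j == i).
Qed.
Lemma yg_sval (i : 'I_n) : @yg K n i = sval (YS i).
Proof.
rewrite /yg /YS /=; congr mon; congr pair; apply/ffunP => j; rewrite !ffunE ?val_eqE; by case: (j == i).
Qed.
Lemma Est_sval s r (i : 'I_n) : @Est K n s r i = sval (Es s r i).
Proof. by rewrite /Est /Es xg_sval yg_sval -!svalX. Qed.
Lemma EI_sval (A B : 'I_n -> nat) (I : {set 'I_n}) :
  @EI K n A B I = sval (\prod_(i in I) Es (A i) (B i) i).
Proof.
rewrite /EI (big_morph (fun u : S => sval u) (@svalM K n) (@sval1 K n)).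
by apply: eq_bigr => i _; rewrite Est_sval.
Qed.
Lemma eI_sval (I : {set 'I_n}) : @eI K n I = sval (\prod_(i in I) Es 0 0 i).
Proof.
rewrite /eI (big_morph (fun u : S => sval u) (@svalM K n) (@sval1 K n)).
by apply: eq_bigr => i _; rewrite /eg Est_sval.
Qed.
Lemma mon_comm (a b : mono) : (forall i, (a.1 i = 0%N /\ a.2 i = 0%N) \/ (b.1 i = 0%N /\ b.2 i = 0%N)) ->
  monS K a * monS K b = monS K b * monS K a.
Proof.
move=> h; rewrite !monS_mul; congr monS; rewrite /mmul; congr pair; apply/ffunP => i; rewrite !ffunE /=; case: (h i) => -[-> ->]; lia.
Qed.

Section T.
Variable t : 'I_n -> F.
Hypothesis t0 : forall j, t j != 0.
Variable I : {set 'I_n}.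
Notation rho := (rho_ t (I := I)).

Lemma tw_dl i s r : tw t I (dl i s, dl i r) = if i \in I then 1 else t i ^+ s / t i ^+ r.
Proof.
rewrite /tw; case: ifP => hi.
  by rewrite big1 // => j hj; rewrite !ffunE /=; case: eqP => [e|_]; [rewrite e hi in hj|rewrite expr0 divr1].
rewrite (bigD1 i) ?hi //= !ffunE eqxx big1 ?mulr1 // => j /andP[_ /negPf hj].
by rewrite !ffunE hj expr0 divr1.
Qed.
Lemma rho_XY_out i s r f x : i \notin I -> rho (XS i ^+ s * YS i ^+ r) f x = t i ^+ s / t i ^+ r * f x.
Proof.
move=> hi; rewrite XYn rho_mon tw_dl (negPf hi).
have ne (k : ix I) : (val k == i) = false by apply: contraNF hi => /eqP <-; apply: (valP k).
have -> : lea (dl i s, dl i r) x by apply/forallP => k; rewrite /= ffunE ne.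
by congr (_ * f _); apply/ffunP => k; rewrite !ffunE /= ne subn0 addn0.
Qed.
Definition upd (x : mi I) (k : ix I) (r : nat) : mi I := [ffun j => if j == k then r else x j].
Lemma rho_XY_in (k : ix I) s r f x :
  rho (XS (val k) ^+ s * YS (val k) ^+ r) f x = if (s <= x k)%N then f (upd x k (x k - s + r)%N) else 0.
Proof.
rewrite XYn rho_mon tw_dl (valP k) mul1r.
have -> : lea (dl (val k) s, dl (val k) r) x = (s <= x k)%N.
  apply/forallP/idP => [/(_ k)|h j]; rewrite /= ffunE ?eqxx //.
  by case: eqP => [/val_inj ->|].
case: ifP => // h; congr f; apply/ffunP => j; rewrite !ffunE /=.
by rewrite val_eqE; case: eqP => [->|_]; rewrite ?subn0 ?addn0.
Qed.
Lemma rho_Es_out i s r f x : i \notin I -> rho (Es s r i) f x = 0.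
Proof.
move=> hi; rewrite rhoB !rho_XY_out // !exprS invfM mulrACA divff // mul1r subrr //.
Qed.
(** A matrix unit in one coordinate. Together with the vanishing when the variable lies outside [I],
    this dichotomy is the source of all kernel statements. *)
Lemma rho_Es_in (k : ix I) s r f x : rho (Es s r (val k)) f x = if x k == s then f (upd x k r) else 0.
Proof.
rewrite rhoB !rho_XY_in.
case: (ltngtP (x k) s) => h.
- by rewrite subrr.
- by rewrite (_ : (x k - s + r = x k - s.+1 + r.+1)%N) ?subrr //; lia.
- by rewrite subr0 h subnn add0n.
Qed.

Definition mat (l : seq 'I_n) (A : 'I_n -> nat) (x : mi I) := [forall k : ix I, (val k \in l) ==> (x k == A (val k))].
Definition upl (l : seq 'I_n) (B : 'I_n -> nat) (x : mi I) : mi I := [ffun k => if val k \in l then B (val k) else x k].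

Lemma rho_prodE_in (l : seq 'I_n) A B f x : uniq l -> {subset l <= I} ->
  rho (\prod_(i <- l) Es (A i) (B i) i) f x = if mat l A x then f (upl l B x) else 0.
Proof.
elim: l f x => [|i l IH] f x /=.
  move=> _ _; rewrite big_nil rho1.
  have -> : mat [::] A x by apply/forallP => k.
  by congr f; apply/ffunP => k; rewrite ffunE.
case/andP => il ul hl; rewrite big_cons rhoM //.
have iI : i \in I by apply: hl; rewrite mem_head.
pose k : ix I := exist _ i iI.
have -> : Es (A i) (B i) i = Es (A i) (B i) (val k) by [].
rewrite rho_Es_in IH //; last by move=> j hj; apply: hl; rewrite inE hj orbT.
have -> : mat (i :: l) A x = (x k == A i) && mat l A (upd x k (B (val k))).
  apply/forallP/andP => [h|[h1 /forallP h2] j].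
    split; first by have := h k; rewrite mem_head.
    apply/forallP => j; apply/implyP => hj; have := h j; rewrite inE hj orbT /= ffunE.
    by case: (j =P k) => [e|//]; case/negP: il; rewrite -[i]/(val k) -e.
  apply/implyP; rewrite inE => /orP[/eqP e|hj].
    by have -> : j = k by apply: val_inj.
  have := h2 j; rewrite hj /= ffunE; case: (j =P k) => [e|//].
  by case/negP: il; rewrite -[i]/(val k) -e.
case: (x k =P A i) => //= _; case: ifP => // _; congr f; apply/ffunP => j; rewrite !ffunE inE.
case: (val j =P i) => [e|ne] /=.
  by rewrite e (negPf il); have -> : j = k by [apply: val_inj]; rewrite eqxx.
by case: ifP => // _; case: eqP => // e; case: ne; rewrite e.
Qed.
Lemma rho_prodE_out (l : seq 'I_n) A B f x i : i \in l -> i \notin I ->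
  rho (\prod_(i <- l) Es (A i) (B i) i) f x = 0.
Proof.
move=> + iI; elim: l f x => [|j l IH] f x //; rewrite big_cons rhoM // inE => /orP[/eqP <-|h].
  by rewrite rho_Es_out.
by rewrite (_ : rho _ f = fun _ => 0) ?rho_zf //; apply: funext => y; apply: IH.
Qed.
End T.
End Gens.
End Repr.

(** * The ideals as common kernels *)

Section Ideals.
Import GRing.Theory.
Local Open Scope ring_scope.

Section LI.
Variables (F : fieldType) (n : nat) (t : 'I_n -> F) (Kp : F -> Prop).
Hypothesis hK : sring Kp.

Lemma laur_mono_in (js : seq 'I_n) (e : 'I_n -> nat) : (forall j, j \in js -> t j != 0) ->
  laur Kp (map t js) (\prod_(j <- js) t j ^+ e j).
Proof.
move=> h; have hL := laur_sring (map t js) hK; rewrite big_seq; apply: sring_prod => // j hj.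
by apply: sringX => //; have [] := laur_gen hK (map_f t hj) (h j hj).
Qed.

(** Terms with equal exponent of the first variable form the coefficients of a polynomial relation.
    Transcendence makes them vanish, and each is a sum of the same kind in the remaining
    variables. *)
Lemma lin_indep (js : seq 'I_n) (T : eqType) (s : seq T) (c : T -> F) (e : T -> 'I_n -> nat) :
  chain Kp (map t js) -> uniq s -> (forall a, Kp (c a)) ->
  (forall a b, a \in s -> b \in s -> (forall j, j \in js -> e a j = e b j) -> a = b) ->
  \sum_(a <- s) c a * \prod_(j <- js) t j ^+ e a j = 0 -> forall a, a \in s -> c a = 0.
Proof.
elim: js s => [|j js IH] s.
  move=> _ us hc he; case: s us he => // a [|b s] us he.
    by rewrite big_seq1 big_nil mulr1 => h x; rewrite inE => /eqP ->.
  have eab : a = b by apply: he; rewrite ?inE ?eqxx ?orbT.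
  by move: us; rewrite /= eab inE eqxx.
move=> [hc ht] us hk he hs a ha.
have h0 i : i \in js -> t i != 0 by move=> hi; apply: (chain_neq0 hK hc); apply: map_f.
have hL := laur_sring (map t js) hK.
pose m b := c b * \prod_(i <- js) t i ^+ e b i.
pose p := \sum_(b <- s) m b *: 'X^(e b j).
have pc k : p`_k = \sum_(b <- s | e b j == k) m b.
  rewrite coef_sum [RHS]big_mkcond /=; apply: eq_bigr => b _; rewrite coefZ coefXn eq_sym.
  by case: eqP => _; rewrite ?mulr1 ?mulr0.
have p0 : p = 0.
  apply: ht => [k|].
    rewrite pc; apply: sring_sum => // b _; apply: sringM => //; first by apply: laur_base.
    exact: laur_mono_in.
  rewrite -hs horner_sum; apply: eq_bigr => b _; rewrite hornerZ hornerXn big_cons /m.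
  by rewrite mulrAC -mulrA.
apply: (IH [seq b <- s | e b j == e a j]) => //.
- exact: filter_uniq.
- move=> b b'; rewrite !mem_filter => /andP[/eqP h1 h2] /andP[/eqP h3 h4] h; apply: he => // i.
  by rewrite inE => /orP[/eqP ->|/h //]; rewrite h1 h3.
- by rewrite big_filter -pc p0 coef0.
- by rewrite mem_filter eqxx.
Qed.
End LI.

Lemma chain_subseq (F : fieldType) (Kp : F -> Prop) (T : eqType) (t : T -> F) (js js' : seq T) : sring Kp ->
  chain Kp (map t js) -> subseq js' js -> chain Kp (map t js').
Proof.
move=> hK; elim: js js' => [|j js IH] [|j' js'] //= [hc ht].
have sub r x : subseq r js -> laur Kp (map t r) x -> laur Kp (map t js) x.
  move=> hr; apply: laur_min => [|y|y]; first exact: laur_sring.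
    exact: laur_base.
  case/mapP => i hi ->; have hi' := mem_subseq hr hi.
  have hi0 : t i != 0 by apply: (chain_neq0 hK hc); apply: map_f.
  by have [] := laur_gen hK (map_f t hi') hi0.
case: eqP => [-> h|_ h]; last exact: (IH (j' :: js')).
split; first exact: IH.
by apply: trans_mono ht => x; apply: sub.
Qed.

Variables (K F : fieldType) (n : nat) (io : {rmorphism K -> F}).
Notation S := (SR K n).
Notation mono := (mono n).
Definition Kp (x : F) := exists k, x = io k.
Lemma Kp_sfield : sfield Kp.
Proof.
split; first split.
- by exists 1; rewrite rmorph1.
- by move=> x y [a ->] [b ->]; exists (a - b); rewrite rmorphB.
- by move=> x y [a ->] [b ->]; exists (a * b); rewrite rmorphM.
- by move=> x [a ->]; exists a^-1; rewrite fmorphV.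
Qed.
Let hKp : sring Kp. Proof. by case: Kp_sfield. Qed.

(** * A partition of unity indexed by subsets of the variables *)

Section Unity.
(** It acts as the projection to the points with $x_i<D$ when [i] lies in the subset, and as 0
    otherwise. *)
Definition gS D (i : 'I_n) : S := 1 - XS K i ^+ D * YS K i ^+ D.
Definition EE D (l : seq 'I_n) : S := \prod_(i <- l) gS D i.
Definition dC D (I : {set 'I_n}) : {ffun 'I_n -> nat} := [ffun j => if j \in I then 0%N else D].
Definition d0 : {ffun 'I_n -> nat} := [ffun => 0%N].
Definition Xc D I : S := monS K (dC D I, d0).
Definition Yc D I : S := monS K (d0, dC D I).
(** The counterpart for the variables outside [I]: in the full representation the projection to
    $x_j\ge D$ for all these [j], and the identity in the representation of [I]. *)
Definition fC D I : S := Xc D I * Yc D I.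
Definition bnd D (w : S) := forall m, sval w m != 0 -> forall j, (m.1 j <= D)%N /\ (m.2 j <= D)%N.
Definition box (I : {set 'I_n}) D (x : mi I) := [forall k, x k < D]%N.

Lemma bnd_ex (w : S) : exists D, bnd D w.
Proof.
suff [D hD] : exists D, forall m, m \in supp (sval w) -> forall j, (m.1 j <= D)%N /\ (m.2 j <= D)%N.
  by exists D => m hm; apply: hD; apply: (suppP (SnS w) hm).
elim: (supp _) => [|m r [D IH]]; first by exists 0%N.
exists (D + \sum_j (m.1 j + m.2 j))%N => m'; rewrite inE => /orP[/eqP -> j|/IH h j].
  have h : (m.1 j + m.2 j <= D + \sum_j (m.1 j + m.2 j))%N by rewrite (bigD1 j) //= addnCA leq_addr.
  by split; apply: leq_trans h; [apply: leq_addr|apply: leq_addl].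
by have [h1 h2] := h j; split; apply: leq_trans (leq_addr _ _).
Qed.
Lemma bndW D D' (w : S) : (D <= D')%N -> bnd D w -> bnd D' w.
Proof. by move=> h hw m hm j; have := hw m hm j; lia. Qed.

Lemma supp_EE D l m j : sval (EE D l) m != 0 -> j \notin l -> m.1 j = 0%N /\ m.2 j = 0%N.
Proof.
elim: l m => [|i l IH] m.
  rewrite /EE big_nil sval1 /one; case: (m =P mone n) => [-> _ _|_]; last by rewrite eqxx.
  by rewrite !ffunE.
rewrite /EE big_cons svalM => /(mul_supp (SnS _) (SnS _)) [a [b [ha hb ->]]]; rewrite inE negb_or => /andP[ij jl].
have [b1 b2] := IH b hb jl.
have [a1 a2] : a.1 j = 0%N /\ a.2 j = 0%N.
  move: ha; rewrite /gS svalD svalN /add /opp sval1 /one XYn /= /mon.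
  case: (a =P mone n) => [-> _|_]; first by rewrite !ffunE.
  case: (a =P (_, _)) => [-> _|_]; first by rewrite !ffunE /= (negPf ij).
  by rewrite subr0 eqxx.
by rewrite !ffunE a1 a2 b1 b2.
Qed.

Section T.
Variable t : 'I_n -> F.
Hypothesis t0 : forall j, t j != 0.
Variable J : {set 'I_n}.
Notation rho := (rho_ io t (I := J)).
Lemma rho_gS_out D i f x : i \notin J -> rho (gS D i) f x = 0.
Proof. by move=> hi; rewrite rhoB rho1 rho_XY_out // divff ?mul1r ?subrr // expf_neq0. Qed.
Lemma rho_gS_in D (k : ix J) f x : rho (gS D (val k)) f x = if (x k < D)%N then f x else 0.
Proof.
rewrite rhoB rho1 rho_XY_in; case: leqP => h; last by rewrite subr0.
rewrite subnK // (_ : upd x k (x k) = x) ?subrr //; apply/ffunP => j; rewrite ffunE; by case: eqP => // ->.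
Qed.
Lemma rho_EE_in D l f x : {subset l <= J} ->
  rho (EE D l) f x = if [forall k : ix J, (val k \in l) ==> (x k < D)%N] then f x else 0.
Proof.
elim: l f x => [|i l IH] f x hl.
  by rewrite /EE big_nil rho1; case: ifP => // /negbT/forallPn[k].
rewrite /EE big_cons rhoM //.
have iJ : i \in J by apply: hl; rewrite mem_head.
pose k : ix J := exist _ i iJ.
rewrite -[gS D i]/(gS D (val k)) rho_gS_in IH; last by move=> j hj; apply: hl; rewrite inE hj orbT.
have -> : [forall k : ix J, (val k \in i :: l) ==> (x k < D)%N] =
   (x k < D)%N && [forall k : ix J, (val k \in l) ==> (x k < D)%N].
  apply/forallP/andP => [h|[h1 /forallP h2] j].
    split; first by have := h k; rewrite mem_head.
    by apply/forallP => j; apply/implyP => hj; have := h j; rewrite inE hj orbT.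
  apply/implyP; rewrite inE => /orP[/eqP e|hj]; last by have := h2 j; rewrite hj.
  by have -> : j = k by apply: val_inj.
by case: ifP.
Qed.
Lemma rho_EE_out D l f x i : i \in l -> i \notin J -> rho (EE D l) f x = 0.
Proof.
move=> + iI; elim: l f x => [|j l IH] f x //; rewrite /EE big_cons rhoM // inE => /orP[/eqP <-|h].
  by rewrite rho_gS_out.
by rewrite (_ : rho _ f = fun _ => 0) ?rho_zf //; apply: funext => y; apply: IH.
Qed.
Lemma rho_fC D f x : rho (fC D J) f x = f x.
Proof.
rewrite /fC monS_mul rho_mon.
have hk (k : ix J) : val k \in J by apply: (valP k).
have -> : tw t J (mmul (dC D J, d0) (d0, dC D J)) = 1.
  rewrite /tw big1 // => j hj; rewrite !ffunE /= (negPf hj) ?(addn0, add0n, subn0, sub0n) divff ?expf_neq0 //.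
have -> : lea (mmul (dC D J, d0) (d0, dC D J)) x.
  by apply/forallP => k; rewrite !ffunE /= hk.
by rewrite mul1r; congr f; apply/ffunP => k; rewrite !ffunE /= hk ?(subnn, subn0, addn0).
Qed.
End T.

Variable t : 'I_n -> F.
Hypothesis ht : chain Kp (map t (enum 'I_n)).
Lemma t_neq0 j : t j != 0.
Proof. by apply: (chain_neq0 hKp ht); apply: map_f; rewrite mem_enum. Qed.
Let t0 := t_neq0.
Notation rho := (rho_ io t).

(* Evaluating at the monomial of the support whose [I]-part is minimal
   isolates a linear relation between distinct monomials in [t]. *)
Lemma rho_inj (I : {set 'I_n}) (u : S) :
  (forall m, sval u m != 0 -> forall j, j \notin I -> m.2 j = 0%N) ->
  (forall f x, rho (I := I) u f x = 0) -> u = 0.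
Proof.
move=> hu hr; apply: SRP; rewrite sval0; apply: funext => m1; apply/eqP; apply: contraT => hm1.
pose s := [seq m <- undup (supp (sval u)) | sval u m != 0].
have us : uniq s by rewrite filter_uniq // undup_uniq.
have ms m : (m \in s) = (sval u m != 0).
  rewrite mem_filter mem_undup; case: (boolP (sval u m != 0)) => //= h; exact: suppP (SnS u) h.
pose wt (m : mono) := (\sum_(i in I) m.1 i)%N.
have ex : exists k, has (fun m => wt m == k) s.
  by exists (wt m1); apply/hasP; exists m1; rewrite ?ms.
have [k /hasP[m0 hm0 /eqP wm0] kmin] := ex_minnP ex.
have min a : a \in s -> (forall i, i \in I -> (a.1 i <= m0.1 i)%N) -> forall i, i \in I -> a.1 i = m0.1 i.
  move=> ha hle i hi; have h1 : (wt m0 <= wt a)%N.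
    by rewrite wm0; apply: kmin; apply/hasP; exists a.
  move: h1; rewrite /wt (bigD1 i) //= [X in (_ <= X)%N](bigD1 i) //=.
  have := hle i hi; have : (\sum_(j in I | j != i) a.1 j <= \sum_(j in I | j != i) m0.1 j)%N.
    by apply: leq_sum => j /andP[hj _]; apply: hle.
  move=> h1 h2 h3; apply/eqP; rewrite eqn_leq h2 /= -(leq_add2r (\sum_(j in I | j != i) m0.1 j)).
  by apply: leq_trans h3 _; rewrite leq_add2l.
pose x0 : mi I := [ffun k => m0.1 (val k)].
pose f0 (y : mi I) : F := [forall k, y k == m0.2 (val k)]%:R.
pose ok (a : mono) := [forall (i | i \in I), (a.1 i == m0.1 i) && (a.2 i == m0.2 i)].
pose s' := [seq m <- s | ok m].
have key : \sum_(a <- s') io (sval u a) * \prod_(j <- enum 'I_n) t j ^+ a.1 j = 0.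
  transitivity (\prod_(j in I) t j ^+ m0.1 j * rho (I := I) u f0 x0); last by rewrite hr mulr0.
  rewrite /rho_ (@lin_any _ _ _ io _ _ s (SnS u) us); last by move=> a; rewrite ms.
  rewrite big_filter big_mkcond big_distrr /= big_seq [RHS]big_seq; apply: eq_bigr => a ha.
  have ua : sval u a != 0 by rewrite -ms.
  case: ifP => [hok|hok].
    have [e1 e2] : (forall i, i \in I -> a.1 i = m0.1 i) /\ (forall i, i \in I -> a.2 i = m0.2 i).
      by split=> i hi; have := forall_inP hok i hi => /andP[/eqP h1 /eqP h2].
    have -> : lea a x0 by apply/forallP => -[i hi]; rewrite ffunE /= e1.
    have -> : f0 (sh a x0) = 1.
      rewrite /f0; have -> // : [forall k, sh a x0 k == m0.2 (val k)].
      by apply/forallP => -[i hi]; rewrite !ffunE /= e1 // subnn e2.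
    rewrite mulr1 mulrCA; congr (_ * _); rewrite big_enum /= (bigID (mem I)) /=; congr (_ * _).
      by apply: eq_bigr => i hi; rewrite e1.
    by apply: eq_bigr => j hj; rewrite (hu a ua j hj) expr0 divr1.
  case: (boolP (lea a x0)) => [/forallP hle|_]; last by rewrite !mulr0.
  have e1 i : i \in I -> a.1 i = m0.1 i.
    by move: i; apply: min => // i hi; have := hle (exist _ i hi); rewrite ffunE.
  suff -> : f0 (sh a x0) = 0 by rewrite !mulr0.
  rewrite /f0; have -> // : [forall k, sh a x0 k == m0.2 (val k)] = false.
  apply: contraFF hok => /forallP h; apply/forall_inP => i hi; rewrite e1 // eqxx /=.
  by have := h (exist _ i hi); rewrite !ffunE /= e1 // subnn.
have /eqP : io (sval u m0) = 0.
  apply: (@lin_indep _ _ t Kp hKp (enum 'I_n) _ s' (fun a : mono => io (sval u a)) (fun a => a.1) ht) => //.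
  - by rewrite filter_uniq.
  - by move=> a; exists (sval u a).
  - move=> a b; rewrite !mem_filter => /andP[oa ha] /andP[ob hb] h.
    have e1 : a.1 = b.1 by apply/ffunP => i; apply: h; rewrite mem_enum.
    have e2 : a.2 = b.2.
      apply/ffunP => j; case: (boolP (j \in I)) => hj.
        by have /andP[_ /eqP ->] := forall_inP oa j hj; have /andP[_ /eqP ->] := forall_inP ob j hj.
      by case/andP: ha => ha _; case/andP: hb => hb _; rewrite (hu a ha j hj) (hu b hb j hj).
    by case: a b e1 e2 {oa ha ob hb h} => [? ?] [? ?] /= -> ->.
  - rewrite mem_filter hm0 andbT; apply/forall_inP => i hi; rewrite !eqxx //.
by rewrite fmorph_eq0 (negPf (_ : sval u m0 != 0)) // -ms.
Qed.

Lemma faith (u v : S) : (forall f x, rho (I := setT) u f x = rho (I := setT) v f x) -> u = v.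
Proof.
move=> h; apply/eqP; rewrite -subr_eq0; apply/eqP; apply: (@rho_inj setT).
  by move=> m _ j; rewrite inE.
by move=> f x; rewrite rhoB h subrr.
Qed.

Lemma rho_fC_T D I f x : rho (I := setT) (fC D I) f x =
  if [forall k : ix setT, (val k \notin I) ==> (D <= x k)%N] then f x else 0.
Proof.
rewrite /fC monS_mul rho_mon.
have -> : tw t setT (mmul (dC D I, d0) (d0, dC D I)) = 1.
  by rewrite /tw big1 // => j; rewrite inE.
rewrite mul1r.
have -> : lea (mmul (dC D I, d0) (d0, dC D I)) x = [forall k : ix setT, (val k \notin I) ==> (D <= x k)%N].
  apply: eq_forallb => k; rewrite !ffunE /=; case: ifP => _ /=; rewrite ?(addn0, sub0n, subn0) //.
case: ifP => // /forallP h; congr f; apply/ffunP => k; have := h k; rewrite !ffunE /=.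
by case: ifP => _ /=; rewrite ?(subnn, subn0, addn0, add0n) // => h'; rewrite subnK.
Qed.

(** Every point of $\mathbb N^n$ singles out one subset, that of its coordinates below [D], and only
    the corresponding term acts on it. *)
Lemma unity D : \sum_(I : {set 'I_n}) EE D (enum I) * fC D I = 1.
Proof.
apply: faith => f x; rewrite rho1 rho_suml.
pose kk (i : 'I_n) : ix setT := exist _ i (in_setT i).
pose I0 : {set 'I_n} := [set i | (x (kk i) < D)%N].
have kkE (k : ix setT) : kk (val k) = k by apply: val_inj.
rewrite (bigD1 I0) //= big1 ?addr0.
  rewrite rhoM // (rho_EE_in t0); last by move=> i; rewrite inE.
  have -> : [forall k : ix setT, (val k \in enum I0) ==> (x k < D)%N].
    by apply/forallP => k; apply/implyP; rewrite mem_enum inE kkE.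
  rewrite rho_fC_T.
  have -> // : [forall k : ix setT, (val k \notin I0) ==> (D <= x k)%N].
  by apply/forallP => k; apply/implyP; rewrite inE kkE -leqNgt.
move=> I hI; rewrite rhoM // (rho_EE_in t0); last by move=> i; rewrite inE.
case: ifP => // /forallP h1; rewrite rho_fC_T; case: ifP => // /forallP h2.
case/eqP: hI; apply/setP => i; rewrite inE.
have := h1 (kk i); have := h2 (kk i); rewrite mem_enum /=.
by case: (i \in I) => /=; [move=> _ ->|rewrite leqNgt => /negPf ->].
Qed.

(** Right multiplication by [Xc] cancels every power of $y_j$ with [j] outside [I], since these are
    at most [D]; the result satisfies the hypothesis of [rho_inj]. *)
Lemma kill D I (w : S) : bnd D w -> (forall f x, rho (I := I) w f x = 0) -> w * (EE D (enum I) * fC D I) = 0.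
Proof.
move=> hb hr; rewrite /fC !mulrA.
suff -> : w * EE D (enum I) * Xc D I = 0 by rewrite mul0r.
apply: (@rho_inj I) => [m|f x]; last by rewrite -mulrA rhoM.
rewrite svalM => /(mul_supp (SnS _) (SnS _)) [a [b [ha hb' ->]]] j hj.
move: ha; rewrite svalM => /(mul_supp (SnS _) (SnS _)) [a1 [a2 [h1 h2 ->]]].
have [e1 e2] : a2.1 j = 0%N /\ a2.2 j = 0%N by apply: (supp_EE h2); rewrite mem_enum.
have [_ h3] := hb _ h1 j.
move: hb'; rewrite /Xc /= /mon; case: (b =P (_, _)) => [-> _|_]; last by rewrite eqxx.
by rewrite !ffunE /= (negPf hj) e1 e2 subn0 !addn0; apply/eqP; rewrite subn_eq0.
Qed.

Lemma decomp D (w : S) : w = \sum_(I : {set 'I_n}) w * (EE D (enum I) * fC D I).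
Proof. by rewrite -big_distrr /= unity mulr1. Qed.

(** In [decomp] the proper subsets of [J] are removed by [kill], and subsets not inside [J] act as
    0. As [kill] is an identity of the ring, the conclusion holds at every invertible specialisation
    [t'], which the index computation exploits. *)
Lemma fin_col (t' : 'I_n -> F) D (J : {set 'I_n}) (w : S) f x : (forall j, t' j != 0) -> bnd D w ->
  (forall I : {set 'I_n}, I \proper J -> forall f x, rho (I := I) w f x = 0) ->
  rho_ io t' (I := J) w f x = rho_ io t' (I := J) w (fun y => if box D y then f y else 0) x.
Proof.
move=> t'0 hb hr; rewrite {1}(decomp D w) rho_suml (bigD1 J) //= big1 ?addr0.
  rewrite rhoM //; apply: eq_rho => y; rewrite rhoM // (rho_EE_in t'0); last by move=> i; rewrite mem_enum.
  rewrite rho_fC // /box; congr (if _ then _ else _); apply: eq_forallb => k.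
  by rewrite mem_enum (valP k).
move=> I hI; case: (boolP (I \subset J)) => hs.
  by rewrite kill ?rho0 //; apply: hr; rewrite properEneq hI hs.
case/subsetPn: hs => i iI iJ; rewrite rhoM //.
rewrite (_ : rho_ io t' _ f = fun _ => 0) ?rho_zf //; apply: funext => y.
by rewrite rhoM // (@rho_EE_out t' t'0 J D (enum I) _ _ i) // mem_enum.
Qed.

(** Monomials with exponents at most [D] lower a coordinate by at most [D], so a point outside the
    double box cannot reach the box. *)
Lemma fin_row (t' : 'I_n -> F) D (J : {set 'I_n}) (w : S) f x : bnd D w -> ~~ box (D + D) x ->
  rho_ io t' (I := J) w (fun y => if box D y then f y else 0) x = 0.
Proof.
move=> hb /forallPn[k]; rewrite -leqNgt => hk; rewrite /rho_ /lin big1 // => a _.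
have [->|ha] := eqVneq (sval w a) 0; first by rewrite rmorph0 mul0r.
case: ifP => // _; last by rewrite !mulr0.
have -> : box D (sh a x) = false; last by rewrite !mulr0.
apply/negbTE/forallPn; exists k; rewrite -leqNgt ffunE.
by have [h1 h2] := hb a ha (val k); lia.
Qed.
End Unity.

(** * The ideals $\mathfrak p_n$, $\mathfrak a_{n,s}$ and $F_n$ as kernels *)

Section Mem.
Variable t : 'I_n -> F.
Hypothesis ht : chain Kp (map t (enum 'I_n)).
Let t0 := t_neq0 ht.
Notation rho := (rho_ io t).
Notation ker I w := (forall f x, rho (I := I) w f x = 0).

Lemma idealg_ker (i : 'I_n) (I : {set 'I_n}) h : i \notin I -> @p_ K n i h -> exists w : S, sval w = h /\ ker I w.
Proof.
move=> hi; elim=> [|f a b hf [w [ew hw]] ha hb]; first by exists 0; split=> // f x; rewrite rho0.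
exists (w + (exist _ a ha : S) * Es K 0 0 i * (exist _ b hb : S)); split.
  by rewrite svalD !svalM /= ew /eg Est_sval.
move=> g x; rewrite rhoD hw add0r !rhoM //.
rewrite (_ : rho (Es K 0 0 i) _ = fun _ => 0) ?rho_zf //; apply: funext => y; exact: rho_Es_out.
Qed.
Lemma idprod_ker I (A B : elem K n -> Prop) h :
  ((forall h, A h -> exists w : S, sval w = h) /\ (forall h, B h -> exists w : S, sval w = h)) ->
  ((forall h, A h -> exists w : S, sval w = h /\ ker I w) \/ (forall h, B h -> exists w : S, sval w = h /\ ker I w)) ->
  idprod A B h -> exists w : S, sval w = h /\ ker I w.
Proof.
move=> [hA hB] hAB; elim=> [|f a b hf [w [ew hw]] ha hb]; first by exists 0; split=> // f x; rewrite rho0.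
case: hAB => hh.
  have [u [eu hu]] := hh a ha; have [v ev] := hB b hb; exists (w + u * v); split.
    by rewrite svalD svalM ew eu ev.
  by move=> g x; rewrite rhoD hw add0r rhoM.
have [u eu] := hA a ha; have [v [ev hv]] := hh b hb; exists (w + u * v); split.
  by rewrite svalD svalM ew eu ev.
move=> g x; rewrite rhoD hw add0r rhoM //.
by rewrite (_ : rho v g = fun _ => 0) ?rho_zf //; apply: funext.
Qed.
Lemma p_sval (i : 'I_n) h : @p_ K n i h -> exists w : S, sval w = h.
Proof.
have i0 : i \notin (set0 : {set 'I_n}) by rewrite inE.
by move=> /(idealg_ker i0)[w [e _]]; exists w.
Qed.
Lemma idprod_sval (A B : elem K n -> Prop) h :
  (forall h, A h -> exists w : S, sval w = h) -> (forall h, B h -> exists w : S, sval w = h) ->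
  idprod A B h -> exists w : S, sval w = h.
Proof.
move=> hA hB; elim=> [|f a b hf [w ew] ha hb]; first by exists 0.
have [u eu] := hA a ha; have [v ev] := hB b hb; exists (w + u * v).
by rewrite svalD svalM ew eu ev.
Qed.
Definition pl (l : seq 'I_n) : elem K n -> Prop := foldr (fun i acc => idprod (p_ (val i)) acc) (@Sn K n) l.
Lemma pl_sval l h : pl l h -> exists w : S, sval w = h.
Proof.
elim: l h => [|i l IH] h /=; first by move=> hh; exists (exist _ h hh).
by apply: idprod_sval => // h'; apply: p_sval.
Qed.
Lemma pl_ker l (I : {set 'I_n}) h i : i \in l -> i \notin I -> pl l h -> exists w : S, sval w = h /\ ker I w.
Proof.
move=> + hi; elim: l h => [|j l IH] h //=; rewrite inE => /orP[/eqP <-|hl].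
  apply: idprod_ker; first by split=> h'; [apply: p_sval|apply: pl_sval].
  by left=> h'; apply: idealg_ker.
apply: idprod_ker; first by split=> h'; [apply: p_sval|apply: pl_sval].
by right=> h'; apply: IH.
Qed.
Lemma asum_ker s (I : {set 'I_n}) h : (#|I| < s)%N -> @asum K n s h -> exists w : S, sval w = h /\ ker I w.
Proof.
move=> hI; elim=> [|f J a hf [w [ew hw]] hJ ha]; first by exists 0; split=> // f x; rewrite rho0.
have /subsetPn[i iJ iI] : ~~ (J \subset I).
  by apply: contraL hI => /subset_leq_card; rewrite hJ -leqNgt.
have iJ' : i \in enum J by rewrite mem_enum.
have [v [ev hv]] := pl_ker iJ' iI ha.
exists (w + v); split; first by rewrite svalD ew ev.
by move=> g x; rewrite rhoD hw hv addr0.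
Qed.
Lemma Fn_ker (I : {set 'I_n}) h : I != setT -> @Fn K n h -> exists w : S, sval w = h /\ ker I w.
Proof.
move=> hI hh; have /subsetPn[i iT iI] : ~~ ([set: 'I_n] \subset I) by rewrite subTset.
by apply: (@pl_ker (enum setT) I h i) => //; rewrite mem_enum.
Qed.

(** $1-x^Dy^D$ telescopes into the sum of $x^key^k$ over $k<D$. *)
Lemma ideal_gS D (i : 'I_n) (v c : S) : @p_ K n i (sval (v * gS D i * c)).
Proof.
have tel : gS D i = \sum_(k < D) XS K i ^+ k * Es K 0 0 i * YS K i ^+ k.
  rewrite /gS; elim: D => [|D IH]; first by rewrite big_ord0 !expr0 mulr1 subrr.
  have e : XS K i ^+ D * Es K 0 0 i * YS K i ^+ D = XS K i ^+ D * YS K i ^+ D - XS K i ^+ D.+1 * YS K i ^+ D.+1.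
    rewrite /Es !expr0 !expr1 mulr1 mulrBr mulr1 mulrBl; congr (_ - _).
    by rewrite mulrA -exprSr -mulrA -exprS.
  by rewrite big_ord_recr /= -IH e addrA subrK.
rewrite tel big_distrr big_distrl /=; elim: D {tel} => [|D IH].
  by rewrite big_ord0; apply: ig0.
have E : eg K i = sval (Es K 0 0 i) by rewrite /eg Est_sval.
have -> : \sum_(k < D.+1) v * (XS K i ^+ k * Es K 0 0 i * YS K i ^+ k) * c =
  \sum_(k < D) v * (XS K i ^+ k * Es K 0 0 i * YS K i ^+ k) * c + (v * XS K i ^+ D) * Es K 0 0 i * (YS K i ^+ D * c).
  by rewrite big_ord_recr /= !mulrA.
rewrite svalD.
change (sval (v * XS K i ^+ D * Es K 0 0 i * (YS K i ^+ D * c))) with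
  (mul (mul (sval (v * XS K i ^+ D)) (sval (Es K 0 0 i))) (sval (YS K i ^+ D * c))).
by rewrite -E; apply: igS => //; apply: SnS.
Qed.
Lemma pl_mem D l (v c : S) : pl l (sval (v * EE D l * c)).
Proof.
elim: l v c => [|i l IH] v c; first exact: (SnS (v * EE D [::] * c)).
change (idprod (p_ (val i)) (pl l) (sval (v * EE D (i :: l) * c))).
rewrite /EE big_cons -/(EE D l).
have -> : v * (gS D i * EE D l) * c = 0 + (v * gS D i * 1) * (1 * EE D l * c) by rewrite add0r mulr1 mul1r !mulrA.
rewrite svalD svalM; apply: ipS; [exact: ip0|exact: ideal_gS|exact: IH].
Qed.
Lemma idealg_add g f f' : idealg g f -> @idealg K n g f' -> idealg g (add f f').
Proof.
move=> hf; elim=> [|h a b _ IH ha hb].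
  by rewrite (_ : add f _ = f) //; apply: funext => m; rewrite /add /zero addr0.
rewrite (_ : add f _ = add (add f h) (mul (mul a g) b)); first exact: igS.
by apply: funext => m; rewrite /add addrA.
Qed.
Lemma EE_eq D l l1 l2 : (forall i, (i \in l) = (i \in l1) || (i \in l2)) -> EE D l = EE D l1 * EE D l2.
Proof.
move=> hl; apply: (faith ht) => f x.
have hT (r : seq 'I_n) : {subset r <= [set: 'I_n]} by move=> i; rewrite inE.
rewrite rhoM // !(rho_EE_in t0) //.
have -> : [forall k : ix [set: 'I_n], (val k \in l) ==> (x k < D)%N] =
  [forall k : ix [set: 'I_n], (val k \in l1) ==> (x k < D)%N] && [forall k : ix [set: 'I_n], (val k \in l2) ==> (x k < D)%N].
  apply/forallP/andP => [h|[/forallP h1 /forallP h2] k].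
    by split; apply/forallP => k; apply/implyP => hk; have := h k; rewrite hl hk ?orbT.
  by apply/implyP; rewrite hl => /orP[hk|hk]; [have := h1 k|have := h2 k]; rewrite hk.
by case: [forall k : ix [set: 'I_n], (val k \in l1) ==> (x k < D)%N].
Qed.
Lemma p_mem (i : 'I_n) (w : S) : (forall I : {set 'I_n}, i \notin I -> ker I w) -> @p_ K n i (sval w).
Proof.
move=> hw; have [D hD] := bnd_ex w; rewrite (decomp ht D w).
apply: (big_ind (fun v : S => @p_ K n i (sval v))) => [|u v|I _]; first exact: ig0.
  by rewrite svalD; apply: idealg_add.
case: (boolP (i \in I)) => hi; last by rewrite (kill ht) //; [apply: ig0|apply: hw].
rewrite (@EE_eq D (enum I) (enum (I :\ i)) [:: i]); last first.
  by move=> j; rewrite !mem_enum !inE; case: eqP => [->|_]; rewrite ?hi ?orbF.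
rewrite /EE big_seq1 !mulrA -mulrA; have := ideal_gS D i (w * EE D (enum (I :\ i))) (fC D I).
by rewrite /EE !mulrA.
Qed.
Lemma asum_mem s (w : S) : (forall I : {set 'I_n}, (#|I| < s)%N -> ker I w) -> @asum K n s (sval w).
Proof.
move=> hw; have [D hD] := bnd_ex w; rewrite (decomp ht D w).
elim: (index_enum _) => [|I r IH]; first by rewrite big_nil; apply: as0.
rewrite big_cons addrC svalD.
have [hI|hI] := ltnP #|I| s.
  rewrite (kill ht) //; last exact: hw.
  by rewrite (_ : add _ _ = sval (\sum_(j <- r) w * (EE D (enum j) * fC D j))) //; apply: funext => m; rewrite /add /= /zero addr0.
(* The ideal is a sum over subsets of exactly [s] elements, so [s] elements of [I] are singled out
   and the remaining factors join the coefficient. *)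
pose I0 := [set x in take s (enum I)].
have cI0 : #|I0| = s.
  rewrite cardsE (card_uniqP _) ?size_takel // -?cardE //; exact: take_uniq (enum_uniq _).
have sI0 : I0 \subset I by apply/subsetP => x; rewrite inE => /mem_take; rewrite mem_enum.
apply: (asS (I := I0)) => //.
rewrite (@EE_eq D (enum I) (enum (I :\: I0)) (enum I0)); last first.
  move=> j; rewrite !mem_enum in_setD; have := subsetP sI0 j; by case: (j \in I0) => [/(_ isT) ->|_]; rewrite //= orbF.
by have := pl_mem D (enum I0) (w * EE D (enum (I :\: I0))) (fC D I); rewrite -!mulrA.
Qed.
Lemma Fn_mem (w : S) : (forall I : {set 'I_n}, I != setT -> ker I w) -> @Fn K n (sval w).
Proof.
move=> hw; have [D hD] := bnd_ex w.
have e : w = w * EE D (enum [set: 'I_n]) * fC D [set: 'I_n].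
  rewrite {1}(decomp ht D w) (bigD1 setT) //= big1 ?addr0 ?mulrA // => I hI.
  by rewrite (kill ht) //; apply: hw.
by rewrite e; apply: pl_mem.
Qed.
End Mem.
End Ideals.

(** * Reduction of units *)

Section Reduction.
Import GRing.Theory.
Local Open Scope ring_scope.
Variables (K F : fieldType) (n : nat) (io : {rmorphism K -> F}).
Notation S := (SR K n).
Notation mono := (mono n).
Notation Kp := (Kp io).
Variable t : 'I_n -> F.
Hypothesis ht : chain Kp (map t (enum 'I_n)).
Let t0 := t_neq0 ht.
Let hKp : sring Kp. Proof. by case: (Kp_sfield io). Qed.
Notation rho := (rho_ io t).
Implicit Types (I J : {set 'I_n}) (u v g : S).

Definition uS u := exists v, u * v = 1 /\ v * u = 1.
Lemma uSM u v : uS u -> uS v -> uS (u * v).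
Proof.
move=> [u' [h1 h2]] [v' [h3 h4]]; exists (v' * u'); split.
  by rewrite mulrA -[X in X * _]mulrA h3 mulr1 h1.
by rewrite mulrA -[X in X * _]mulrA h2 mulr1 h4.
Qed.
Lemma uS1 : uS 1. Proof. by exists 1; rewrite mulr1. Qed.
Lemma isunitE u : isunit (sval u) <-> uS u.
Proof.
split=> [[_ [h [hh [h1 h2]]]]|[v [h1 h2]]].
  by exists (exist _ h hh : S); split; apply: SRP.
by split; [exact: SnS|exists (sval v); split; [exact: SnS|rewrite -!svalM h1 h2]].
Qed.

Definition idl I u := forall f x, rho (I := I) u f x = f x.
Lemma idlM I u v : idl I u -> idl I v -> idl I (u * v).
Proof. by move=> hu hv f x; rewrite rhoM // hu hv. Qed.
Lemma idl1 I : idl I 1. Proof. by move=> f x; rewrite rho1. Qed.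
Lemma idlV I u v : u * v = 1 -> v * u = 1 -> idl I u -> idl I v.
Proof. by move=> h1 h2 hu f x; rewrite -[RHS](rho1 io t f x) -h1 rhoM // hu. Qed.

(** The generators of [Einf] take multi-indices on all variables; outside [I] the value 0 is mere
    filler. *)
Definition e0 I (x : mi I) (i : 'I_n) : nat := if insub i is Some k then x k else 0%N.
Lemma e0E I (x : mi I) (k : ix I) : e0 x (val k) = x k.
Proof. by rewrite /e0 valK. Qed.
Definition EA (A B : 'I_n -> nat) I : S := \prod_(i in I) Es K (A i) (B i) i.

Lemma EA_enum A B I : EA A B I = \prod_(i <- enum I) Es K (A i) (B i) i.
Proof. by rewrite /EA -big_filter deprecated_filter_index_enum. Qed.
Lemma rho_EA_in A B I J f x : I \subset J -> rho (I := J) (EA A B I) f x =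
  if mat (I := J) (enum I) A x then f (upl (enum I) B x) else 0.
Proof.
move=> /subsetP h; rewrite EA_enum rho_prodE_in ?enum_uniq //.
by move=> i; rewrite mem_enum; apply: h.
Qed.
Lemma rho_EA_out A B I J f x : ~~ (I \subset J) -> rho (I := J) (EA A B I) f x = 0.
Proof.
by move=> /subsetPn[i iI iJ]; rewrite EA_enum (@rho_prodE_out _ _ _ io t t0 J _ A B f x i) // mem_enum.
Qed.
Lemma rho_EA A B I f (x : mi I) : rho (EA A B I) f x =
  if x == [ffun k => A (val k)] then f [ffun k => B (val k)] else 0.
Proof.
rewrite rho_EA_in //.
have -> : mat (I := I) (enum I) A x = (x == [ffun k => A (val k)]).
  apply/forallP/eqP => [h|-> k]; last by rewrite ffunE eqxx implybT.
  by apply/ffunP => k; rewrite ffunE; have := h k; rewrite mem_enum (valP k) => /eqP.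
by case: ifP => // _; congr f; apply/ffunP => k; rewrite !ffunE mem_enum (valP k).
Qed.
Lemma rho_Exy I (a b : mi I) f x : rho (EA (e0 a) (e0 b) I) f x = if x == a then f b else 0.
Proof.
rewrite rho_EA; have E (c : mi I) : [ffun k : ix I => e0 c (val k)] = c by apply/ffunP => k; rewrite ffunE e0E.
by rewrite !E.
Qed.
Lemma EA_mul A B A' B' I : EA A B I * EA A' B' I =
  if [forall (i | i \in I), B i == A' i] then EA A B' I else 0.
Proof.
apply: (faith ht) => f x; rewrite rhoM // rho_EA_in ?subsetT // rho_EA_in ?subsetT //; set b := [forall (_ | _), _].
have -> : mat (I := setT) (enum I) A' (upl (enum I) B x) = b.
  rewrite /b; apply/forallP/forall_inP => [h i hi|h k].
    by have := h (exist _ i (in_setT i)); rewrite ffunE /= mem_enum hi.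
  by apply/implyP => hk; rewrite ffunE hk; apply: h; rewrite -mem_enum.
case: b; last by rewrite rho0; case: ifP.
rewrite rho_EA_in ?subsetT //; case: ifP => // _; congr f; apply/ffunP => k; rewrite !ffunE.
by case: (val k \in enum I).
Qed.

Section Scalars.
Variable I : {set 'I_n}.
Definition LI := laur Kp (map t (enum (~: I))).
Lemma LI_sring : sring LI. Proof. exact: laur_sring. Qed.
Lemma LI_chain : chain Kp (map t (enum (~: I))).
Proof. by apply: (chain_subseq hKp ht); rewrite enumT; apply: filter_subseq. Qed.
Lemma LI_t j : j \notin I -> LI (t j) /\ LI (t j)^-1.
Proof. by move=> hj; apply: laur_gen => //; apply: map_f; rewrite mem_enum inE. Qed.
Lemma LI_tw a : LI (tw t I a).
Proof.
apply: (sring_prod LI_sring) => j hj; have [h1 h2] := LI_t hj.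
by apply: (sringM LI_sring); rewrite -?exprVn; apply: sringX => //; exact: LI_sring.
Qed.
Lemma LI_rho u f x : (forall y, LI (f y)) -> LI (rho (I := I) u f x).
Proof.
move=> hf; apply: (sring_sum LI_sring) => a _; apply: (sringM LI_sring).
  by apply: laur_base => //; exists (sval u a).
by apply: (sringM LI_sring); [apply: LI_tw|case: ifP => // _; apply: (sring0 LI_sring)].
Qed.

Lemma SC_S h : SC I h -> exists a : S, sval a = h /\
  forall i s r, i \in I -> a * Es K s r i = Es K s r i * a.
Proof.
elim=> [g [j [hj hg]]||c f _ [a [<- ha]]|f g _ [a [<- ha]] _ [b [<- hb]]|f g _ [a [<- ha]] _ [b [<- hb]]].
- have ij i : i \in I -> i != j by move=> hi; apply: contraNneq hj => <-.
  have com (m : mono) i s r : (forall k, k != j -> m.1 k = 0%N /\ m.2 k = 0%N) -> i \in I ->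
      monS K m * Es K s r i = Es K s r i * monS K m.
    move=> hm hi; rewrite /Es mulrBl mulrBr !XYn; congr (_ - _); apply: mon_comm => k.
      have [->|hk] := eqVneq k j; first by right; rewrite !ffunE eq_sym (negPf (ij i hi)).
      by left; apply: hm.
    have [->|hk] := eqVneq k j; first by right; rewrite !ffunE eq_sym (negPf (ij i hi)).
    by left; apply: hm.
  case: hg => ->; [exists (XS K j)|exists (YS K j)]; rewrite ?xg_sval ?yg_sval; split=> // i s r hi;
    by apply: com => // k hk; rewrite !ffunE (negPf hk).
- by exists 1; split=> // i s r _; rewrite mulr1 mul1r.
- exists (scaleS c a); split=> // i s r hi; rewrite scaleSE -mulrA ha // mulrA scaleS_comm.
  by rewrite -mulrA.
- by exists (a + b); split=> // i s r hi; rewrite mulrDl [RHS]mulrDr ha // hb.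
- by exists (a * b); split=> // i s r hi; rewrite -mulrA hb // mulrA ha // mulrA.
Qed.
Lemma SC_comm (a : S) A B : SC I (sval a) -> a * EA A B I = EA A B I * a.
Proof.
case/SC_S => b [/SRP -> hb]; rewrite /EA; elim/big_rec: _ => [|i z hi IH]; first by rewrite mulr1 mul1r.
by rewrite mulrA hb // -mulrA IH mulrA.
Qed.
Lemma SC_X j : j \notin I -> SC I (sval (XS K j)).
Proof. by move=> hj; rewrite -xg_sval; apply: sa_gen; exists j; split=> //; left. Qed.
Lemma SC_Y j : j \notin I -> SC I (sval (YS K j)).
Proof. by move=> hj; rewrite -yg_sval; apply: sa_gen; exists j; split=> //; right. Qed.
Lemma SC_scale c : SC I (sval (scaleS c (1 : S))).
Proof. by apply: sa_scale; apply: sa_one. Qed.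
Lemma SCM (a b : S) : SC I (sval a) -> SC I (sval b) -> SC I (sval (a * b)).
Proof. exact: sa_mul. Qed.
Lemma SCN (a : S) : SC I (sval a) -> SC I (sval (- a)).
Proof. by move=> h; rewrite svalN opp_scale; apply: sa_scale. Qed.
Lemma SCD (a b : S) : SC I (sval a) -> SC I (sval b) -> SC I (sval (a + b)).
Proof. exact: sa_add. Qed.

(** The coefficient ring is generated by constants and by $t_j^{\pm1}$ for [j] outside [I], which
    are the actions of $x_j$ and $y_j$. *)
Lemma lift_scalar c : LI c -> exists a : S, SC I (sval a) /\ forall f x, rho (I := I) a f x = c * f x.
Proof.
apply: (@laur_min _ Kp (fun c => exists a : S, SC I (sval a) /\ forall f x, rho (I := I) a f x = c * f x)).
- split.
  + by exists 1; split; [exact: sa_one|move=> f x; rewrite rho1 mul1r].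
  + move=> x y [a [h1 h2]] [b [h3 h4]]; exists (a - b); split; first by apply: SCD => //; apply: SCN.
    by move=> f z; rewrite rhoB h2 h4 mulrBl.
  + move=> x y [a [h1 h2]] [b [h3 h4]]; exists (a * b); split; first exact: SCM.
    by move=> f z; rewrite rhoM // h2 h4 mulrA.
- move=> x [k ->]; exists (scaleS k 1); split; first exact: SC_scale.
  by move=> f z; rewrite rho_scale rho1.
- move=> y /mapP[j]; rewrite mem_enum inE => hj ->; split=> //.
    exists (XS K j); split; first exact: SC_X.
    move=> f x; have := @rho_XY_out _ _ _ io t I j 1 0 f x hj.
    by rewrite !expr1 !expr0 mulr1 divr1.
  exists (YS K j); split; first exact: SC_Y.
  move=> f x; have := @rho_XY_out _ _ _ io t I j 0 1 f x hj.
  by rewrite !expr1 !expr0 !mul1r.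
Qed.

Lemma gen_sq (a : S) A B : SC I (sval a) -> (exists i, i \in I /\ A i <> B i) -> a * EA A B I * (a * EA A B I) = 0.
Proof.
move=> ha [i [hi hAB]]; rewrite mulrA -[X in X * _]mulrA -SC_comm // mulrA -mulrA EA_mul.
case: ifP => [/forall_inP h|_]; last by rewrite mulr0.
by case: hAB; apply/esym/eqP/h.
Qed.
Lemma gen_inv (a : S) A B : SC I (sval a) -> (exists i, i \in I /\ A i <> B i) ->
  (1 + a * EA A B I) * (1 - a * EA A B I) = 1 /\ (1 - a * EA A B I) * (1 + a * EA A B I) = 1.
Proof.
move=> ha hAB; have Z2 := gen_sq ha hAB; set Z := a * EA A B I in Z2 *.
by split; rewrite mulrDl mul1r mulrDr mulr1 ?mulrN ?mulNr Z2 ?oppr0 addr0 ?subrK ?addrK // addrK.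
Qed.
Lemma gen_Einf (a : S) A B : SC I (sval a) -> (exists i, i \in I /\ A i <> B i) -> Einf I (sval (1 + a * EA A B I)).
Proof.
move=> ha h; rewrite -[X in Einf I (sval X)]mulr1; apply: ggg; last exact: gg1.
by exists (sval a), A, B; split=> //; split=> //; rewrite EI_sval.
Qed.
Lemma Einf_Sn (h : elem K n) : Einf I h -> Sn h.
Proof.
elim=> [|a b [a' [A [B [ha' [hAB ->]]]]] _ hb|a ai b _ hai _ _ _ hb]; [exact: Sn_one| |exact: Sn_mul].
apply: Sn_mul => //; have [a1 [<- _]] := SC_S ha'.
by rewrite EI_sval -svalM -sval1 -svalD; apply: SnS.
Qed.
Lemma Einf_mul g h : Einf I (sval g) -> Einf I (sval h) -> Einf I (sval (g * h)).
Proof.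
rewrite /Einf svalM => hg hh.
elim: hg => [|a b Ga /Einf_Sn hb IH|a ai b Ga hai h1 h2 /Einf_Sn hb IH].
- by rewrite -sval1 -svalM mul1r.
- case: Ga => a' [A [B [ha' [hAB ->]]]]; have [a1 [ea1 _]] := SC_S ha'.
  have SnA : Sn (add (@one K n) (mul a' (EI K A B I))).
    by rewrite -ea1 EI_sval -svalM -sval1 -svalD; apply: SnS.
  have Gb : mul (mul (add (@one K n) (mul a' (EI K A B I))) b) (sval h) = mul (add (@one K n) (mul a' (EI K A B I))) (mul b (sval h)).
    by have := congr1 sval (mulrA (exist _ _ SnA : S) (exist _ b hb : S) h) => /= ->.
  by rewrite Gb; apply: ggg => //; exists a', A, B.
- have -> : mul (mul ai b) (sval h) = mul ai (mul b (sval h)).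
    by have := congr1 sval (mulrA (exist _ _ hai : S) (exist _ b hb : S) h) => /= ->.
  by apply: (ggi Ga).
Qed.
End Scalars.

(** * Operators given by finite matrices *)

Section Rep.
Variable I : {set 'I_n}.
Notation rho := (rho_ io t (I := I)).
(** The matrix governs the points [p], and the operator is the identity elsewhere. [r] is an
    arbitrary operator, so that diagonal ones such as [dOp] are covered along with ring elements. *)
Definition rep (X : finType) (p : X -> mi I) (r : (mi I -> F) -> mi I -> F) (M : sqm F X) :=
  (forall f b, r f (p b) = \sum_c M b c * f (p c)) /\ (forall f x, (forall b, p b <> x) -> r f x = f x).

Section X.
Variables (X : finType) (p : X -> mi I).
Hypothesis pi : injective p.
Lemma rep_comp (r r' : (mi I -> F) -> mi I -> F) M N : rep p r M -> rep p r' N -> rep p (fun f => r (r' f)) (M * N).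
Proof.
move=> [h1 h2] [h3 h4]; split=> [f b|f x hx]; last by rewrite h2 // h4.
rewrite h1; under eq_bigr do rewrite h3 big_distrr /=.
rewrite exchange_big /=; apply: eq_bigr => c _; rewrite sqm_mulE big_distrl /=.
by apply: eq_bigr => d _; rewrite mulrA.
Qed.
Lemma rep_mul u v M N : rep p (rho u) M -> rep p (rho v) N -> rep p (rho (u * v)) (M * N).
Proof.
move=> h h'; have [h1 h2] := rep_comp h h'; split=> [f b|f x hx].
  by rewrite rhoM //; apply: h1.
by rewrite rhoM //; apply: h2.
Qed.
Lemma rep_over u M : rep p (rho u) M -> over (LI I) M.
Proof.
move=> [h _] b c; have := h (fun y => (y == p c)%:R) b; rewrite (bigD1 c) //= eqxx mulr1 big1 ?addr0.
  by move=> <-; apply: LI_rho => y; apply: (sring_nat (LI_sring I)).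
by move=> d hd; rewrite (inj_eq pi) (negPf hd) mulr0.
Qed.
Lemma rep_eq r r' M : rep p r M -> rep p r' M -> forall f x, r f x = r' f x.
Proof.
move=> [h1 h2] [h3 h4] f x; case: (pselect (exists b, p b = x)) => [[b <-]|h]; first by rewrite h1 h3.
by rewrite h2 ?h4 // => b e; apply: h; exists b.
Qed.
Lemma rep_inj r M N : rep p r M -> rep p r N -> M = N.
Proof.
move=> [h1 _] [h3 _]; apply: sqmP => b c.
have := h1 (fun y => (y == p c)%:R) b; rewrite h3 (bigD1 c) //= eqxx mulr1 big1 ?addr0; last first.
  by move=> d hd; rewrite (inj_eq pi) (negPf hd) mulr0.
rewrite (bigD1 c) //= eqxx mulr1 big1 ?addr0 // => d hd.
by rewrite (inj_eq pi) (negPf hd) mulr0.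
Qed.
Lemma rep1 : rep p (rho 1) 1.
Proof.
split=> [f b|f x _]; last by rewrite rho1.
rewrite rho1 (bigD1 b) //= sqmE eqxx mul1r big1 ?addr0 // => c hc.
by rewrite sqmE eq_sym (negPf hc) mul0r.
Qed.
Lemma rep_de r b c k : (forall f x, r f x = f x + (x == p b)%:R * (k * f (p c))) -> rep p r (1 + de b c k).
Proof.
move=> h; split=> [f d|f x hx]; last first.
  by rewrite h (_ : (x == p b) = false) ?mul0r ?addr0 //; apply/eqP => e; apply: (hx b).
rewrite h (inj_eq pi); under eq_bigr do rewrite sqmE mulrDl.
rewrite big_split /= (bigD1 d) //= sqmE eqxx mul1r [X in _ + X + _]big1 ?addr0; last first.
  by move=> z hz; rewrite sqmE eq_sym (negPf hz) mul0r.
congr (_ + _); rewrite (bigD1 c) //= /de eqxx andbT mulrA big1 ?addr0 // => z hz.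
by rewrite (negPf hz) andbF !mul0r.
Qed.
End X.
Lemma rep_ext (X Y : finType) (p : X -> mi I) (q : Y -> mi I) (h : X -> Y) r M : injective h -> injective q -> (forall b, q (h b) = p b) ->
  rep p r M -> rep q r (ext h M).
Proof.
move=> hi qi hq [h1 h2]; split=> [f y|f x hx]; last first.
  by apply: h2 => b e; apply: (hx (h b)); rewrite hq.
have [[b ->]|hy] := in_img h y.
  rewrite hq h1 [RHS](bigID (fun k => [exists x, h x == k])) /= [X in _ = _ + X]big1 ?addr0; last first.
    move=> k /existsPn hk; rewrite ext_out; last by right => z; apply/eqP/hk.
    by case: eqP => [e|_]; [have := hk b; rewrite e eqxx|rewrite mul0r].
  rewrite (reindex_omap h (fun k => [pick x | h x == k])) /=.
    apply: eq_big => [x|x _]; last by rewrite extf // hq.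
    case: pickP => [z /eqP/hi ->|/(_ x)]; rewrite ?eqxx ?andbT //.
    by apply/esym/existsP; exists x.
  move=> k /existsP[x /eqP <-]; case: pickP => [z /eqP /hi -> //|/(_ x)].
  by rewrite eqxx.
rewrite h2; last by move=> b e; apply: (hy b); apply: qi; rewrite hq.
rewrite (bigD1 y) //= ext_out ?eqxx ?mul1r; last by left.
rewrite big1 ?addr0 // => z hz; rewrite ext_out; last by left.
by rewrite eq_sym (negPf hz) mul0r.
Qed.

Definition bx D := {ffun ix I -> 'I_D}.
Definition bp D (b : bx D) : mi I := [ffun k => val (b k)].
Lemma bp_inj D : injective (@bp D).
Proof.
move=> b c e; apply/ffunP => k; apply: val_inj.
by have := congr1 (fun f : mi I => f k) e; rewrite !ffunE.
Qed.
Lemma bp_box D (x : mi I) : box D x <-> exists b : bx D, bp b = x.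
Proof.
split=> [/forallP h|[b <-]]; last by apply/forallP => k; rewrite /bp ffunE; apply: ltn_ord.
exists [ffun k => Ordinal (h k)]; by apply/ffunP => k; rewrite !ffunE.
Qed.

(** By [fin_col] and [fin_row], [u - 1] reads values in the box of side [D] and writes into the box
    of side [D + D]; the larger one carries a square matrix. *)
Lemma rep_fin D u : bnd D (u - 1) -> (forall J, J \proper I -> idl J u) ->
  exists M, rep (@bp (D + D)) (rho u) M /\ over (LI I) M.
Proof.
move=> hb hp; set w := u - 1.
have hr J : J \proper I -> forall f x, rho_ io t (I := J) w f x = 0.
  by move=> hJ f x; rewrite rhoB rho1 (hp J hJ) subrr.
pose dl (c : bx (D + D)) (y : mi I) : F := (y == bp c)%:R.
pose M : sqm F (bx (D + D)) := fun b c => (b == c)%:R + rho w (dl c) (bp b).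
have uE f x : rho u f x = f x + rho w f x by rewrite /w rhoB rho1 addrC subrK.
exists M; split; last first.
  move=> b c; apply: (sringD (LI_sring I)); first exact: (sring_nat (LI_sring I)).
  by apply: LI_rho => y; apply: (sring_nat (LI_sring I)).
split=> [f b|f x hx]; last first.
  rewrite uE (fin_col ht f x t0 hb hr) fin_row ?addr0 //.
  by apply/negP => /bp_box[b e]; apply: (hx b).
rewrite uE /M; under eq_bigr do rewrite mulrDl; rewrite big_split /=; congr (_ + _).
  by rewrite (bigD1 b) //= eqxx mul1r big1 ?addr0 // => c hc; rewrite eq_sym (negPf hc) mul0r.
have E (q : mi I -> F) : rho w q (bp b) = \sum_c (if box D (bp c) then q (bp c) else 0) * rho w (dl c) (bp b).
  rewrite (fin_col ht q (bp b) t0 hb hr).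
  under eq_bigr do rewrite -rhoZ; rewrite -rho_sumr; apply: eq_rho => y.
  case: ifP => hy.
    have hy' : box (D + D) y by apply/forallP => k; have := forallP hy k; lia.
    have /bp_box [c ec] := hy'; rewrite (bigD1 c) //= /dl ec eqxx mulr1 hy big1 ?addr0 // => c' hc'.
    by rewrite -ec (inj_eq (@bp_inj _)) eq_sym (negPf hc') mulr0.
  rewrite big1 // => c _; rewrite /dl; case: eqP => [<-|_]; last by rewrite mulr0.
  by rewrite hy mul0r.
rewrite E; apply: eq_bigr => c _; rewrite mulrC.
(* A point of the large box outside the small one has a zero column. *)
case: ifP => // hc; rewrite [in RHS]E big1 ?mulr0 ?mul0r // => c' _.
rewrite /dl; case: ifP => [h|_]; last by rewrite mul0r.
by case: eqP => [e|_]; [rewrite e hc in h|rewrite mul0r].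
Qed.
End Rep.

(** With [pred_mul]: on the corner of an idempotent, $a\mapsto 1+(a-1)e$ is multiplicative as long
    as the right factor commutes with $e$. *)
Lemma idem_mul (R : pzRingType) (e a b : R) : e * e = e -> e * b = b * e ->
  (1 + a * e) * (1 + b * e) = 1 + (a + b + a * b) * e.
Proof.
move=> he hb; rewrite mulrDl mul1r mulrDr mulr1 mulrA -[a * e * b]mulrA hb !mulrA -[_ * e * e]mulrA he !mulrDl.
by rewrite -!addrA; congr (_ + _); rewrite addrCA.
Qed.
Lemma pred_mul (R : pzRingType) (c d : R) : (c - 1) + (d - 1) + (c - 1) * (d - 1) = c * d - 1.
Proof. by rewrite mulrBr mulr1 mulrBl mul1r addrC addrA subrK addrA subrK. Qed.
Lemma scaleSM c d : scaleS c 1 * scaleS d 1 = scaleS (c * d) (1 : S).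
Proof. by rewrite -scaleSE; apply: SRP; apply: funext => m /=; rewrite /scale mulrA. Qed.
Lemma scaleS1 : scaleS 1 1 = 1 :> S.
Proof. by apply: SRP; apply: funext => m /=; rewrite /scale mul1r. Qed.

Definition z0 : 'I_n -> nat := fun _ => 0%N.
Definition eS I : S := EA z0 z0 I.
Definition zf I : mi I := [ffun => 0%N].
Lemma eS_idem I : eS I * eS I = eS I.
Proof. by rewrite /eS EA_mul; case: ifP => // /negP[]; apply/forall_inP. Qed.
Lemma rho_eS I f x : rho (I := I) (eS I) f x = if x == zf I then f (zf I) else 0.
Proof. exact: rho_EA. Qed.
Lemma EA_out A B I J (a : S) f x : ~~ (I \subset J) -> rho (I := J) (a * EA A B I) f x = 0.
Proof.
move=> h; rewrite rhoM // (_ : rho_ io t (EA A B I) f = fun _ => 0) ?rho_zf //.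
by apply: funext => y; apply: rho_EA_out.
Qed.
Lemma idl_EA A B I J (a : S) : ~~ (I \subset J) -> idl J (1 + a * EA A B I).
Proof. by move=> h f x; rewrite rhoD rho1 EA_out // addr0. Qed.
Definition muS I l : S := 1 + (scaleS l 1 - 1) * eS I.
Lemma muS_sval I l : sval (muS I l) = mu I l.
Proof.
have -> : muS I l = scaleS l (eS I) + 1 - eS I by rewrite /muS mulrBl mul1r -scaleSE addrA [1 + _]addrC.
by rewrite !svalD svalN sval1 /mu eI_sval.
Qed.
Lemma muS_inv I l : l != 0 -> muS I l * muS I l^-1 = 1.
Proof.
move=> l0; rewrite /muS idem_mul ?eS_idem ?pred_mul ?scaleSM ?divff ?scaleS1 ?subrr ?mul0r ?addr0 //.
by rewrite mulrBr mulrBl mulr1 mul1r scaleS_comm.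
Qed.
Lemma muS_unit I l : l != 0 -> uS (muS I l).
Proof.
by move=> l0; exists (muS I l^-1); rewrite muS_inv //; split=> //; rewrite -{2}[l]invrK muS_inv ?invr_eq0.
Qed.

Definition lifts I (Y : finType) (q : Y -> mi I) M := exists g : S,
  [/\ Einf I (sval g), uS g, rep q (rho (I := I) g) M & forall J, ~~ (I \subset J) -> idl J g].
(** Words lift letter by letter: [lift_scalar] gives the coefficient, and the two points of a letter
    give the multi-indices. Lifts are trivial on subsets that do not contain [I]. *)
Lemma EL_lift I (Y : finType) (q : Y -> mi I) M : injective q -> EL (LI I) M -> lifts q M.
Proof.
move=> qi; elim=> [|b c k A bc hk _ [g [h1 h2 h3 h4]]].
  by exists 1; split; [exact: gg1|exact: uS1|exact: rep1|move=> J _; exact: idl1].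
have [a [ha hr]] := lift_scalar hk.
have ne : exists i, i \in I /\ e0 (q b) i <> e0 (q c) i.
  have qbc : q b != q c by rewrite (inj_eq qi).
  case: (boolP [forall j, q b j == q c j]) => [/forallP h|/forallPn[j /eqP hj]].
    by case/eqP: qbc; apply/ffunP => j; apply/eqP.
  by exists (val j); split; [exact: valP|rewrite !e0E].
exists ((1 + a * EA (e0 (q b)) (e0 (q c)) I) * g); split.
- by apply: Einf_mul => //; apply: gen_Einf.
- by apply: uSM => //; exists (1 - a * EA (e0 (q b)) (e0 (q c)) I); apply: gen_inv.
- apply: rep_mul => //; apply: rep_de => // f x; rewrite rhoD rho1 rhoM // hr rho_Exy.
  by case: eqP => _; rewrite ?mul1r ?mul0r ?mulr0.
- by move=> J hJ; apply: idlM; [exact: idl_EA|exact: h4].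
Qed.

Definition wd I D D' (h : (D <= D')%N) (b : bx I D) : bx I D' := [ffun k => widen_ord h (b k)].
Lemma bp_wd I D D' (h : (D <= D')%N) (b : bx I D) : bp (wd h b) = bp b.
Proof. by apply/ffunP => k; rewrite !ffunE. Qed.
Lemma wd_inj I D D' (h : (D <= D')%N) : injective (@wd I D D' h).
Proof. by move=> b c e; apply: (@bp_inj I D); rewrite -(bp_wd h b) e bp_wd. Qed.

(** The extra indices of an abstract stabilisation are placed on the diagonal of a larger box, at
    coordinates from [D] on. This is possible when [I] is nonempty. *)
Lemma SE_box I D (M : sqm F (bx I D)) : ix I -> SE (LI I) M ->
  exists D' (w : bx I D -> bx I D'), [/\ injective w, forall b, bp (w b) = bp b & EL (LI I) (ext w M)].
Proof.
move=> k0 [J0 [f0 [fi hE]]]; pose w := @wd I D _ (leq_addr #|J0| D).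
have wi : injective w by apply: wd_inj.
exists (D + #|J0|)%N, w; split=> //; first by move=> b; apply: bp_wd.
pose h j : bx I (D + #|J0|) := if [pick b | f0 b == j] is Some b then w b else [ffun _ => rshift D (enum_rank j)].
have dis b j : w b <> [ffun _ => rshift D (enum_rank j)].
  move=> e; have := congr1 (fun b' : bx I (D + #|J0|) => val (b' k0)) e; rewrite /= !ffunE /= => e'.
  by have := ltn_ord (b k0); rewrite e' ltnNge leq_addr.
have hi : injective h.
  move=> j j'; rewrite /h; case: pickP => [b /eqP <-|_]; case: pickP => [b' /eqP <-|_].
  - by move=> /wi ->.
  - by move=> /dis.
  - by move=> /esym /dis.
  - move=> e; have := congr1 (fun b' : bx I (D + #|J0|) => b' k0) e; rewrite !ffunE => /rshift_inj.
    exact: enum_rank_inj.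
have hf : h \o f0 = w.
  apply: funext => b; rewrite /h /=; case: pickP => [b' /eqP /fi -> //|/(_ b)].
  by rewrite eqxx.
by rewrite -hf -ext_comp //; apply: EL_ext.
Qed.

Definition tz I (z : 'I_n -> int) : F := \prod_(j | j \notin I) t j ^ z j.
Lemma tz_neq0 I z : tz I z != 0.
Proof. by apply/prodf_neq0 => j _; apply: expfz_neq0. Qed.
Lemma tzD I z z' : tz I (fun j => z j + z' j) = tz I z * tz I z'.
Proof. by rewrite -big_split; apply: eq_bigr => j _; rewrite expfzDr. Qed.
Lemma tz0 I : tz I (fun _ => 0) = 1.
Proof. by rewrite /tz big1. Qed.
Lemma tzN I z : tz I (fun j => - z j) = (tz I z)^-1.
Proof. by rewrite /tz -prodfV; apply: eq_bigr => j _; rewrite invr_expz. Qed.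
Lemma LI_tz I z : LI I (tz I z).
Proof.
apply: (sring_prod (LI_sring I)) => j hj; have [h1 h2] := LI_t hj.
case: (z j) => k; first by rewrite -exprnP; apply: sringX => //; exact: LI_sring.
by rewrite NegzE -exprnN -exprVn; apply: sringX => //; exact: LI_sring.
Qed.
(** What remains of a unit on its layer after [reduce]: a Laurent monomial at the origin. *)
Definition dOp I (z : 'I_n -> int) (f : mi I -> F) y := (if y == zf I then tz I z else 1) * f y.

(** [z] is the exponent of the determinant of [u] on the layer [I]. The side [D.+1] guarantees that
    the box contains the origin. *)
Definition dexp I u (z : 'I_n -> int) := exists D (M : sqm F (bx I D.+1)) l,
  [/\ rep (@bp I D.+1) (rho (I := I) u) M, l != 0 & detF M = io l * tz I z].

Lemma dexpM I u v z z' : dexp I u z -> dexp I v z' -> dexp I (u * v) (fun j => z j + z' j).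
Proof.
move=> [D [M [l [hM l0 dM]]]] [D' [M' [l' [hM' l0' dM']]]].
have h1 : (D.+1 <= (D + D').+1)%N by rewrite ltnS leq_addr.
have h2 : (D'.+1 <= (D + D').+1)%N by rewrite ltnS leq_addl.
exists (D + D')%N, (ext (wd h1) M * ext (wd h2) M'), (l * l'); split; last 1 first.
- by rewrite detF_mul (detF_ext _ (@wd_inj I _ _ h1)) (detF_ext _ (@wd_inj I _ _ h2)) dM dM' tzD rmorphM mulrACA.
- by apply: rep_mul; [apply: (rep_ext _ _ _ hM)|apply: (rep_ext _ _ _ hM')]; try exact: bp_inj; try exact: wd_inj; exact: bp_wd.
- by rewrite mulf_neq0.
Qed.

Section Diag.
Variables (I : {set 'I_n}) (D : nat).
Definition b0 : bx I D.+1 := [ffun => ord0].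
Lemma bp_b0 : bp b0 = zf I. Proof. by apply/ffunP => k; rewrite !ffunE. Qed.
Definition diag c : sqm F (bx I D.+1) := 1 + de b0 b0 (c - 1).
Lemma diagM c d : diag c * diag d = diag (c * d).
Proof.
rewrite /diag mulrDl mul1r mulrDr mulr1 deM eqxx; apply: sqmP => x y; rewrite !sqmE /de; ring.
Qed.
Lemma diag1 : diag 1 = 1.
Proof. by apply: sqmP => x y; rewrite /diag subrr !sqmE /de mulr0 addr0. Qed.
Lemma det_diag c : detF (diag c) = c.
Proof. by rewrite detF_de eqxx mul1r addrC subrK. Qed.
Lemma over_diag c : LI I c -> over (LI I) (diag c).
Proof.
have hL := LI_sring I; move=> hc; apply: overD => //; first exact: over1.
by apply: over_de => //; apply: (sringB hL) => //; apply: sring1.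
Qed.
Lemma rep_mu l : rep (@bp I D.+1) (rho (I := I) (muS I l)) (diag (io l)).
Proof.
apply: rep_de => [|f x]; first exact: bp_inj.
rewrite bp_b0 rhoD rho1 rhoM // rhoB rho_scale !rho1 rho_eS; case: eqP => _ /=; ring.
Qed.
Lemma rep_dOp z : rep (@bp I D.+1) (dOp z) (diag (tz I z)).
Proof.
apply: rep_de => [|f x]; first exact: bp_inj.
rewrite bp_b0 /dOp; case: eqP => [->|_] /=; ring.
Qed.
End Diag.

Lemma dexp_dOp I u z : (forall f x, rho (I := I) u f x = dOp z f x) -> dexp I u z.
Proof.
move=> h; exists 0%N, (@diag I 0 (tz I z)), 1; split; rewrite ?oner_eq0 ?det_diag ?rmorph1 ?mul1r //.
by have [h1 h2] := rep_dOp I 0 z; split=> [f b|f x hx]; rewrite h ?h1 ?h2.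
Qed.
Lemma dexp_eq I u z z' : (forall j, j \notin I -> z j = z' j) -> dexp I u z -> dexp I u z'.
Proof.
move=> e [D [M [l [hM l0 dM]]]]; exists D, M, l; split=> //; rewrite dM; congr (_ * _).
by apply: eq_bigr => j /e ->.
Qed.
Lemma dexp_idl I u : idl I u -> dexp I u (fun _ => 0).
Proof. by move=> h; apply: dexp_dOp => f x; rewrite h /dOp tz0; case: ifP => _; rewrite mul1r. Qed.
Lemma dexp_rho I u v z : (forall f x, rho (I := I) u f x = rho v f x) -> dexp I u z -> dexp I v z.
Proof.
move=> e [D [M [l [[h1 h2] l0 dM]]]]; exists D, M, l; split=> //.
by split=> [f b|f x hx]; rewrite -e ?h1 ?h2.
Qed.

(** Splitting off one diagonal matrix for the scalar and one for the monomial leaves determinant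
    one, where [SK1] applies. The scalar lifts to [muS], and the monomial stays behind as [dOp]. *)
Lemma reduce I u z : ix I -> dexp I u z -> exists g, [/\ prodset (UI I) (Einf I) (sval g), uS g,
  forall J, ~~ (I \subset J) -> idl J g & forall f x, rho (I := I) u f x = rho g (dOp z f) x].
Proof.
move=> k0 [D [M [l [hM l0 dM]]]]; have il0 : io l != 0 by rewrite fmorph_eq0.
have tz0' := tz_neq0 I z.
pose M' := @diag I D (io l)^-1 * M * @diag I D (tz I z)^-1.
have eM : M = @diag I D (io l) * M' * @diag I D (tz I z).
  by rewrite /M' !mulrA diagM divff // diag1 mul1r -mulrA diagM mulVf // diag1 mulr1.
have dM' : detF M' = 1 by rewrite !detF_mul dM !det_diag mulKf // divff.
have hL := LI_sring I.
have oM' : over (LI I) M'.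
  apply: overM => //; last by apply: over_diag; rewrite -tzN; apply: LI_tz.
  apply: overM => //; last by apply: (rep_over _ hM); apply: bp_inj.
  by apply: over_diag; apply: laur_base => //; exists l^-1; rewrite fmorphV.
have [D' [w [wi wp hE]]] := SE_box k0 (SK1 (Kp_sfield io) (LI_chain I) oM' dM').
have [g1 [h1 h2 h3 h4]] := EL_lift (@bp_inj I D') hE.
have ex r N : rep (@bp I D.+1) r N -> rep (@bp I D') r (ext w N).
  by apply: rep_ext => //; apply: bp_inj.
exists (muS I l * g1); split.
- by exists (sval (muS I l)), (sval g1); split; [exists l; rewrite muS_sval|].
- by apply: uSM => //; apply: muS_unit.
- by move=> J hJ; apply: idlM; [apply: idl_EA|apply: h4].
move=> f x; have R1 := ex _ _ hM; rewrite eM (extM _ _ wi) (extM _ _ wi) in R1.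
exact: (rep_eq R1 (rep_comp (rep_mul (ex _ _ (rep_mu I D l)) h3) (ex _ _ (rep_dOp I D z)))).
Qed.

(** The matrices of a unit and of its inverse are mutually inverse over the Laurent ring, so
    [chain_units] describes the determinant. *)
Lemma dexp_ex I u : uS u -> (forall J, J \proper I -> idl J u) -> exists z, dexp I u z.
Proof.
move=> [v [uv vu]] hu; have hv J : J \proper I -> idl J v by move=> hJ; apply: (idlV uv vu); apply: hu.
have [D1 hD1] := bnd_ex (u - 1); have [D2 hD2] := bnd_ex (v - 1).
pose D := (D1 + D2).+1.
have [M [hM oM]] := @rep_fin I D u (bndW (leqW (leq_addr _ _)) hD1) hu.
have [N [hN oN]] := @rep_fin I D v (bndW (leqW (leq_addl _ _)) hD2) hv.
have MN : M * N = 1.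
  by apply: (rep_inj (@bp_inj I _) (rep_mul hM hN)); rewrite uv; apply: rep1.
have hL := LI_sring I.
have [c [d [z [[k ec] hd cd sz e]]]] := chain_units hKp (LI_chain I) (P_detF hL oM) (P_detF hL oN)
  (etrans (esym (detF_mul M N)) (etrans (congr1 _ MN) (detF1 _ _))).
exists (fun j => z`_(index j (enum (~: I)))), (D1 + D2 + D)%N, M, k; split=> //.
  by apply: contraTneq (oner_neq0 F) => k0; rewrite -cd ec k0 rmorph0 mul0r eqxx.
rewrite e ec; congr (_ * _); rewrite /tz.
rewrite -(big_mkord xpredT (fun i => (map t (enum (~: I)))`_i ^ z`_i)) size_map.
have -> : \prod_(j | j \notin I) t j ^ z`_(index j (enum (~: I))) =
   \prod_(j <- enum (~: I)) t j ^ z`_(index j (enum (~: I))).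
  by rewrite big_enum /=; apply: eq_bigl => j; rewrite inE.
case: (pickP (fun j => j \in ~: I)) => [j0 hj0|h0]; last first.
  by rewrite (_ : enum (~: I) = [::]) ?big_nil //; apply/eqP; rewrite -size_eq0 -cardE; apply/eqP/eq_card0.
rewrite (big_nth j0); apply: eq_big_nat => i /andP[_ hi]; rewrite (nth_map j0) //.
by rewrite index_uniq ?enum_uniq.
Qed.

Lemma EA_D1 A B J i : i \in J -> EA A B J = Es K (A i) (B i) i * EA A B (J :\ i).
Proof.
move=> hi; apply: (faith ht) => f x; rewrite rhoM // rho_EA_in ?subsetT //.
pose k : ix [set: 'I_n] := exist _ i (in_setT i).
have nk (j : ix [set: 'I_n]) : (val j == i) = (j == k) by [].
rewrite -[X in Es _ _ _ X]/(val k) rho_Es_in rho_EA_in ?subsetT //.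
have -> : mat (I := setT) (enum J) A x = (x k == A i) && mat (I := setT) (enum (J :\ i)) A (upd x k (B i)).
  apply/forallP/andP => [h|[h1 /forallP h2] j].
    split; first by have := h k; rewrite mem_enum hi.
    by apply/forallP => j; have := h j; rewrite !mem_enum in_setD1 nk ffunE; case: (j =P k).
  have := h2 j; rewrite !mem_enum in_setD1 nk ffunE; case: (j =P k) => [->|_] //= _.
  by rewrite h1 implybT.
case: ifP => [/andP[-> ->]|/negbT]; last by case: ifP => //= h; case: ifP.
congr f; apply/ffunP => j; rewrite !ffunE !mem_enum in_setD1 nk; case: (j =P k) => [->|_] //=.
by rewrite hi.
Qed.

(** * The elements $\theta_{ij}(J)$ and the exponents of their determinants *)

Definition fa (c : S) I : S := 1 + (c - 1) * eS I.
Lemma fa_mul c d I : SC I (sval d) -> fa c I * fa d I = fa (c * d) I.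
Proof.
move=> hd; rewrite /fa idem_mul ?eS_idem ?pred_mul //.
by rewrite mulrBr mulrBl mulr1 mul1r /eS SC_comm.
Qed.
Lemma fa_out c I J : ~~ (I \subset J) -> idl J (fa c I).
Proof. exact: idl_EA. Qed.
Lemma rho_fa c I z : (forall f x, rho (I := I) c f x = tz I z * f x) ->
  forall f x, rho (I := I) (fa c I) f x = dOp z f x.
Proof.
move=> hc f x; rewrite rhoD rho1 rhoM // rhoB rho1 hc rho_eS /dOp.
by case: eqP => [->|_]; ring.
Qed.
Lemma tz1 I i e : i \notin I -> tz I (fun k => if k == i then e else 0) = t i ^ e.
Proof.
move=> hi; rewrite /tz (bigD1 i) //= eqxx big1 ?mulr1 // => k /andP[_ /negPf ->].
by rewrite expr0z.
Qed.
Lemma rho_X I i f x : i \notin I -> rho (I := I) (XS K i) f x = t i ^ (1 : int) * f x.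
Proof.
by move=> hi; have := @rho_XY_out _ _ _ io t I i 1 0 f x hi; rewrite !expr1 !expr0 mulr1 divr1 expr1z.
Qed.
Lemma rho_Y I i f x : i \notin I -> rho (I := I) (YS K i) f x = t i ^ (-1 : int) * f x.
Proof.
by move=> hi; have := @rho_XY_out _ _ _ io t I i 0 1 f x hi; rewrite !expr1 !expr0 !mul1r -invr_expz expr1z.
Qed.

Definition thS i j J : S := fa (YS K i) (J :\ i) * fa (XS K j) (J :\ j).
Lemma notD1 J (i : 'I_n) : i \notin J :\ i. Proof. by rewrite !inE eqxx. Qed.
Lemma thS_sval (i j : 'I_n) J : theta K (val i) (val j) J = sval (thS i j J).
Proof.
have E (k : 'I_n) : J :\: [set t0 | val t0 == val k] = J :\ k.
  by apply/setP => l; rewrite !inE val_eqE.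
by rewrite /theta !E yg_sval xg_sval !eI_sval /thS /fa !(svalM, svalD, svalN, sval1).
Qed.
(** The inner factors combine to $1-e_J$, because $x_jy_j-1=-e_j$. The term $e_J$ dies since
    $y_ie_i=0$, and the outer factors cancel by $y_ix_i=1$. *)
Lemma thS_inv i j J : i \in J -> j \in J -> thS i j J * thS j i J = 1.
Proof.
move=> hi hj; rewrite /thS mulrA -[_ * fa (YS K j) _]mulrA fa_mul; last by apply: SC_Y; apply: notD1.
have E k : k \in J -> eS J = (1 - XS K k * YS K k) * eS (J :\ k).
  by move=> hk; rewrite /eS (EA_D1 _ _ hk) /Es !expr0 !expr1 mul1r.
have -> : fa (XS K j * YS K j) (J :\ j) = 1 - eS J by rewrite (E j hj) /fa -[X in _ = _ - X * _]opprB mulNr opprK.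
rewrite mulrBr mulr1 mulrBl fa_mul; last by apply: SC_X; apply: notD1.
rewrite YX /fa subrr mul0r addr0.
have -> : (1 + (YS K i - 1) * eS (J :\ i)) * eS J = 0; last by rewrite mul0r subr0.
have ce : eS (J :\ i) * eS J = eS J.
  rewrite (E i hi) mulrA /eS -SC_comm -?mulrA ?[EA _ _ _ * EA _ _ _]eS_idem //.
  apply: SCD; first exact: sa_one.
  by apply: SCN; apply: SCM; [apply: SC_X|apply: SC_Y]; apply: notD1.
rewrite mulrDl mul1r -mulrA ce mulrBl mul1r addrC subrK (E i hi) mulrA mulrBr mulr1 mulrA YX mul1r subrr.
by rewrite mul0r.
Qed.

(** Integer powers with the inverse supplied as [v], in place of the one that [inv] obtains by
    choice. *)
Definition zpw (u v : S) (e : int) : S := match e with Posz k => u ^+ k | Negz k => v ^+ k.+1 end.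
Lemma inv_sval u v : u * v = 1 -> v * u = 1 -> inv (sval u) = sval v.
Proof.
move=> h1 h2; rewrite /inv; case: ClassicalEpsilon.excluded_middle_informative => [H|[]]; last first.
  by exists (sval v); split; [exact: SnS|rewrite -!svalM h1 h2].
case: ClassicalEpsilon.constructive_indefinite_description => g [hg [h3 h4]] /=.
pose g' : S := exist _ g hg; have e3 : u * g' = 1 by apply: SRP.
have : v * (u * g') = g' by rewrite mulrA h2 mul1r.
by rewrite e3 mulr1 => e; exact: (congr1 sval (esym e)).
Qed.
Lemma zpow_sval u v e : u * v = 1 -> v * u = 1 -> zpow (sval u) e = sval (zpw u v e).
Proof. by move=> h1 h2; case: e => k /=; rewrite ?(inv_sval h1 h2) svalX. Qed.
Lemma expr_inv u v k : u * v = 1 -> u ^+ k * v ^+ k = 1.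
Proof.
move=> h; elim: k => [|k IH]; first by rewrite mulr1.
by rewrite exprSr exprS mulrA -[_ * u * v]mulrA h mulr1.
Qed.
Lemma zpw_inv u v e : u * v = 1 -> v * u = 1 -> zpw u v e * zpw v u e = 1.
Proof. by move=> h1 h2; case: e => k; apply: expr_inv. Qed.
Lemma dexp_pow I u z k : dexp I u z -> dexp I (u ^+ k) (fun j => k%:Z * z j).
Proof.
move=> h; elim: k => [|k IH].
  by apply: (dexp_eq _ (dexp_idl (@idl1 I))) => j _; rewrite mul0r.
by rewrite exprS; apply: (dexp_eq _ (dexpM h IH)) => j _; rewrite intS mulrDl mul1r.
Qed.
Lemma dexp_zpw I u v z e : dexp I u z -> dexp I v (fun j => - z j) -> dexp I (zpw u v e) (fun j => e * z j).
Proof.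
move=> hu hv; case: e => k; first exact: dexp_pow.
by apply: (dexp_eq _ (dexp_pow k.+1 hv)) => j _; rewrite NegzE mulrN mulNr.
Qed.

Variables (nl : 'I_n) (hnl : val nl = n.-1).
Lemma lastinE I : lastin I = (nl \in I).
Proof.
apply/exists_inP/idP => [[x hx /eqP e]|h]; last by exists nl; rewrite ?hnl.
by rewrite (_ : nl = x) //; apply: val_inj; rewrite hnl e.
Qed.
Definition G s u := uS u /\ forall I, (#|I| < s)%N || (nl \notin I) -> idl I u.
Lemma GM s u v : G s u -> G s v -> G s (u * v).
Proof. by move=> [h1 h2] [h3 h4]; split; [exact: uSM|move=> I hI; apply: idlM; auto]. Qed.
Lemma G1 s : G s 1. Proof. by split; [exact: uS1|move=> I _; exact: idl1]. Qed.
Lemma GV s u v : u * v = 1 -> v * u = 1 -> G s u -> G s v.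
Proof.
by move=> h1 h2 [_ h]; split; [exists u|move=> I hI; apply: (idlV h1 h2); apply: h].
Qed.
Lemma GX s u k : G s u -> G s (u ^+ k).
Proof. by move=> h; elim: k => [|k IH]; [exact: G1|rewrite exprS; apply: GM]. Qed.
Lemma Gzpw s u v e : u * v = 1 -> v * u = 1 -> G s u -> G s (zpw u v e).
Proof. by move=> h1 h2 h; case: e => k; apply: GX => //; apply: (GV h1 h2). Qed.
Lemma G_le s r u : (s <= r)%N -> G r u -> G s u.
Proof.
move=> sr [h1 h2]; split=> // I hI; apply: h2; case/orP: hI => [h|->]; last by rewrite orbT.
by rewrite (leq_trans h sr).
Qed.
Lemma notsub s I J : (s <= #|I|)%N -> nl \in I -> (#|J| < s)%N || (nl \notin J) -> ~~ (I \subset J).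
Proof.
move=> hI hn h; apply/negP => hs; case/orP: h => h.
  by have := leq_trans (leq_trans h hI) (subset_leq_card hs); rewrite ltnn.
by rewrite (subsetP hs) in h.
Qed.
Lemma cardD1 J (i : 'I_n) s : i \in J -> #|J| = s.+1 -> #|J :\ i| = s.
Proof. by move=> hi; rewrite (cardsD1 i) hi => -[]. Qed.
Lemma G_th s J i j : #|J| = s.+1 -> nl \in J -> i \in J -> j \in J -> i != nl -> j != nl -> G s (thS i j J).
Proof.
move=> cJ hn hi hj i1 j1; split; first by exists (thS j i J); rewrite !thS_inv.
by move=> I hI; apply: idlM; apply: fa_out; apply: (notsub _ _ hI);
  rewrite ?(cardD1 hi cJ) ?(cardD1 hj cJ) // !inE ?hn ?andbT eq_sym.
Qed.
Lemma dexp_fa i c e J I : #|I| = #|J :\ i| -> (forall f x, rho (I := J :\ i) c f x = t i ^ e * f x) ->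
  dexp I (fa c (J :\ i)) (fun k => if (I == J :\ i) && (k == i) then e else 0).
Proof.
move=> cI hc; have [->|ne] := eqVneq I (J :\ i).
  by apply: dexp_dOp; apply: rho_fa => f x; rewrite hc tz1 ?notD1.
apply: dexp_idl; apply: fa_out; apply: contra ne => hs.
by rewrite eq_sym eqEcard hs cI leqnn.
Qed.
(** Among subsets with one element fewer than [J], two see [thS m j J]: without [m] its determinant
    is $t_m^{-1}$, without [j] it is $t_j$. *)
Definition zth J m j I k : int := (if (I == J :\ m) && (k == m) then -1 else 0) + (if (I == J :\ j) && (k == j) then 1 else 0).
Lemma dexp_th s J m j I : #|J| = s.+1 -> m \in J -> j \in J -> #|I| = s -> dexp I (thS m j J) (zth J m j I).
Proof.
move=> cJ hm hj cI; apply: dexpM; apply: dexp_fa; rewrite ?(cardD1 hm cJ) ?(cardD1 hj cJ) // => f x.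
  by rewrite rho_Y ?notD1.
by rewrite rho_X ?notD1.
Qed.
Lemma zthN J m j I k : zth J j m I k = - zth J m j I k.
Proof. by rewrite /zth opprD addrC; congr (_ + _); case: ifP => _; rewrite ?opprK ?oppr0. Qed.

Definition DX s u (Z : {set 'I_n} -> 'I_n -> int) := forall I, #|I| = s -> nl \in I -> dexp I u (Z I).
Definition Thj J (lj : seq 'I_n) : elem K n -> Prop := foldr (fun j acc' =>
  prodset (fun w : elem K n => exists z : int, w = zpow (theta K (mJ J) (val j) J) z) acc') (@singl1 K n) lj.

Lemma setD1_inj (J J' : {set 'I_n}) i : i \in J -> i \in J' -> J' :\ i = J :\ i -> J' = J.
Proof. by move=> h h' e; rewrite -(setD1K h) -e setD1K. Qed.

(** A power of $\theta_{m,j}(J)$ changes the exponent at [J] without [j], as desired, and also at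
    [J] without [m]. The second place is not recorded, as the last clause leaves out the index
    [mJ J'] of each [J']. *)
Lemma kill_j s J m lj u Z : #|J| = s.+1 -> nl \in J -> m \in J -> m != nl -> val m = mJ J ->
  (forall j, j \in lj -> [&& j \in J, j != nl & j != m]) -> G s u -> DX s u Z ->
  exists (h u' : S) Z', [/\ Thj J lj (sval h), u = h * u', G s u', DX s u' Z' &
   forall J' j', j' \in J' -> val j' != mJ J' ->
     Z' (J' :\ j') j' = if (J' == J) && (j' \in lj) then 0 else Z (J' :\ j') j'].
Proof.
move=> cJ hn hm mn em; elim: lj u Z => [|j lj IH] u Z hlj hu hZ.
  by exists 1, u, Z; split=> //; [rewrite mul1r|move=> J' j' _ _; rewrite andbF].
have /and3P[hj jn jm] := hlj j (mem_head _ _).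
pose th := thS m j J; pose th' := thS j m J; pose e := Z (J :\ j) j.
have t1 : th * th' = 1 by apply: thS_inv.
have t2 : th' * th = 1 by apply: thS_inv.
have Gth : G s th by apply: G_th.
(* This multiplies by the power of $\theta$ with exponent $-e$; its inverse becomes the first factor
   of [h]. *)
pose u1 := zpw th' th e * u.
pose Z1 I k : int := e * zth J j m I k + Z I k.
have hu1 : G s u1 by apply: GM => //; apply: Gzpw => //; apply: GV t1 t2 Gth.
have hZ1 : DX s u1 Z1.
  move=> I cI nI; apply: dexpM; last exact: hZ.
  apply: dexp_zpw; first exact: dexp_th cJ _ _ cI.
  by apply: (dexp_eq _ (dexp_th cJ hm hj cI)) => k _; rewrite zthN.
have [|h [u' [Z' [h1 h2 h3 h4 h5]]]] := IH u1 Z1 _ hu1 hZ1.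
  by move=> k hk; apply: hlj; rewrite inE hk orbT.
exists (zpw th th' e * h), u', Z'; split=> //.
- exists (sval (zpw th th' e)), (sval h); split; last by [].
  by exists e; rewrite -em thS_sval (zpow_sval _ t1 t2).
- by rewrite -mulrA -h2 /u1 mulrA zpw_inv // mul1r.
move=> J' j' hj' mj'; rewrite h5 // /Z1 /zth.
have -> : (J' :\ j' == J :\ m) && (j' == m) = false.
  apply/negP => /andP[/eqP e1 /eqP e2]; subst j'.
  by move: mj'; rewrite (setD1_inj hm hj' e1) em eqxx.
have -> : (J' :\ j' == J :\ j) && (j' == j) = (J' == J) && (j' == j).
  case: (j' =P j) => [ej|_]; rewrite ?andbF ?andbT //; subst j'.
  by apply/eqP/eqP => [e1|->] //; apply: (setD1_inj hj hj').
rewrite addr0 inE; case: (J' =P J) => [eJ|_] /=; last by rewrite mulr0 add0r.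
subst J'; case: (j' =P j) => [->|_] /=; last by rewrite mulr0 add0r.
by rewrite mulrN1 addNr; case: ifP.
Qed.

Lemma mJ_ex s J : #|J| = s.+2 -> nl \in J -> exists m, [/\ m \in J, m != nl & val m = mJ J].
Proof.
move=> cJ hn; pose A := [pred x : 'I_n | (x \in J) && (val x != n.-1)].
have cA : (0 < #|A|)%N.
  have : (0 < #|J :\ nl|)%N by rewrite (cardD1 hn cJ).
  case/card_gt0P => x; rewrite !inE => /andP[h1 h2]; apply/card_gt0P; exists x.
  by rewrite inE /= h2 -hnl val_eqE.
have [m hm e] := eq_bigmax_cond (fun x : 'I_n => val x) cA.
have /andP[m1 m2] : (m \in J) && (val m != n.-1) by [].
by exists m; split; [|rewrite -val_eqE hnl|rewrite -e].
Qed.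

Lemma kill_J s (LJ : seq {set 'I_n}) (ordj : {set 'I_n} -> seq 'I_n) u Z :
  (forall J j, (j \in ordj J) = [&& j \in J, val j != n.-1 & val j != mJ J]) ->
  (forall J, J \in LJ -> #|J| = s.+2 /\ nl \in J) -> G s.+1 u -> DX s.+1 u Z ->
  exists (h u' : S) Z', [/\ Thtil LJ ordj (sval h), u = h * u', G s.+1 u', DX s.+1 u' Z' &
   forall J' j', j' \in J' -> val j' != mJ J' ->
     Z' (J' :\ j') j' = if (J' \in LJ) && (j' \in ordj J') then 0 else Z (J' :\ j') j'].
Proof.
move=> Hj; elim: LJ u Z => [|J LJ IH] u Z hJ hu hZ.
  by exists 1, u, Z; split=> //; rewrite mul1r.
have [cJ hn] := hJ J (mem_head _ _); have [m [m1 m2 m3]] := mJ_ex cJ hn.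
have hl j : j \in ordj J -> [&& j \in J, j != nl & j != m].
  by rewrite Hj -hnl -m3 !val_eqE.
have [h [u1 [Z1 [a1 a2 a3 a4 a5]]]] := kill_j cJ hn m1 m2 m3 hl hu hZ.
have [|h' [u' [Z' [b1 b2 b3 b4 b5]]]] := IH u1 Z1 _ a3 a4.
  by move=> J' h'; apply: hJ; rewrite inE h' orbT.
exists (h * h'), u', Z'; split=> //; first by exists (sval h), (sval h').
  by rewrite -mulrA -b2.
move=> J' j' h1 h2; rewrite b5 // a5 // inE.
by case: (J' =P J) => [->|_] //=; case: (j' \in ordj J); rewrite ?andbT ?andbF //; case: ifP.
Qed.

(** An element reducing the layer [I] is trivial on every other subset of the same size, since none
    contains [I]. The reductions therefore do not interfere. *)
Lemma red_list s (LE : seq {set 'I_n}) u Z : uniq LE -> (forall I, I \in LE -> #|I| = s /\ nl \in I) ->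
  G s u -> DX s u Z -> exists h u' : S, [/\ Etil LE (sval h), u = h * u', G s u',
   forall I, I \in LE -> forall f x, rho (I := I) u' f x = dOp (Z I) f x &
   forall I, #|I| = s -> I \notin LE -> forall f x, rho (I := I) u' f x = rho (I := I) u f x].
Proof.
elim: LE u => [|I LE IH] u /=; first by move=> _ _ hu _; exists 1, u; split=> //; rewrite mul1r.
move=> /andP[nI uL] hI hu hZ; have [cI hn] := hI I (mem_head _ _).
have [g [g1 [v [gv vg]] g3 g4]] := reduce (exist _ nl hn : ix I) (hZ I cI hn).
have Gg : G s g.
  by split; [exists v|move=> J hJ; apply: g3; apply: (notsub _ hn hJ); rewrite cI].
have uI f x : rho (I := I) (v * u) f x = dOp (Z I) f x.
  rewrite rhoM // (_ : rho u f = rho g (dOp (Z I) f)); last by apply: funext => y.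
  by rewrite -rhoM // vg rho1.
have uO J f x : #|J| = s -> J != I -> rho (I := J) (v * u) f x = rho u f x.
  move=> cJ ne; rewrite rhoM // (idlV gv vg) //; apply: g3; apply: contra ne => hs.
  by rewrite eq_sym eqEcard hs cI cJ leqnn.
have hZ1 : DX s (v * u) Z.
  move=> J cJ nJ; have [->|ne] := eqVneq J I; first exact: dexp_dOp.
  by apply: (dexp_rho _ (hZ J cJ nJ)) => f x; rewrite uO.
have [||h [u' [h1 h2 h3 h4 h5]]] := IH (v * u) uL _ _ hZ1.
- by move=> J hJ; apply: hI; rewrite inE hJ orbT.
- by apply: GM => //; apply: (GV gv vg).
exists (g * h), u'; split=> //.
- by exists (sval g), (sval h).
- by rewrite -mulrA -h2 mulrA gv mul1r.
- by move=> J; rewrite inE => /orP[/eqP -> f x|]; [rewrite h5|apply: h4].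
- by move=> J cJ; rewrite inE negb_or => /andP[ne hJ] f x; rewrite h5 // uO.
Qed.

(** The monomial of $\mathbb S_{CI}$ with $x_j$ for positive and $y_j$ for negative exponents,
    acting by [tz I z]. *)
Definition mn I (z : 'I_n -> int) : mono :=
  ([ffun j => if j \in I then 0%N else if z j is Posz k then k else 0%N],
   [ffun j => if j \in I then 0%N else if z j is Negz k then k.+1 else 0%N]).
Lemma rho_mn I z f x : rho (I := I) (monS K (mn I z)) f x = tz I z * f x.
Proof.
have hk (k : ix I) : val k \in I by apply: (valP k).
rewrite rho_mon; have -> : tw t I (mn I z) = tz I z.
  apply: eq_bigr => j /negPf hj; rewrite !ffunE hj; case: (z j) => k; first by rewrite expr0 divr1.
  by rewrite expr0 mul1r NegzE -exprnN.
have -> : lea (mn I z) x by apply/forallP => k; rewrite ffunE hk.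
by congr (_ * f _); apply/ffunP => k; rewrite !ffunE /= hk subn0 addn0.
Qed.
Lemma rank_le (U W : finType) (A : W -> U -> F) (B : U -> W -> F) :
  (forall w w', \sum_u A w u * B u w' = (w == w')%:R) -> (#|W| <= #|U|)%N.
Proof.
move=> h; apply: (@mulmx1_min F #|W| #|U| (\matrix_(i, j) A (enum_val i) (enum_val j))
  (\matrix_(i, j) B (enum_val i) (enum_val j))).
apply/matrixP => i j; rewrite !mxE; under eq_bigr do rewrite !mxE.
rewrite -(inj_eq enum_val_inj) -h.
by rewrite -(big_enum_val (fun u : U => A (enum_val i) u * B u (enum_val j))); apply: eq_bigl.
Qed.

(** * The Fredholm index forces the last exponent to vanish *)

Section Index.
Variables (J : {set 'I_n}) (m : 'I_n) (Zf : 'I_n -> 'I_n -> int).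
Hypothesis hm : m \in J.
Let t1 : 'I_n -> F := fun _ => 1.
Let t1_0 j : t1 j != 0. Proof. exact: oner_neq0. Qed.
Notation r := (rho_ io t1 (I := J)).
Let km : ix J := exist _ m hm.
Let nk (j : ix J) : (val j == m) = (j == km). Proof. by []. Qed.
Let hk (k : ix J) : val k \in J. Proof. exact: (valP k). Qed.
Lemma tw1 a : tw t1 J a = 1.
Proof. by rewrite /tw big1 // => i _; rewrite !expr1n divr1. Qed.
Lemma r_mn0 j f x : Zf j j = 0 -> r (monS K (mn (J :\ j) (Zf j))) f x = f x.
Proof.
move=> hz; rewrite rho_mon tw1 mul1r.
have E (k : ix J) : (mn (J :\ j) (Zf j)).1 (val k) = 0%N /\ (mn (J :\ j) (Zf j)).2 (val k) = 0%N.
  by rewrite !ffunE in_setD1 hk andbT; case: eqP => [->|_] //=; rewrite hz.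
have -> : lea (mn (J :\ j) (Zf j)) x by apply/forallP => k; rewrite (E k).1.
by congr f; apply/ffunP => k; rewrite ffunE (E k).1 (E k).2 subn0 addn0.
Qed.
Lemma r_e f x : r (eS (J :\ m)) f x = if mat (I := J) (enum (J :\ m)) z0 x then f x else 0.
Proof.
rewrite /eS EA_enum rho_prodE_in ?enum_uniq //; last by move=> i; rewrite mem_enum in_setD1 => /andP[].
case: ifP => // /forallP h; congr f; apply/ffunP => k; rewrite ffunE; case: ifP => // hk'.
by have := h k; rewrite hk' => /eqP.
Qed.

(* The exponent is minus the Fredholm index of the specialisation of [u] at
   [t = 1]: a right inverse would embed a box plus [k] points into the box. *)
Lemma index_le u v : u * v = 1 ->
  (forall j, j \in J -> forall f x, rho (I := J :\ j) u f x = dOp (Zf j) f x) ->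
  (forall I, I \proper J -> (#|I|.+1 < #|J|)%N -> idl I u) -> (forall j, j \in J -> j != m -> Zf j j = 0) ->
  ~~ (0 < Zf m m).
Proof.
move=> uv hu hs hz; apply/negP => hpos.
have [k ek k0] : exists2 k, Zf m m = Posz k & (0 < k)%N by case: (Zf m m) hpos => // k; exists k.
(* [T j] reproduces [u - 1] on [J] without [j]. Subtracting all of them leaves an element [w] that
   vanishes on every proper subset of [J] and so has a finite matrix on [J]. *)
pose T j : S := (monS K (mn (J :\ j) (Zf j)) - 1) * eS (J :\ j).
pose w := u - 1 - \sum_(j in J) T j.
have hw I : I \proper J -> forall f x, rho (I := I) w f x = 0.
  move=> hI f x; rewrite !rhoB rho1 rho_suml; have hIJ := proper_sub hI.
  have out j : j \in J -> I != J :\ j -> rho (I := I) (T j) f x = 0.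
    move=> hj ne; apply: EA_out; apply: contra ne => hs'.
    by rewrite eq_sym eqEcard hs' /=; have := proper_card hI; rewrite (cardsD1 j J) hj ltnS.
  have [e|ne] := eqVneq #|I|.+1 #|J|; last first.
    have lt : (#|I|.+1 < #|J|)%N by rewrite ltn_neqAle ne proper_card.
    rewrite (hs I hI lt) subrr big1 ?subr0 // => j hj; apply: out => //.
    by apply: contraTneq lt => ->; rewrite [X in (_ < X)%N](cardsD1 j J) hj ltnn.
  have [_ [j hj jI]] := properP hI.
  have eI : I = J :\ j.
    apply/eqP; rewrite eqEcard; apply/andP; split; last by rewrite -ltnS e (cardsD1 j J) hj.
    by apply/subsetP => i hi; rewrite !inE (subsetP hIJ) // andbT; apply: contraNneq jI => <-.
  subst I; rewrite (bigD1 j) //= big1 ?addr0; last first.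
    move=> i /andP[hi ne]; apply: out => //; apply/eqP => E.
    by have := notD1 J i; rewrite -E !inE ne hi.
  rewrite hu // -(rho_fa (@rho_mn (J :\ j) (Zf j)) f x) /fa rhoD rho1 -/(T j).
  by ring.
have eu : u = w + \sum_(j in J) T j + 1 by rewrite /w subrK subrK.
clearbody w; have [D0 hD0] := bnd_ex w; pose D := D0.+1; have hD : bnd D w := bndW (leqnSn _) hD0.
have rw f f' x : (forall y, box D y -> f y = f' y) -> r w f x = r w f' x.
  move=> h; rewrite (fin_col ht f x t1_0 hD hw) (fin_col ht f' x t1_0 hD hw).
  by apply: eq_rho => y; case: ifP => // /h.
(* At $t=1$ the [T j] with [j != m] act as 0, because the exponent of $t_j$ in them is 0. Hence, up
   to a finite part, [u] is a shift by [k] on the [m]-axis and the identity off it. *)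
have ru f x : r u f x = (if mat (I := J) (enum (J :\ m)) z0 x then
    (if (k <= x km)%N then f (upd x km (x km - k)%N) else 0) else f x) + r w f x.
  rewrite {1}eu !rhoD rho1 rho_suml (bigD1 m) //= big1 ?addr0; last first.
    by move=> j /andP[hj ne]; rewrite rhoM // rhoB rho1 r_mn0 ?subrr ?hz.
  rewrite rhoM // rhoB rho1 rho_mon tw1 mul1r !r_e.
  set a := mn _ _.
  have la : lea a x = (k <= x km)%N.
    apply/forallP/idP => [/(_ km)|h j]; rewrite ffunE in_setD1 nk ?eqxx /= ?ek //.
    by case: (j =P km) => [->|_] /=; rewrite ?ek // hk.
  have sa : sh a x = upd x km (x km - k)%N.
    apply/ffunP => j; rewrite !ffunE !in_setD1 nk hk andbT; case: (j =P km) => [->|_] /=.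
      by rewrite ek addn0.
    by rewrite subn0 addn0.
  have ma : mat (I := J) (enum (J :\ m)) z0 (upd x km (x km - k)%N) = mat (I := J) (enum (J :\ m)) z0 x.
    by apply: eq_forallb => j; rewrite mem_enum in_setD1 nk ffunE; case: (j =P km).
  rewrite la sa ma; case: (mat _ _ _); last by case: ifP => _; rewrite subrr addr0 addrC.
  by rewrite -addrA subrK addrC.
(* The box together with the next [k] points of the [m]-axis: after the shift by [k], all of these
   read values inside the box. *)
pose q (y : bx J D + 'I_k) : mi J := match y with inl b => bp b | inr i => [ffun j => if j == km then (D + i)%N else 0%N] end.
have qi : injective q.
  have dis b (i : 'I_k) : q (inl b) <> q (inr i).
    move=> e; have := congr1 (fun f : mi J => f km) e; rewrite /= !ffunE eqxx => e'.
    by have := ltn_ord (b km); rewrite e' ltnNge leq_addr.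
  move=> [b|i] [b'|i'] e; first by congr inl; apply: bp_inj.
  - by case: (dis _ _ e).
  - by case: (dis _ _ (esym e)).
  - congr inr; apply: val_inj; have := congr1 (fun f : mi J => f km) e; rewrite /= !ffunE eqxx.
    exact: addnI.
have det f f' y : (forall b : bx J D, f (bp b) = f' (bp b)) -> r u f (q y) = r u f' (q y).
  move=> h; have hb x : box D x -> f x = f' x by move=> /bp_box[b <-].
  rewrite !ru (rw f f') //; congr (_ + _); case: ifP => hmat.
    case: ifP => // hk'; apply: hb; apply/forallP => j; rewrite ffunE; case: (j =P km) => [_|/eqP ne].
      case: y {hmat hk'} => [b|i] /=; rewrite ffunE; first exact: leq_ltn_trans (leq_subr _ _) (ltn_ord _).
      by rewrite eqxx; have := ltn_ord i; move: (nat_of_ord i) => i'; rewrite /D; lia.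
    by case: y {hmat hk'} => [b|i] /=; rewrite ffunE; [exact: ltn_ord|rewrite (negPf ne)].
  case: y hmat => [b|i] //= /negP[]; apply/forallP => j; rewrite mem_enum in_setD1 nk ffunE.
  by case: (j =P km) => //= _; rewrite implybT.
pose A y (b : bx J D) := r u (fun x => (x == bp b)%:R) (q y).
have ex f y : r u f (q y) = \sum_(b : bx J D) A y b * f (bp b).
  rewrite (det _ (fun x => \sum_(b : bx J D) f (bp b) * (x == bp b)%:R)); last first.
    move=> b; rewrite (bigD1 b) //= eqxx mulr1 big1 ?addr0 // => b' ne.
    by rewrite (inj_eq (@bp_inj J D)) eq_sym (negPf ne) mulr0.
  by rewrite rho_sumr; apply: eq_bigr => b _; rewrite rhoZ mulrC.
have := @rank_le _ _ A (fun b y => r v (fun x => (x == q y)%:R) (bp b)).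
rewrite card_sum card_ord => H; have : (#|{: bx J D}| + k <= #|{: bx J D}|)%N.
  by apply: H => y y'; rewrite -ex -rhoM // uv rho1 (inj_eq qi).
by rewrite -{2}[#|_|]addn0 leq_add2l leqNgt k0.
Qed.
End Index.

(** The inverse unit has opposite exponents and excludes the other sign. *)
Lemma index_eq J m Zf u v : m \in J -> u * v = 1 -> v * u = 1 ->
  (forall j, j \in J -> forall f x, rho (I := J :\ j) u f x = dOp (Zf j) f x) ->
  (forall I, I \proper J -> (#|I|.+1 < #|J|)%N -> idl I u) -> (forall j, j \in J -> j != m -> Zf j j = 0) ->
  Zf m m = 0.
Proof.
move=> hm uv vu hu hs hz; have h1 := index_le hm uv hu hs hz.
suff : ~~ (0 < (fun i j => - Zf i j) m m) by move: h1; lia.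
apply: (@index_le J m (fun i j => - Zf i j) hm v u vu) => [j hj f x|I hI cI|j hj ne]; last by rewrite hz ?oppr0.
  have e : f = rho (I := J :\ j) u (dOp (fun k => - Zf j k) f).
    apply: funext => y; rewrite hu // /dOp tzN; case: ifP => _; last by rewrite !mul1r.
    by rewrite mulVKf // tz_neq0.
  by rewrite {1}e -rhoM // vu rho1.
by apply: (idlV uv vu); apply: hs.
Qed.

(** * One layer of the factorisation *)

Section Step.
Variables (ordE ordJ : nat -> seq {set 'I_n}) (ordj : {set 'I_n} -> seq 'I_n).
Hypothesis HE : forall s, uniq (ordE s) /\ forall I, (I \in ordE s) = (#|I| == s) && lastin I.
Hypothesis HJ : forall s, uniq (ordJ s) /\ forall J, (J \in ordJ s) = (#|J| == s.+1) && lastin J.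
Hypothesis Hj : forall J, uniq (ordj J) /\ forall j, (j \in ordj J) = [&& j \in J, val j != n.-1 & val j != mJ J].

Lemma step s u : G s.+1 u -> exists a b u' : S, [/\ Thtil (ordJ s.+1) ordj (sval a), Etil (ordE s.+1) (sval b),
  u = a * (b * u') & G s.+2 u'].
Proof.
move=> hu; have [uu iu] := hu.
have hJl J : J \in ordJ s.+1 -> #|J| = s.+2 /\ nl \in J.
  by rewrite (HJ s.+1).2 lastinE => /andP[/eqP -> ->].
have hEl I : I \in ordE s.+1 -> #|I| = s.+1 /\ nl \in I.
  by rewrite (HE s.+1).2 lastinE => /andP[/eqP -> ->].
have [Z hZ] : {Z : {set 'I_n} -> 'I_n -> int & forall I, #|I| = s.+1 -> dexp I u (Z I)}.
  apply: (choice (P := fun I z => #|I| = s.+1 -> dexp I u z)) => I.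
  case: (pselect (#|I| = s.+1)) => [cI|h]; last by exists (fun _ => 0).
  have [|z hz] := dexp_ex (I := I) uu; last by exists z.
  by move=> J /proper_card; rewrite cI => cJ; apply: iu; rewrite cJ.
have hDX : DX s.+1 u Z by move=> I cI _; apply: hZ.
have [a [u1 [Z1 [a1 a2 a3 a4 a5]]]] := kill_J (fun J => (Hj J).2) hJl hu hDX.
have [b [u' [b1 b2 b3 b4 _]]] := red_list (HE s.+1).1 hEl a3 a4.
exists a, b, u'; split=> //; first by rewrite a2 b2.
have [uu' iu'] := b3; split=> // I.
case: (boolP ((#|I| < s.+1)%N || (nl \notin I))) => [h _|]; first exact: iu'.
rewrite negb_or negbK -leqNgt => /andP[cI1 nI]; rewrite nI orbF ltnS => cI2.
have cI : #|I| = s.+1 by apply/eqP; rewrite eqn_leq cI2.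
have mE I' : #|I'| = s.+1 -> nl \in I' -> I' \in ordE s.+1 by move=> h1 h2; rewrite (HE _).2 h1 eqxx lastinE.
suff z0 i : i \notin I -> Z1 I i = 0.
  move=> f x; rewrite b4 ?mE // /dOp (_ : tz I (Z1 I) = 1); first by case: ifP; rewrite mul1r.
  by rewrite /tz big1 // => i /z0 ->.
(* An exponent belongs to a set [I] and a variable [i] missing from it, that is, to the larger set
   [J] with the marked element [i]. *)
move=> iI; pose J := i |: I.
have iJ : i \in J by rewrite setU11.
have eI : J :\ i = I by rewrite setU1K.
have cJ : #|J| = s.+2 by rewrite cardsU1 iI cI.
have nJ : nl \in J by rewrite inE nI orbT.
have i_nl : i != nl by apply: contraNneq iI => ->.
have JL : J \in ordJ s.+1 by rewrite (HJ _).2 cJ eqxx lastinE.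
have Zk j : j \in J -> j != nl -> val j != mJ J -> Z1 (J :\ j) j = 0.
  by move=> h1 h2 h3; rewrite a5 // JL (Hj J).2 h1 -hnl val_eqE h2 h3.
(* Only the marked element of index [mJ J] was left untreated. On [J] without [nl] the unit is the
   identity and on the other faces the exponents are known to vanish, so the index applies. *)
case: (boolP (val i == mJ J)) => [/eqP im|im]; last by rewrite -{1}eI Zk.
have [v [uv vu]] := uu'.
have := @index_eq J i (fun j => if j == nl then fun _ => 0 else Z1 (J :\ j)) u' v iJ uv vu.
rewrite (negPf i_nl) eI; apply.
- move=> j hj f x; case: (j =P nl) f x => [->|/eqP ne] f x.
    by rewrite iu' ?notD1 ?orbT // /dOp tz0; case: ifP => _; rewrite mul1r.
  by apply: b4; apply: mE; rewrite ?(cardD1 hj cJ) // in_setD1 nJ andbT eq_sym.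
- by move=> I' _; rewrite cJ ltnS => h; apply: iu'; rewrite h.
- move=> j hj ne; case: (j =P nl) => [_|/eqP h] //; apply: Zk => //.
  by rewrite -im val_eqE.
Qed.
End Step.


Lemma SC_mono I J (h : elem K n) : J \subset I -> SC I h -> SC J h.
Proof.
move=> /subsetP hs; elim=> [g [j [hj hg]]||c f _ h1|f g _ h1 _ h2|f g _ h1 _ h2].
- by apply: sa_gen; exists j; split=> //; apply: contra hj; apply: hs.
- exact: sa_one.
- exact: sa_scale.
- exact: sa_add.
- exact: sa_mul.
Qed.
Lemma SC_pow I (a : S) k : SC I (sval a) -> SC I (sval (a ^+ k)).
Proof. by move=> h; elim: k => [|k IH]; [exact: sa_one|rewrite exprS; apply: SCM]. Qed.
Lemma SC_Es I s r j : j \notin I -> SC I (sval (Es K s r j)).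
Proof.
move=> hj; apply: SCD; last apply: SCN; apply: SCM; apply: SC_pow; by [apply: SC_X|apply: SC_Y].
Qed.

Lemma commutator_unip (R : pzRingType) (X Y : R) : X * X = 0 -> Y * Y = 0 -> Y * X = 0 ->
  (1 + X) * (1 + Y) * ((1 - X) * (1 - Y)) = 1 + X * Y.
Proof.
move=> XX YY YX0.
have e : (1 + X) * (1 + Y) = (1 + X * Y) * ((1 + Y) * (1 + X)).
  have -> : (1 + Y) * (1 + X) = 1 + (Y + X) by rewrite mulrDl mul1r mulrDr mulr1 YX0 addr0 -addrA [X + Y]addrC.
  rewrite [RHS]mulrDl mul1r [X * Y * _]mulrDr mulr1 [X * Y * (Y + X)]mulrDr -!mulrA YY YX0 !mulr0 !addr0.
  by rewrite mulrDl mul1r mulrDr mulr1 !addrA.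
have i1 Z : Z * Z = 0 -> (1 + Z) * (1 - Z) = 1 :> R.
  by move=> ZZ; rewrite mulrDl mul1r mulrBr mulr1 ZZ subr0 subrK.
by rewrite e -!mulrA [(1 + X) * _]mulrA i1 // mul1r i1 // mulr1.
Qed.

(* Whitehead's factorisation of [diag(1 + ab, (1 + ba)^-1)]. *)
Lemma whitehead (R : pzRingType) (A B A1 B1 Q : R) : A * A1 = 0 -> B * A1 = Q -> A * Q = A - A1 ->
  B1 * B = 0 -> B1 * A * B = B - B1 -> B1 * Q = 0 ->
  (1 - B1) * ((1 + A) * (1 + B) * (1 - A1)) = 1 + A * B - Q.
Proof.
move=> h1 h2 h3 h4 h5 h6.
have -> : (1 + A) * (1 + B) * (1 - A1) = 1 + B + A * B - Q.
  have -> : (1 + A) * (1 + B) * (1 - A1) = (1 + A) * (1 + B) - (A1 + A * A1 + (B * A1 + A * (B * A1))).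
    rewrite mulrBr mulr1; congr (_ - _); rewrite -mulrA mulrDl mul1r mulrDl mul1r mulrDr.
    by rewrite -!addrA; congr (_ + _); rewrite addrCA.
  rewrite h1 h2 h3 addr0 mulrDl mul1r mulrDr mulr1.
  have -> : A1 + (Q + (A - A1)) = Q + A by rewrite addrCA [A1 + _]addrC subrK.
  rewrite opprD [- Q - A]addrC addrA; congr (_ - _).
  by rewrite [A + _]addrC addrA addrK.
rewrite mulrBl mul1r mulrBr h6 subr0 !mulrDr mulr1 h4 addr0 mulrA h5 [B1 + _]addrC subrK.
by rewrite addrAC; congr (_ - _); rewrite [1 + B + _]addrAC addrK.
Qed.

(** * Absorbing the units of $1+F_n$ *)

Section Last.
Variable j : 'I_n.
Hypothesis jn : j != nl.
Let I0 : {set 'I_n} := setT :\ j.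
Let hn0 : nl \in I0. Proof. by rewrite !inE andbT eq_sym. Qed.
Let j0 : j \notin I0. Proof. exact: notD1. Qed.

Lemma gen_last (a : S) A B : SC setT (sval a) -> (exists i, i \in I0 /\ A i <> B i) ->
  Einf I0 (sval (1 + a * EA A B setT)).
Proof.
move=> ha h; rewrite (EA_D1 _ _ (in_setT j)) mulrA; apply: gen_Einf => //.
by apply: SCM; [apply: (SC_mono _ ha); apply: subsetT|apply: SC_Es].
Qed.
(** If the multi-indices differ at [j] only, the generator is a commutator of two generators through
    [C], which differs from both [A] and [B] at [nl]. *)
Lemma gen_last_any (a : S) A B : SC setT (sval a) -> (exists i, i \in [set: 'I_n] /\ A i <> B i) ->
  Einf I0 (sval (1 + a * EA A B setT)).
Proof.
move=> ha [i [_ hi]]; case: (pselect (exists i, i \in I0 /\ A i <> B i)) => [|h]; first exact: gen_last.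
have AB k : k \in I0 -> A k = B k by move=> hk; case: (pselect (A k = B k)) => // h'; case: h; exists k.
pose C k := (A k).+1.
have AC : exists k, k \in I0 /\ A k <> C k by exists nl; split=> //; rewrite /C; lia.
have CB : exists k, k \in I0 /\ C k <> B k by exists nl; split=> //; rewrite /C -AB //; lia.
have one1 : SC setT (sval (1 : S)) by apply: sa_one.
have E X Y X' Y' : a * EA X Y setT * EA X' Y' setT = if [forall (k | k \in setT), Y k == X' k] then a * EA X Y' setT else 0.
  by rewrite -mulrA EA_mul; case: ifP; rewrite ?mulr0.
have -> : a * EA A B setT = (a * EA A C setT) * EA C B setT by rewrite E; case: ifP => // /negP[]; apply/forall_inP.
have neq (X Y : 'I_n -> nat) k : X k <> Y k -> [forall (k | k \in [set: 'I_n]), X k == Y k] = false.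
  by move=> hk; apply/negbTE/negP => /forall_inP/(_ k (in_setT k))/eqP.
have [k1 [_ AC1]] := AC; have [k2 [_ CB2]] := CB.
rewrite -commutator_unip.
- apply: Einf_mul; apply: Einf_mul; first exact: gen_last.
  + by rewrite -[EA C B _]mul1r; apply: gen_last.
  + by rewrite -mulNr; apply: gen_last => //; apply: SCN.
  + by rewrite -[EA C B _]mul1r -mulNr; apply: gen_last => //; apply: SCN.
- by apply: gen_sq => //; exists k1.
- by rewrite EA_mul (neq B C k2) //; apply: nesym.
- by rewrite mulrA -SC_comm // E (neq B A i) //; apply: nesym.
Qed.
Lemma Einf_last (h : elem K n) : Einf setT h -> Einf I0 h.
Proof.
elim=> [|g h' [a [A [B [ha [hAB ->]]]]] hh' IH|g gi h' [a [A [B [ha [hAB ->]]]]] hgi e1 e2 hh' IH]; first exact: gg1.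
  have [a' [ea _]] := SC_S ha; rewrite -ea in ha *.
  have hS := Einf_Sn IH; rewrite EI_sval -[h']/(sval (exist _ h' hS : S)).
  by have := Einf_mul (gen_last_any ha hAB) (h := exist _ h' hS : S) IH.
have [a' [ea _]] := SC_S ha; rewrite -ea in ha e1 e2.
have hS := Einf_Sn IH; have [g1 g2] := gen_inv ha hAB.
have -> : gi = sval (1 - a' * EA A B setT).
  pose gi' : S := exist _ gi hgi.
  have e : (1 + a' * EA A B setT) * gi' = 1 by apply: SRP; rewrite sval1 -e1 EI_sval.
  have : (1 - a' * EA A B setT) * ((1 + a' * EA A B setT) * gi') = gi' by rewrite mulrA g2 mul1r.
  by rewrite e mulr1 => ->.
have ha' : SC setT (sval (- a')) by apply: SCN.
by have := Einf_mul (gen_last_any ha' hAB) (h := exist _ h' hS : S) IH; rewrite mulNr.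
Qed.

Let d1 : 'I_n -> nat := fun _ => 1%N.
Let m_mul (a b : S) A B C : SC I0 (sval b) -> a * EA A B I0 * (b * EA B C I0) = a * b * EA A C I0.
Proof.
move=> hb; rewrite mulrA -[_ * EA A B I0 * b]mulrA -SC_comm // mulrA -mulrA EA_mul.
by case: ifP => // /negP[]; apply/forall_inP.
Qed.
Let m_mul0 (a b : S) A B B' C : SC I0 (sval b) -> B nl != B' nl -> a * EA A B I0 * (b * EA B' C I0) = 0.
Proof.
move=> hb ne; rewrite mulrA -[_ * EA A B I0 * b]mulrA -SC_comm // mulrA -mulrA EA_mul.
by case: ifP => [/forall_inP/(_ nl hn0)|_]; rewrite ?(negPf ne) ?mulr0.
Qed.
(** Applied to the two constant multi-indices 0 and 1. The hypotheses say that [k] commutes with [a]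
    and [b] and inverts $1+ba$. *)
Lemma whitehead_Einf (a b k : S) : SC I0 (sval a) -> SC I0 (sval b) -> SC I0 (sval k) ->
  k * b = b * k -> k * a = a * k -> k * (b * a) = 1 - k ->
  Einf I0 (sval (1 + a * b * EA z0 z0 I0 + (k - 1) * EA d1 d1 I0)).
Proof.
move=> ha hb hk kb ka kba.
have n01 : exists i, i \in I0 /\ z0 i <> d1 i by exists nl.
have n10 : exists i, i \in I0 /\ d1 i <> z0 i by exists nl.
have hka : SC I0 (sval (k * a)) by apply: SCM.
have hkb : SC I0 (sval (k * b)) by apply: SCM.
have h1k : SC I0 (sval (1 - k)) by apply: SCD; [exact: sa_one|exact: SCN].
have -> : 1 + a * b * EA z0 z0 I0 + (k - 1) * EA d1 d1 I0 =
  1 + (a * EA z0 d1 I0) * (b * EA d1 z0 I0) - (1 - k) * EA d1 d1 I0.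
  by rewrite m_mul // -mulNr opprB.
rewrite -(@whitehead _ (a * EA z0 d1 I0) (b * EA d1 z0 I0) (k * a * EA z0 d1 I0) (k * b * EA d1 z0 I0)).
- apply: Einf_mul; first by rewrite -mulNr; apply: gen_Einf => //; apply: SCN.
  apply: Einf_mul; last by rewrite -mulNr; apply: gen_Einf => //; apply: SCN.
  by apply: Einf_mul; apply: gen_Einf.
- exact: m_mul0.
- by rewrite m_mul // mulrA -kb -[k * b * a]mulrA kba.
- by rewrite m_mul // mulrBr mulr1 -ka mulrBl.
- exact: m_mul0.
- by rewrite m_mul // m_mul // -[k * b * a]mulrA kba mulrBl mul1r mulrBl.
- exact: m_mul0.
Qed.
(** Two applications of Whitehead's lemma put [c] and [c'] at multi-index 1, where they cancel. At
    multi-index 0 the product is $c\,(1+(c^{-1}-1)x_jy_j)=1+(c-1)(1-x_jy_j)$, and $1-x_jy_j$ is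
    $e_j$. *)
Lemma muT_Einf l : l != 0 -> Einf I0 (sval (muS setT l)).
Proof.
move=> l0; pose c := scaleS l (1 : S); pose c' := scaleS l^-1 (1 : S); pose X := XS K j; pose Y := YS K j.
have cc' : c * c' = 1 by rewrite scaleSM divff // scaleS1.
have c'c : c' * c = 1 by rewrite scaleSM mulVf // scaleS1.
have cm u : c * u = u * c by apply: scaleS_comm.
have cm' u : c' * u = u * c' by apply: scaleS_comm.
have sc : SC I0 (sval c) by apply: SC_scale.
have sc' : SC I0 (sval c') by apply: SC_scale.
have sX : SC I0 (sval X) by apply: SC_X.
have sY : SC I0 (sval Y) by apply: SC_Y.
have s1 : SC I0 (sval (1 : S)) by apply: sa_one.
have sB (u v : S) : SC I0 (sval u) -> SC I0 (sval v) -> SC I0 (sval (u - v)).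
  by move=> h1 h2; apply: SCD => //; apply: SCN.
have sc1 := sB _ _ sc s1; have sc1' := sB _ _ sc' s1.
have e1 : c * (Y * ((c' - 1) * X)) = 1 - c.
  rewrite mulrA cm -mulrA [c * _]mulrA mulrBr mulr1 cc' mulrBl mul1r mulrBr YX.
  by rewrite [c * X]cm mulrA YX mul1r.
have h1 := @whitehead_Einf ((c' - 1) * X) Y c (SCM sc1' sX) sY sc (cm _) (cm _) e1.
have e2 : c' * (1 * (c - 1)) = 1 - c' by rewrite mul1r mulrBr mulr1 c'c.
have h2 := @whitehead_Einf (c - 1) 1 c' (sB _ _ sc s1) s1 sc' (cm' _) (cm' _) e2.
have := Einf_mul h1 h2; rewrite mulr1; congr (Einf _ (sval _)).
set u0 := EA z0 z0 I0; set u1 := EA d1 d1 I0; set p := (c' - 1) * X * Y.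
have uu : u0 * u0 = u0 by apply: eS_idem.
have uu1 : u1 * u1 = u1 by rewrite EA_mul; case: ifP => // /negP[]; apply/forall_inP.
have sp (q r : S) : SC I0 (sval r) -> 1 + q * u0 + r * u1 = (1 + q * u0) * (1 + r * u1).
  by move=> hr; rewrite mulrDl mul1r [q * u0 * _]mulrDr mulr1 m_mul0 // addr0 addrAC.
have sw (q r : S) : SC I0 (sval q) -> SC I0 (sval r) -> (1 + r * u1) * (1 + q * u0) = (1 + q * u0) * (1 + r * u1).
  move=> hq hr; rewrite -sp // mulrDl mul1r [r * u1 * _]mulrDr mulr1 m_mul0 // addr0.
  by [].
rewrite !sp // mulrA -[X in X * _]mulrA sw // mulrA -mulrA.
rewrite !idem_mul ?uu ?uu1 //; try by rewrite mulrBr mulrBl mulr1 mul1r ?cm ?cm'.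
rewrite pred_mul cc' subrr mul0r addr0 mulr1.
rewrite /muS /eS (EA_D1 _ _ (in_setT j)) -/I0 -/u0 mulrA; congr (1 + _ * u0).
have -> : Es K (z0 j) (z0 j) j = 1 - X * Y by rewrite /Es /z0 !expr0 !expr1 mul1r.
rewrite -/c; have -> : (c - 1) * (1 - X * Y) = (c - 1) - (c - 1) * (X * Y) by rewrite mulrBr mulr1.
have -> : p + (c - 1) + p * (c - 1) = (c - 1) + p * c.
  by rewrite mulrBr mulr1 [p + _]addrC -addrA [p + _]addrC subrK.
have -> // : p * c = - ((c - 1) * (X * Y)).
by rewrite -cm /p !mulrA mulrBr mulr1 cc' -!mulNr opprB.
Qed.

(** On the full set no variable is left to form a monomial, so [reduce] describes [u] completely,
    and [faith] turns equal operators into equal elements. *)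
Lemma Gn_Einf u : G n u -> Einf I0 (sval u).
Proof.
move=> [uu iu]; have iu' J : J \proper setT -> idl J u.
  by move=> /proper_card; rewrite cardsT card_ord => h; apply: iu; rewrite h.
have [z hz] := dexp_ex uu iu'.
have [g [g1 _ _ g4]] := reduce (exist _ nl (in_setT nl) : ix [set: 'I_n]) hz.
have -> : u = g.
  apply: (faith ht) => f x; rewrite g4; apply: eq_rho => y; rewrite /dOp (_ : tz setT z = 1) ?if_same ?mul1r //.
  by rewrite /tz big1 // => i; rewrite inE.
case: g1 => a [b [[l [l0 ->]] [hb ->]]]; have hb' := Einf_last hb.
rewrite -muS_sval.
by have := Einf_mul (muT_Einf l0) (h := exist _ b (Einf_Sn hb) : S) hb'.
Qed.
End Last.

Lemma Einf_S I (h : elem K n) : Einf I h -> exists g : S, [/\ sval g = h, uS g & forall J, ~~ (I \subset J) -> idl J g].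
Proof.
elim=> [|g h' [a [A [B [ha [hAB ->]]]]] hh' [g' [<- g1 g2]]|g gi h' [a [A [B [ha [hAB ->]]]]] hgi e1 e2 hh' [g' [<- g1 g2]]].
- by exists 1; split=> //; [exact: uS1|move=> J _; exact: idl1].
- have [a' [ea _]] := SC_S ha; rewrite -ea in ha *; have hi := gen_inv ha hAB.
  exists ((1 + a' * EA A B I) * g'); split; first by rewrite svalM svalD svalM sval1 EI_sval.
    by apply: uSM => //; exists (1 - a' * EA A B I).
  by move=> J hJ; apply: idlM; [apply: idl_EA|apply: g2].
have [a' [ea _]] := SC_S ha; rewrite -ea in ha e1 e2.
pose gi' : S := exist _ gi hgi.
have E1 : (1 + a' * EA A B I) * gi' = 1 by apply: SRP; rewrite sval1 -e1 EI_sval.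
have E2 : gi' * (1 + a' * EA A B I) = 1 by apply: SRP; rewrite sval1 -e2 EI_sval.
exists (gi' * g'); split=> //; first by apply: uSM => //; exists (1 + a' * EA A B I).
by move=> J hJ; apply: idlM; [apply: (idlV E1 E2); apply: idl_EA|apply: g2].
Qed.
Lemma UE_S I (h : elem K n) : prodset (UI I) (Einf I) h ->
  exists g : S, [/\ sval g = h, uS g & forall J, ~~ (I \subset J) -> idl J g].
Proof.
case=> a [b [[l [l0 ->]] [/Einf_S[g [<- g1 g2]] ->]]]; rewrite -muS_sval.
exists (muS I l * g); split=> //; first by apply: uSM => //; apply: muS_unit.
by move=> J hJ; apply: idlM; [apply: idl_EA|apply: g2].
Qed.
Lemma Etil_S L (h : elem K n) : Etil L h -> exists g : S, sval g = h.
Proof.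
elim: L h => [|I L IH] h /=; first by move=> ->; exists 1.
by case=> a [b [/UE_S[g [<- _ _]] [/IH[g' <-] ->]]]; exists (g * g').
Qed.
Lemma Etil_absorb L I (h g : S) : Etil (rcons L I) (sval h) -> Einf I (sval g) -> Etil (rcons L I) (sval (h * g)).
Proof.
move=> + hg; elim: L h => [|I' L IH] h /=.
  case=> a [b [[a1 [a2 [[l [l0 ea1]] [ha2 ea]]]] [eb eh]]].
  have [g2 [eg2 _ _]] := Einf_S ha2; rewrite /singl1 in eb.
  have {}eh : h = muS I l * g2 by apply: SRP; rewrite eh ea ea1 eb -eg2 -muS_sval -sval1 -!svalM mulr1.
  exists (sval (muS I l * (g2 * g))), (@one K n); split; last first.
    by split=> //; rewrite -[mul (sval h) (sval g)]/(sval (h * g)) eh -sval1 -svalM mulr1 mulrA.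
  exists (sval (muS I l)), (sval (g2 * g)); split; first by exists l; rewrite muS_sval.
  by split=> //; apply: Einf_mul => //; rewrite eg2.
case=> a [b [ha [hb eh]]]; have [a' [ea _ _]] := UE_S ha; have [b' eb] := Etil_S hb.
have {}eh : h = a' * b' by apply: SRP; rewrite eh -ea -eb.
exists a, (sval (b' * g)); split=> //; split; first by apply: IH; rewrite eb.
by rewrite -[mul (sval h) (sval g)]/(sval (h * g)) eh -ea -svalM mulrA.
Qed.

Lemma G_Etil s L (h : elem K n) : (forall I, I \in L -> #|I| = s /\ nl \in I) -> Etil L h ->
  exists2 g : S, sval g = h & G s g.
Proof.
elim: L h => [|I L IH] h hL /=; first by move=> ->; exists 1; last exact: G1.
have [cI nI] := hL I (mem_head _ _).
case=> a [b [/UE_S[g [<- g1 g2]] [/IH hb ->]]].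
have [|g' <- Gg'] := hb; first by move=> J hJ; apply: hL; rewrite inE hJ orbT.
exists (g * g') => //; apply: GM => //; split=> // J hJ; apply: g2; apply: (notsub _ nI hJ).
by rewrite cI.
Qed.

(** * Assembling the factorisation *)

Section Main.
Variables (ordE ordJ : nat -> seq {set 'I_n}) (ordj : {set 'I_n} -> seq 'I_n).
Hypothesis HE : forall s, uniq (ordE s) /\ forall I, (I \in ordE s) = (#|I| == s) && lastin I.
Hypothesis HJ : forall s, uniq (ordJ s) /\ forall J, (J \in ordJ s) = (#|J| == s.+1) && lastin J.
Hypothesis Hj : forall J, uniq (ordj J) /\ forall j, (j \in ordj J) = [&& j \in J, val j != n.-1 & val j != mJ J].

Lemma hEl s I : I \in ordE s -> #|I| = s /\ nl \in I.
Proof. by rewrite (HE s).2 lastinE => /andP[/eqP -> ->]. Qed.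
Lemma hJl s J : J \in ordJ s -> #|J| = s.+1 /\ nl \in J.
Proof. by rewrite (HJ s).2 lastinE => /andP[/eqP -> ->]. Qed.

Lemma G_Thtil s (h : elem K n) : Thtil (ordJ s.+1) ordj h -> exists2 g : S, sval g = h & G s.+1 g.
Proof.
have : forall J, J \in ordJ s.+1 -> #|J| = s.+2 /\ nl \in J by move=> J; apply: hJl.
elim: (ordJ s.+1) h => [|J L IH] h hL /=; first by move=> ->; exists 1; last exact: G1.
have [cJ nJ] := hL J (mem_head _ _); have [m [m1 m2 m3]] := mJ_ex cJ nJ.
case=> a [b [ha [/IH hb ->]]].
have [|g' <- Gg'] := hb; first by move=> J' hJ'; apply: hL; rewrite inE hJ' orbT.
suff [g <- Gg] : exists2 g : S, sval g = a & G s.+1 g by exists (g * g'); last exact: GM.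
have : forall j, j \in ordj J -> j \in J /\ j != nl.
  by move=> j; rewrite (Hj J).2 -hnl val_eqE => /and3P[].
elim: (ordj J) a ha => [|j l IH2] a /=; first by move=> -> _; exists 1; last exact: G1.
case=> a1 [a2 [[z ->] [/IH2 h2 ->]]] hl.
have [|g <- Gg] := h2; first by move=> j' hj'; apply: hl; rewrite inE hj' orbT.
have [hj jn] := hl j (mem_head _ _).
have t1 : thS m j J * thS j m J = 1 by apply: thS_inv.
have t2 : thS j m J * thS m j J = 1 by apply: thS_inv.
rewrite -m3 thS_sval (zpow_sval _ t1 t2).
by exists (zpw (thS m j J) (thS j m J) z * g) => //; apply: GM => //; apply: Gzpw => //; apply: G_th.
Qed.
Lemma G_tail k s (h : elem K n) : tailF ordE ordJ ordj k s.+1 h -> exists2 g : S, sval g = h & G s.+1 g.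
Proof.
elim: k s h => [|k IH] s h /=; first by move=> ->; exists 1; last exact: G1.
case=> a [b [/G_Thtil[a' <- Ga] [[c [d [hc [/IH[d' <- Gd] ->]]]] ->]]].
have [c' <- Gc] := G_Etil (@hEl s.+1) hc.
by exists (a' * (c' * d')) => //; apply: GM => //; apply: GM => //; apply: G_le Gd.
Qed.
Lemma tail_G k s u : (s.+1 + k.+1)%N = n -> G s.+1 u -> tailF ordE ordJ ordj k.+1 s.+1 (sval u).
Proof.
elim: k s u => [|k IH] s u hs hu; have [a [b [u' [h1 h2 -> h4]]]] := step HE HJ Hj hu.
  (* In the base case the sets of the layer have $n-1$ elements. The rest [u'] lies in $1+F_n$ and
     is merged into the factor of the last set in the list. *)
  have [j hj] : exists j : 'I_n, j != nl.
    have h0 : (0 < n)%N by lia.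
    by exists (Ordinal h0); rewrite -val_eqE hnl /=; lia.
  have mI : setT :\ j \in ordE s.+1.
    rewrite (HE s.+1).2 lastinE !inE andbT [nl == j]eq_sym hj andbT; apply/eqP.
    by apply: cardD1 => //; rewrite cardsT card_ord; lia.
  have [L [I EL]] : exists L I, ordE s.+1 = rcons L I.
    by case: (lastP (ordE s.+1)) mI => [|L I] // _; exists L, I.
  rewrite EL in h2; have [cI nI] : #|I| = s.+1 /\ nl \in I by apply: hEl; rewrite EL mem_rcons mem_head.
  have [i hi] : exists i, i \notin I.
    have : I \proper setT by rewrite properEcard subsetT cardsT card_ord cI; lia.
    by case/properP=> _ [i _ hi]; exists i.
  have eI : I = setT :\ i.
    apply/eqP; rewrite eqEcard; apply/andP; split.
      by apply/subsetP => x hx; rewrite !inE andbT; apply: contraNneq hi => <-.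
    have cT : #|[set: 'I_n]| = s.+2 by rewrite cardsT card_ord; lia.
    by rewrite cI (cardD1 (in_setT i) cT).
  have ni : i != nl by apply: contraNneq hi => ->.
  have hE : Einf I (sval u') by rewrite eI; apply: Gn_Einf => //; apply: G_le h4; lia.
  exists (sval a), (sval (b * u')); split=> //; split=> //.
  exists (sval (b * u')), (@one K n); split; first by rewrite EL; apply: Etil_absorb.
  by split=> //; rewrite -sval1 -svalM mulr1.
exists (sval a), (sval (b * u')); split=> //; split=> //.
by exists (sval b), (sval u'); split=> //; split=> //; apply: IH => //; lia.
Qed.
(** The two elements of [J] are [nl] and the one of index [mJ J], so no admissible [j] remains. *)
Lemma Thtil1 (h : elem K n) : Thtil (ordJ 1) ordj h -> h = @one K n.
Proof.
have : forall J, J \in ordJ 1 -> #|J| = 2 /\ nl \in J by move=> J; apply: hJl.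
elim: (ordJ 1) h => [|J L IH] h hL //=; have [cJ nJ] := hL J (mem_head _ _).
have [m [m1 m2 m3]] := mJ_ex cJ nJ.
have -> : ordj J = [::].
  case E: (ordj J) => [|j l] //; have : j \in ordj J by rewrite E mem_head.
  rewrite (Hj J).2 -hnl -m3 !val_eqE => /and3P[h1 h2 h3].
  have c1 : #|J :\ nl| = 1%N by apply: cardD1.
  have mJ1 : m \in J :\ nl by rewrite !inE m2.
  have := cardD1 mJ1 c1 => /eqP; rewrite cards_eq0 => /eqP/setP/(_ j).
  by rewrite !inE h1 h2 h3.
case=> a [b [/= -> [/IH hb ->]]]; rewrite hb; last by move=> J' hJ'; apply: hL; rewrite inE hJ' orbT.
by rewrite -sval1 -svalM mulr1.
Qed.
Lemma Thtil_1 (LJ : seq {set 'I_n}) : Thtil LJ ordj (@one K n).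
Proof.
have m1 : @one K n = mul (@one K n) (@one K n) by rewrite -sval1 -svalM mulr1.
elim: LJ => [|J L IH] //=; exists (@one K n), (@one K n); split=> //.
elim: (ordj J) => [|j l IH2] //=; exists (@one K n), (@one K n); split=> //.
by exists 0%Z.
Qed.
(** [tailF] begins every layer with a Theta factor; at level 1, where the theorem has none, this
    factor is trivial. *)
Lemma first_factor k (h : elem K n) :
  prodset (Thtil (ordJ 1) ordj) (prodset (Etil (ordE 1)) (tailF ordE ordJ ordj k 2)) h <->
  prodset (Etil (ordE 1)) (tailF ordE ordJ ordj k 2) h.
Proof.
have hS b : prodset (Etil (ordE 1)) (tailF ordE ordJ ordj k 2) b -> mul (@one K n) b = b.
  case=> c [d [/Etil_S[c' <-] [/G_tail[d' <- _] ->]]].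
  by rewrite -svalM -sval1 -svalM mul1r.
split=> [[a [b [/Thtil1 -> [hb ->]]]]|hh]; first by rewrite hS.
by exists (@one K n), h; split; [exact: Thtil_1|rewrite hS].
Qed.
End Main.

Lemma idl_ker I u : idl I u <-> forall f x, rho (I := I) (u - 1) f x = 0.
Proof.
split=> h f x; first by rewrite rhoB rho1 h subrr.
by apply/eqP; rewrite -subr_eq0; have := h f x; rewrite rhoB rho1 => ->.
Qed.
Lemma ker_val I (w : S) (h : elem K n) : sval w = h -> (exists w' : S, sval w' = h /\ forall f x, rho (I := I) w' f x = 0) ->
  forall f x, rho (I := I) w f x = 0.
Proof. by move=> e [w' [e' hw']]; rewrite (SRP (etrans e (esym e'))). Qed.

Lemma unitsPE (u : elem K n) : unitsP u <-> exists2 w : S, sval w = u & G 1 w.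
Proof.
split=> [[hu hp]|[w <- [uw iw]]].
  have [hS _] := hu; pose w : S := exist _ u hS; exists w => //; split; first by apply/isunitE.
  move=> I hI; apply/idl_ker; apply: (@ker_val I (w - 1) (add u (opp (@one K n)))) => //.
  (* A subset of size below 1 is empty and thus also avoids [nl]. *)
  have nI : nl \notin I by case/orP: hI => //; rewrite ltnS leqn0 cards_eq0 => /eqP ->; rewrite inE.
  by apply: (idealg_ker ht nI); rewrite hnl.
split; first by apply/isunitE.
rewrite -sval1 -svalN -svalD /unitsP -hnl; apply: (p_mem ht) => I hI.
by apply/idl_ker; apply: iw; rewrite hI orbT.
Qed.
Lemma unitsPsE s (u : elem K n) : (0 < s)%N -> unitsPs s u <-> exists2 w : S, sval w = u & G s w.
Proof.
move=> s0; split=> [[/unitsPE[w <- [uw iw]] [_ ha]]|[w <- Gw]].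
  exists w => //; split=> // I /orP[hI|hI]; last by apply: iw; rewrite hI orbT.
  apply/idl_ker; apply: (@ker_val I (w - 1) (add (sval w) (opp (@one K n)))) => //.
  exact: (asum_ker ht hI ha).
split; first by apply/unitsPE; exists w => //; apply: G_le Gw.
have [uw iw] := Gw; split; first by apply/isunitE.
rewrite -sval1 -svalN -svalD; apply: (asum_mem ht) => I hI.
by apply/idl_ker; apply: iw; rewrite hI.
Qed.
Lemma FnE (u : elem K n) : oneplus (@Fn K n) u <-> exists2 w : S, sval w = u & G n w.
Proof.
have E I : (#|I| < n)%N || (nl \notin I) = (I != setT).
  apply/idP/idP => [/orP[|] h|h].
  - by apply: contraTneq h => ->; rewrite cardsT card_ord ltnn.
  - by apply: contraNneq h => ->; rewrite inE.
  - have : I \proper [set: 'I_n] by rewrite properEneq h subsetT.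
    by move=> /proper_card; rewrite cardsT card_ord => ->.
split=> [[hu hp]|[w <- [uw iw]]].
  have [hS _] := hu; pose w : S := exist _ u hS; exists w => //; split; first by apply/isunitE.
  move=> I; rewrite E => hI; apply/idl_ker; apply: (@ker_val I (w - 1) (add u (opp (@one K n)))) => //.
  exact: (Fn_ker ht hI hp).
split; first by apply/isunitE.
rewrite -sval1 -svalN -svalD; apply: (Fn_mem ht) => I hI.
by apply/idl_ker; apply: iw; rewrite E.
Qed.
End Reduction.

(** * Existence of algebraically independent elements *)

Section Transcendental.
Import GRing.Theory.
Local Open Scope ring_scope.
Section Map.
Variables (K F F' : fieldType) (io : {rmorphism K -> F}) (phi : {rmorphism F -> F'}).
Variable io' : {rmorphism K -> F'}.
Hypothesis io'E : forall k, io' k = phi (io k).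
Let hK : sring (Kp io). Proof. by case: (Kp_sfield io). Qed.
Lemma laur_map ts x : chain (Kp io) ts -> laur (Kp io') (map phi ts) x -> exists2 y, laur (Kp io) ts y & x = phi y.
Proof.
move=> hc; have hL := laur_sring ts hK.
apply: (@laur_min _ (Kp io') (fun x => exists2 y, laur (Kp io) ts y & x = phi y)).
- split.
  + by exists 1; [exact: sring1|rewrite rmorph1].
  + by move=> _ _ [a ha ->] [b hb ->]; exists (a - b); [exact: sringB|rewrite rmorphB].
  + by move=> _ _ [a ha ->] [b hb ->]; exists (a * b); [exact: sringM|rewrite rmorphM].
- by move=> _ [k ->]; exists (io k); [apply: laur_base => //; exists k|].
- move=> _ /mapP[s hs ->]; have s0 := chain_neq0 hK hc hs.
  have [h1 h2] := laur_gen hK hs s0; split; first by rewrite fmorph_eq0.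
    by exists s.
  by exists s^-1 => //; rewrite fmorphV.
Qed.
Lemma po_map ts p : chain (Kp io) ts -> po (laur (Kp io') (map phi ts)) p ->
  exists2 q, po (laur (Kp io) ts) q & p = map_poly phi q.
Proof.
move=> hc hp; have hL := laur_sring ts hK.
have [y hy] : {y : nat -> F & forall i, laur (Kp io) ts (y i) /\ p`_i = phi (y i)}.
  by apply: (choice (P := fun i z => laur (Kp io) ts z /\ p`_i = phi z)) => i; have [z h1 h2] := laur_map hc (hp i); exists z.
exists (\poly_(i < size p) y i).
  by move=> i; rewrite coef_poly; case: ifP => _; [exact: (hy i).1|exact: sring0].
apply/polyP => i; rewrite coef_map coef_poly; case: ltnP => hi; first exact: (hy i).2.
by rewrite nth_default //; apply/esym; apply: rmorph0.
Qed.
(** The coefficients of a relation in the larger field all come from the smaller one, so the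
    relation can be pulled back along the embedding. *)
Lemma chain_map ts : chain (Kp io) ts -> chain (Kp io') (map phi ts).
Proof.
elim: ts => //= s ts IH [hc hs]; split; first exact: IH.
move=> p /(po_map hc)[q hq ->]; rewrite horner_map => /eqP; rewrite fmorph_eq0 => /eqP /(hs q hq) ->.
by rewrite rmorph0.
Qed.
End Map.

Lemma chain_ex (K : fieldType) n : exists (F : fieldType) (io : {rmorphism K -> F}) (ts : seq F),
  size ts = n /\ chain (Kp io) ts.
Proof.
elim: n => [|n [F [io [ts [sz hc]]]]]; first by exists K, idfun, [::].
pose phi : {rmorphism F -> {fraction {poly F}}} := (@tofrac {poly F} \o @polyC F)%FUN.
pose io' : {rmorphism K -> {fraction {poly F}}} := (phi \o io)%FUN.
exists {fraction {poly F}}, io', (tofrac 'X :: map phi ts); split; first by rewrite /= size_map sz.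
split; first by apply: chain_map hc.
move=> p /(@po_map _ _ _ io phi io' (fun _ => erefl) _ _ hc)[q hq ->].
have -> : (map_poly phi q).[tofrac 'X] = tofrac q.
  have -> : map_poly phi q = map_poly (@tofrac {poly F}) (map_poly polyC q) by rewrite -map_poly_comp.
  by rewrite horner_map; congr tofrac; rewrite -[RHS]comp_polyXr.
by move=> /eqP; rewrite tofrac_eq0 => /eqP ->; rewrite rmorph0.
Qed.

Lemma chain_ord (K : fieldType) n : exists (F : fieldType) (io : {rmorphism K -> F}) (t : 'I_n -> F),
  chain (Kp io) (map t (enum 'I_n)).
Proof.
have [F [io [ts [sz hc]]]] := chain_ex K n; exists F, io, (fun i => ts`_i).
rewrite (_ : map _ _ = ts) //; apply: (@eq_from_nth _ 0) => [|i]; rewrite size_map size_enum_ord //.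
move=> hi; case: n sz hi {hc} => // n sz hi.
by rewrite (nth_map ord0) ?size_enum_ord // nth_enum_ord.
Qed.
End Transcendental.

Theorem theorem3p3 (K : fieldType) (n : nat) (hn : (2 <= n)%N)
  (ordE : nat -> seq {set 'I_n})
  (HE : forall s, uniq (ordE s) /\
        forall I, (I \in ordE s) = (#|I| == s) && lastin I)
  (ordJ : nat -> seq {set 'I_n})
  (HJ : forall s, uniq (ordJ s) /\
        forall J, (J \in ordJ s) = (#|J| == s.+1) && lastin J)
  (ordj : {set 'I_n} -> seq 'I_n)
  (Hj : forall J, uniq (ordj J) /\
        forall j, (j \in ordj J) = [&& j \in J, val j != n.-1 & val j != mJ J]) :
  (forall u : elem K n,
     unitsP u <-> prodset (Etil (ordE 1%N)) (tailF ordE ordJ ordj (n - 2) 2) u)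
  /\ (forall s, (2 <= s <= n - 1)%N -> forall u : elem K n,
        unitsPs s u <-> tailF ordE ordJ ordj (n - s) s u)
  /\ (forall u : elem K n, unitsPs n u <-> oneplus (@Fn K n) u).
Proof.
have [F [io [t ht]]] := chain_ord K n.
have hnl0 : (n.-1 < n)%N by lia.
pose nl := Ordinal hnl0; have hnl : val nl = n.-1 by [].
(* Level 1 is included, where the filtration imposes no condition beyond [unitsP]; with
   [first_factor] it gives the first claim. *)
have U s (u : elem K n) : (0 < s < n)%N -> unitsPs s u <-> tailF ordE ordJ ordj (n - s) s u.
  move=> /andP[s0 sn]; rewrite (unitsPsE ht hnl) //; case: s s0 sn => // s _ sn; split=> [[w <- Gw]|].
    have -> : (n - s.+1 = (n - s.+2).+1)%N by lia.
    by apply: (tail_G ht hnl HE HJ Hj) => //; lia.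
  exact: (G_tail ht hnl HE HJ Hj).
split; last split.
- move=> u; transitivity (unitsPs 1 u).
    by rewrite (unitsPE ht hnl) (unitsPsE ht hnl).
  rewrite U; last by lia.
  have -> : (n - 1 = (n - 2).+1)%N by lia.
  exact: (first_factor ht hnl HE HJ Hj).
- by move=> s /andP[h1 h2] u; apply: U; lia.
- by move=> u; rewrite (FnE ht nl); apply: (unitsPsE ht hnl); lia.
Qed.
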